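(* Let $L_1=\varepsilon_{1,2}+\varepsilon_{3,4}\in\mathfrak{sl}_4(\mathbb C)$ (nilpotent of type $[2,2]$), $h=\tfrac12(\varepsilon_{1,1}-\varepsilon_{2,2}+\varepsilon_{3,3}-\varepsilon_{4,4})$, $f=\varepsilon_{2,1}+\varepsilon_{4,3}$, and let $Q$ be the Slodowy slice $L_1+\mathfrak g^f$ with coordinates $z_1,\dots,z_7$: $$q=\begin{pmatrix}\frac1{\sqrt2}z_2&1&\frac1{\sqrt2}(z_5-z_6)&0\\ z_1+z_3&\frac1{\sqrt2}z_2&z_4+z_7&\frac1{\sqrt2}(z_5-z_6)\\ \frac1{\sqrt2}(z_5+z_6)&0&-\frac1{\sqrt2}z_2&1\\ z_7-z_4&\frac1{\sqrt2}(z_5+z_6)&z_1-z_3&-\frac1{\sqrt2}z_2\end{pmatrix}.$$ Let $\mathbb B_2^{\mathcal Q}$ be the associated classical $W$-algebra on the loop space of $Q$, let $N=\{z_4=z_5=z_6=z_7=0\}\subset Q$, and let $\mathbb B_2^{\mathcal N}$ be its Dirac reduction to the loop space $\mathcal N$ of $N$. On the open set $z_2\neq0$ of $N$ put $e=-\partial_{z_1}+z_2^{-1}\partial_{z_2}$ and use the coordinates $t_1=z_1+\tfrac12z_2^2$, $t_2=\tfrac12z_2^2$, $t_3=z_3$. Then: (1) $e=\partial_{t_2}$. In the coordinates $t$, $\mathbb B_2^{\mathcal N}$ admits a dispersionless limit, has $S_{2;1}^{ab}=0$, and $$\Omega_2(t)=\begin{pmatrix}2t_1&2t_2&2t_3\\2t_2&2t_2&0\\2t_3&0&2t_1-2t_2\end{pmatrix},\qquad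 S_{2;2}(t)=\begin{pmatrix}-\tfrac12&0&0\\0&0&0\\0&0&-\tfrac12\end{pmatrix}.$$ (2) $\mathfrak L_e^2\mathbb B_2^{\mathcal N}=0$, and $\mathbb B_2^{\mathcal N}$ and $\overline{\mathbb B}_1^{\mathcal N}:=\mathfrak L_e\mathbb B_2^{\mathcal N}$ are compatible local Poisson structures. They form an exact Poisson pencil admitting a dispersionless limit. (3) The pair $(\Omega_2,\overline\Omega_1)$, where $$\overline\Omega_1:=\mathfrak L_e\Omega_2=\begin{pmatrix}0&2&0\\2&2&0\\0&0&-2\end{pmatrix},$$ is a regular quasihomogeneous flat pencil of metrics of degree $0$. It consists of the intersection form $\Omega_2$ and the flat contravariant metric $\overline\Omega_1$ of the Dubrovin-Frobenius manifold with flat coordinates $(t_1,t_2,t_3)$, unit $e=\partial_{t_2}$, potential $$\mathbb F=\tfrac1{12}t_1^3-\tfrac14t_2t_1^2+\tfrac14t_2^2t_1+\tfrac14t_3^2t_1-\tfrac14t_2t_3^2$$ and Euler vector field $E=\sum_it_i\partial_{t_i}$, where $E\mathbb F=3\mathbb F$. This structure is trivial: the Frobenius algebra on the tangent space does not depend on the point. (4) The central invariants of the bihamiltonian structure $(\mathbb B_2^{\mathcal N},\overline{\mathbb B}_1^{\mathcal N})$ are $0,-\tfrac1{48},-\tfrac1{48}$. In particular this bihamiltonian structure is not of topological type.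
   Context: All objects are complex. $\varepsilon_{i,j}$ is the matrix unit and $\mathfrak g^a=\ker\mathrm{ad}_a$. **$W$-algebra.** Let $\mathfrak g=\mathfrak{sl}_n$ with $\mathfrak{sl}_2$-triple $(L_1,h,f)$: $[h,L_1]=L_1$, $[h,f]=-f$, $[L_1,f]=2h$. Let $\langle\cdot|\cdot\rangle$ be the multiple of the trace form with $\langle L_1|f\rangle=1$. Write $Q=L_1+\mathfrak g^f\ni q=L_1+\sum z_iX_i$, where $X_i$ is the basis of $\mathfrak g^f$ read off from the coordinates. The loop space $\mathcal Q=L_1+\mathfrak L(\mathfrak g^f)$ consists of smooth maps $q:S^1\to Q$. For a functional $\mathcal I$ on $\mathcal Q$ and $q\in\mathcal Q$, let $\overline{\delta\mathcal I}$ be the unique smooth map $S^1\to\mathfrak g$ with $\langle\overline{\delta\mathcal I}|X_i\rangle=\delta\mathcal I/\delta z_i$ for all $i$ and $\partial_x\overline{\delta\mathcal I}+[q,\overline{\delta\mathcal I}]\in\mathfrak g^f$ pointwise. The classical $W$-algebra bracket $\mathbb B_2^{\mathcal Q}$ is $\{\mathcal F,\mathcal I\}_2=\int_{S^1}\langle\overline{\delta\mathcal F}|\partial_x\overline{\delta\mathcal I}+[q,\overline{\delta\mathcal I}]\rangle dx$. **Reduction to $N$.** $N\subset Q$ is the coordinate subspace where certain coordinates $z_\alpha$ vanish (in the source it is the space of common equilibrium points). All brackets $\{z_a(x),z_\alpha(y)\}_2$ between a remaining coordinate $z_a$ and a vanishing coordinate $z_\alpha$ vanish on $\mathcal N$,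 so the Dirac reduction $\mathbb B_2^{\mathcal N}$ is given by the brackets $\{z_a(x),z_b(y)\}_2$ of the remaining coordinates restricted to $z_\alpha=0$. **Local brackets.** In coordinates $t$ on $N$ a local Poisson bracket has the form $\{t_a(x),t_b(y)\}_m=\sum_{k\ge-1}\{t_a(x),t_b(y)\}_m^{[k]}$ (finite sum). Here the $[k]$ term is homogeneous of differential degree $k+1$, where the degree counts $x$-derivatives of $t$ and of $\delta=\delta(x-y)$. Explicitly $[-1]$: $F_m^{ab}(t)\delta$; $[0]$: $\Omega_m^{ab}(t)\delta'+\Gamma^{ab}_{m,k}(t)t_{k,x}\delta$; $[k]$, $k>0$: $S^{ab}_{m;k}(t)\delta^{(k+1)}+\cdots$. Coefficients are evaluated at $x$. It admits a dispersionless limit if $F_m=0$. For a vector field $e$ on $N$ equal to $\partial_{t_k}$ in coordinates $t$, $\mathfrak L_e$ acts on local brackets by differentiating all coefficients (functions of $t$ and its $x$-derivatives) with respect to $t_k$. Two Poisson structures are compatible if all linear combinations are Poisson. The pair $(\mathbb B_2,\mathbb B_1)$ is an exact Poisson pencil if $\mathfrak L_e\mathbb B_2=\mathbb B_1$ and $\mathfrak L_e\mathbb B_1=0$ for some $e$. **Flat pencils.** A contravariant metric is a symmetric bilinear form on $T^*N$ invertible on a dense open set. It is flat if the inverse metric is flat. Its contravariant Christoffel symbols are $\Gamma^{ij}_k=-\Omega^{im}\Gamma^j_{mk}$. $(\Omega_2,\Omega_1)$ is a flat pencil if both are flat and, for generic constant $\lambda$, $\Omega_2+\lambda\Omega_1$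 is flat with contravariant Christoffel symbols $\Gamma^{ij}_{2k}+\lambda\Gamma^{ij}_{1k}$. It is quasihomogeneous of degree $d$ if there is a function $\tau$ such that $E^i=\Omega_2^{ij}\partial_j\tau$ and $e^i=\Omega_1^{ij}\partial_j\tau$ satisfy $[e,E]=e$, $\mathfrak L_E\Omega_2=(d-1)\Omega_2$, $\mathfrak L_e\Omega_2=\Omega_1$, $\mathfrak L_e\Omega_1=0$. It is regular if the $(1,1)$-tensor $R_i^j=\tfrac{d-1}2\delta_i^j+\nabla_{1\,i}E^j$ is nondegenerate, where $\nabla_1$ is the Levi-Civita connection of $\Omega_1$. **Dubrovin-Frobenius manifolds.** In flat coordinates $t$ with unit $e=\partial_{t_k}$, a potential $\mathbb F$ determines the flat metric $\Pi_{ij}=\partial_{t_k}\partial_{t_i}\partial_{t_j}\mathbb F$ (constant, invertible, with inverse $\Omega_1^{ij}$) and the product with structure constants $\Omega_1^{kp}\partial_p\partial_i\partial_j\mathbb F$, which is required to be associative (WDVV). The Euler field $E$ is affine in $t$ with $E\mathbb F=(3-d)\mathbb F+$ (polynomial of degree $\le2$), and $d$ is the charge. The intersection form is $\Omega_2^{ij}=E^p\,\Omega_1^{ik}\Omega_1^{jm}\partial_p\partial_k\partial_m\mathbb F$. **Central invariants.** Let $\Psi(\lambda;t)=\det(\Omega_2-\lambda\Omega_1)$ have generically distinct roots $u^i$ (with $\Omega_1=\overline\Omega_1$ here). When the $[1]$ terms vanish, the central invariants are $$c_i=\frac13\Big[\frac{d\Psi}{d\lambda}\Big]^2\frac{\partial_k\Psi\,\partial_l\Psi\,(S_{2;2}^{kl}-\lambda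 S_{1;2}^{kl})}{[\partial_k\Psi\,\partial_l\Psi\,\Omega_1^{kl}]^2}\Big|_{\lambda=u^i},\qquad\partial_k=\partial/\partial t_k ,$$ where $S_{1;2}=\mathfrak L_eS_{2;2}$ (entrywise derivative along $e=\partial_{t_k}$) is the corresponding coefficient of the first bracket. The bihamiltonian structure is called of topological type if all central invariants are constant and equal. *)

(* Defs.v *)
From HB Require Import structures.
From mathcomp Require Import all_boot all_order all_algebra.
From mathcomp Require Import complex.
From mathcomp Require Import all_classical all_reals all_analysis.

Set Implicit Arguments.
Unset Strict Implicit.
Unset Printing Implicit Defensive.

Import Order.TTheory GRing.Theory Num.Theory.
Import numFieldNormedType.Exports.

Local Open Scope classical_set_scope.
Local Open Scope ring_scope.
Local Open Scope complex_scope.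

(* The pointwise notions are stated over an arbitrary [K : numClosedFieldType]
   and used at the complex numbers [R[i]], [R : realType].  All indices start
   at 0, so that z_1, ..., z_7 are [z 0 0], ..., [z 0 6]. *)

Definition mx_of {K : nzRingType} {n : nat} (s : seq (seq K)) : 'M[K]_n :=
  \matrix_(i, j) nth 0 (nth [::] s i) j.

(** * The Slodowy slice of type [2,2] in sl_4 *)

Section Slice.
Context {K : numClosedFieldType}.

Definition L1 : 'M[K]_4 := delta_mx 0 1 + delta_mx 2 3.
Definition hmx : 'M[K]_4 :=
  2^-1 *: (delta_mx 0 0 - delta_mx 1 1 + delta_mx 2 2 - delta_mx 3 3).
Definition fmx : 'M[K]_4 := delta_mx 1 0 + delta_mx 3 2.

Definition brk (A B : 'M[K]_4) : 'M[K]_4 := A *m B - B *m A.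

(* the multiple of the trace form for which <L_1|f> = 1 *)
Definition form (A B : 'M[K]_4) : K := \tr (A *m B) / \tr (L1 *m fmx).

Lemma sl2_triple :
  [/\ brk hmx L1 = L1, brk hmx fmx = - fmx & brk L1 fmx = 2 *: hmx].
Proof.
have n2 : 2 != 0 :> K by rewrite pnatr_eq0.
split; last 1 first.
- rewrite /hmx scalerA divff // scale1r /brk /L1 /fmx.
  rewrite !(mulmxDl, mulmxDr, mulmxN, mulNmx) !mul_delta_mx_cond /= !mulr0n !mulr1n.
  by rewrite !(add0r, addr0) opprD addrACA addrA.
- apply: (can_inj (scalerK n2)).
  rewrite /brk /hmx -scalemxAl -scalemxAr -scalerBr scalerA divff // scale1r /L1.
  rewrite !(mulmxDl, mulmxDr, mulmxN, mulNmx) !mul_delta_mx_cond /= !mulr0n !mulr1n.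
  by rewrite !(add0r, addr0, oppr0, sub0r, opprD, opprK, subr0) -mulr2n -scaler_nat.
- apply: (can_inj (scalerK n2)).
  rewrite /brk /hmx -scalemxAl -scalemxAr -scalerBr scalerA divff // scale1r /fmx.
  rewrite !(mulmxDl, mulmxDr, mulmxN, mulNmx) !mul_delta_mx_cond /= !mulr0n !mulr1n.
  by rewrite !(add0r, addr0, oppr0, sub0r, opprD, opprK, subr0) -mulr2n -scaler_nat.
Qed.

Definition in_sl4 (A : 'M[K]_4) : Prop := \tr A = 0.

Definition in_gf (A : 'M[K]_4) : Prop := in_sl4 A /\ brk fmx A = 0.

Definition qmx (z : 'rV[K]_7) : 'M[K]_4 :=
  let r := sqrtC 2 in
  mx_of
  [:: [:: z 0 1 / r;             1;                     (z 0 4 - z 0 5) / r; 0];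
      [:: z 0 0 + z 0 2;         z 0 1 / r;             z 0 3 + z 0 6;       (z 0 4 - z 0 5) / r];
      [:: (z 0 4 + z 0 5) / r;   0;                     - (z 0 1 / r);       1];
      [:: z 0 6 - z 0 3;         (z 0 4 + z 0 5) / r;   z 0 0 - z 0 2;       - (z 0 1 / r)]].

(* the basis of g^f dual to the coordinates: q = L_1 + \sum_i z_i X_i *)
Definition Xb (i : 'I_7) : 'M[K]_4 := qmx (delta_mx 0 i) - L1.

End Slice.

(** * Smooth loops and functionals

    S^1 is R/Z: a loop is a 1-periodic function on [R].  Complex-valued
    functions of a real variable are differentiated and integrated through
    their real and imaginary parts. *)

Section Loops.
Context {R : realType}.
Notation C := R[i].

Definition smooth_loop (f : R -> C) : Prop :=
  (forall x, f (x + 1) = f x) /\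
  forall k x, derivable (derive1n k (@complex.Re R \o f)) x 1 /\
              derivable (derive1n k (@complex.Im R \o f)) x 1.

Definition dx (f : R -> C) (x : R) : C :=
  derive1 (@complex.Re R \o f) x +i* derive1 (@complex.Im R \o f) x.

Definition cint (f : R -> C) : C :=
  (\int[lebesgue_measure]_(x in `[0%R, 1%R]) complex.Re (f x)) +i*
  (\int[lebesgue_measure]_(x in `[0%R, 1%R]) complex.Im (f x)).

Definition is_cderive (f : R -> C) (s : R) (l : C) : Prop :=
  is_derive s 1 (@complex.Re R \o f) (complex.Re l) /\
  is_derive s 1 (@complex.Im R \o f) (complex.Im l).

Definition mloop {m n : nat} (A : R -> 'M[C]_(m, n)) : Prop :=
  forall i j, smooth_loop (fun x => A x i j).

Definition mdx {m n : nat} (A : R -> 'M[C]_(m, n)) (x : R) : 'M[C]_(m, n) :=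
  \matrix_(i, j) dx (fun y => A y i j) x.

(* A functional is a map on loops; its values on non-smooth or non-periodic
   functions are never used. *)
Definition functional (n : nat) := (R -> 'rV[C]_n) -> C.

(* [v] is the variational derivative (delta F / delta q_i)_i of [F] at [q].
   The variations [w] are complex and the pairing is C-bilinear, so a real
   parameter [s] suffices. *)
Definition is_gradient {n : nat} (F : functional n) (q v : R -> 'rV[C]_n) : Prop :=
  mloop v /\
  forall w : R -> 'rV[C]_n, mloop w ->
    is_cderive (fun s : R => F (fun x => q x + s%:C *: w x)) 0
               (cint (fun x => \sum_i v x 0 i * w x 0 i)).

Definition gradient {n : nat} (F : functional n) (q : R -> 'rV[C]_n) :
    R -> 'rV[C]_n :=
  xget (fun=> 0) [set v | is_gradient F q v].

(** * The classical W-algebra bracket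

    A loop in Q is given by its coordinates [z : R -> 'rV_7]. *)

Definition is_delta_bar (F : functional 7) (z : R -> 'rV[C]_7)
    (A : R -> 'M[C]_4) : Prop :=
  [/\ mloop A, forall x, in_sl4 (A x),
      is_gradient F z (fun x => \row_i form (A x) (Xb i)) &
      forall x, in_gf (mdx A x + brk (qmx (z x)) (A x))].

Definition delta_bar (F : functional 7) (z : R -> 'rV[C]_7) : R -> 'M[C]_4 :=
  xget (fun=> 0) [set A | is_delta_bar F z A].

Definition bracketQ (F G : functional 7) : functional 7 := fun z =>
  cint (fun x => form (delta_bar F z x)
    (mdx (delta_bar G z) x + brk (qmx (z x)) (delta_bar G z x))).

(** * Dirac reduction to N = {z_4 = z_5 = z_6 = z_7 = 0} *)

Definition inclN (z : R -> 'rV[C]_3) : R -> 'rV[C]_7 :=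
  fun x => row_mx (z x) (0 : 'rV[C]_4).

Definition projN (q : R -> 'rV[C]_7) : R -> 'rV[C]_3 :=
  fun x => @lsubmx C 1 3 4 (q x).

(* The brackets between a coordinate z_1, z_2, z_3 and a coordinate
   z_4, ..., z_7 vanish on loops in N. *)
Definition mixed_brackets_vanish : Prop :=
  forall (z : R -> 'rV[C]_3) (F G : functional 7)
         (v : R -> 'rV[C]_3) (w : R -> 'rV[C]_4),
    mloop z ->
    is_gradient F (inclN z) (fun x => row_mx (v x) (0 : 'rV[C]_4)) ->
    is_gradient G (inclN z) (fun x => row_mx (0 : 'rV[C]_3) (w x)) ->
    bracketQ F G (inclN z) = 0 /\ bracketQ G F (inclN z) = 0.

(* Given that the mixed brackets vanish, the Dirac reduction consists of the
   brackets of z_1, z_2, z_3 restricted to N: extend functionals to Q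
   independently of z_4, ..., z_7 and evaluate on loops in N. *)
Definition bracketN (F G : functional 3) : functional 3 := fun z =>
  bracketQ (F \o projN) (G \o projN) (inclN z).

End Loops.

(** * Coordinates on N *)

Section PartialDerivatives.
Context {K : numClosedFieldType} {n : nat}.

Definition pd (k : 'I_n) (f : 'rV[K]_n -> K) (t : 'rV[K]_n) : K :=
  'D_(delta_mx 0 k) f t.

(* for [U] open, complex differentiability on [U] is holomorphy *)
Definition holo (U : set 'rV[K]_n) (f : 'rV[K]_n -> K) : Prop :=
  forall t, U t -> differentiable f t.

Definition open_dense_in (U V : set 'rV[K]_n) : Prop :=
  [/\ open V, V `<=` U & U `<=` closure V].

End PartialDerivatives.

Section Coordinates.
Context {K : numClosedFieldType}.

Definition tmap (z : 'rV[K]_3) : 'rV[K]_3 :=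
  \row_a [:: z 0 0 + 2^-1 * z 0 1 ^+ 2; 2^-1 * z 0 1 ^+ 2; z 0 2]`_a.

Definition tjac (z : 'rV[K]_3) : 'M[K]_3 :=
  \matrix_(a, i) pd i (fun y => tmap y 0 a) z.

(* the components of e = - d/dz_1 + z_2^-1 d/dz_2 *)
Definition evec (z : 'rV[K]_3) : 'rV[K]_3 :=
  - delta_mx 0 0 + (z 0 1)^-1 *: delta_mx 0 1.

Definition tdom : set 'rV[K]_3 := [set t | t 0 1 != 0].

End Coordinates.

(** * Local brackets *)

Section LocalBrackets.
Context {K : numClosedFieldType} {n : nat}.

(* a jet lists the values of t, t_x, t_xx, ... *)
Definition jet := nat -> 'rV[K]_n.

Definition jet0 (t : 'rV[K]_n) : jet := fun s => if s == 0%N then t else 0.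

Inductive diffpoly : (jet -> K) -> Prop :=
| diffpoly_const c : diffpoly (fun=> c)
| diffpoly_var s a : diffpoly (fun u => u s 0 a)
| diffpoly_add f g : diffpoly f -> diffpoly g -> diffpoly (fun u => f u + g u)
| diffpoly_mul f g : diffpoly f -> diffpoly g -> diffpoly (fun u => f u * g u).

(* [lb_coef P d j a b] is the coefficient of delta^(j)(x - y) in the part of
   differential degree [d] of {t_a(x), t_b(y)}, i.e. in the term [k] with
   k = d - 1; terms with [d > lb_top P] are absent. *)
Record bracket_expr := BracketExpr {
  lb_top : nat;
  lb_coef : nat -> nat -> 'I_n -> 'I_n -> jet -> K }.

Definition is_local (P : bracket_expr) : Prop :=
  [/\ forall d j a b, diffpoly (lb_coef P d j a b),
      forall d j a b (mu : K) (u : jet), (j <= d)%N ->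
        lb_coef P d j a b (fun s => mu ^+ s *: u s) =
        mu ^+ (d - j) * lb_coef P d j a b u &
      forall d j a b (u : jet), (d < j)%N || (lb_top P < d)%N ->
        lb_coef P d j a b u = 0].

(* the coefficient of delta^(d) in degree d, a function of t alone:
   d = 0 is F, d = 1 is Omega, and d = k + 1 is S_k *)
Definition lead (P : bracket_expr) (d : nat) (t : 'rV[K]_n) : 'M[K]_n :=
  \matrix_(a, b) lb_coef P d d a b (jet0 t).

Definition dispersionless (U : set 'rV[K]_n) (P : bracket_expr) : Prop :=
  forall t, U t -> lead P 0 t = 0.

(* the terms of degree d, i.e. the [d-1] terms, vanish *)
Definition degree_vanishes (U : set 'rV[K]_n) (P : bracket_expr) (d : nat) : Prop :=
  forall j a b (u : jet), U (u 0%N) -> lb_coef P d j a b u = 0.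

(* derivative with respect to t_k at fixed t_x, t_xx, ... *)
Definition pdjet (k : 'I_n) (f : jet -> K) (u : jet) : K :=
  derive1 (fun c : K =>
    f (fun s => if s == 0%N then u 0%N + c *: delta_mx 0 k else u s)) 0.

Definition lb_lie (k : 'I_n) (P : bracket_expr) : bracket_expr :=
  BracketExpr (lb_top P) (fun d j a b => pdjet k (lb_coef P d j a b)).

Definition lb_comb (l : K) (P : bracket_expr) (m : K) (P' : bracket_expr) :=
  BracketExpr (maxn (lb_top P) (lb_top P'))
    (fun d j a b u => l * lb_coef P d j a b u + m * lb_coef P' d j a b u).

Definition lb_eq (U : set 'rV[K]_n) (P P' : bracket_expr) : Prop :=
  forall d j a b (u : jet), U (u 0%N) -> lb_coef P d j a b u = lb_coef P' d j a b u.

Definition lb_eq0 (U : set 'rV[K]_n) (P : bracket_expr) : Prop :=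
  forall d, degree_vanishes U P d.

End LocalBrackets.

Arguments jet : clear implicits.
Arguments bracket_expr : clear implicits.

Section Poisson.
Context {R : realType} {n : nat}.
Notation C := R[i].

Definition jet_of (t : R -> 'rV[C]_n) (x : R) : jet C n :=
  fun s => \row_a iter s dx (fun y => t y 0 a) x.

(* \int {t_a(x), t_b(y)} g_b(y) dy, since
   \int delta^(j)(x - y) g(y) dy is the j-th derivative of g at x *)
Definition lb_op (P : bracket_expr C n) (t g : R -> 'rV[C]_n) (a : 'I_n) (x : R) : C :=
  \sum_(d < (lb_top P).+1) \sum_(j < d.+1) \sum_b
    lb_coef P d j a b (jet_of t x) * iter j dx (fun y => g y 0 b) x.

(* \int\int f_a(x) {t_a(x), t_b(y)} g_b(y) dx dy *)
Definition lb_pair (P : bracket_expr C n) (t f g : R -> 'rV[C]_n) : C :=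
  cint (fun x => \sum_a f x 0 a * lb_op P t g a x).

Definition lb_bracket (P : bracket_expr C n) (F G : @functional R n) :
    functional n :=
  fun t => lb_pair P t (gradient F t) (gradient G t).

(* densities polynomial in the jet, with smooth dependence on x; the linear
   ones \sum_a c_a(x) t_a give the identities for the kernels
   {t_a(x), t_b(y)} themselves *)
Inductive density : (R -> jet C n -> C) -> Prop :=
| density_coef c : smooth_loop c -> density (fun x _ => c x)
| density_var s a : density (fun _ u => u s 0 a)
| density_add f g : density f -> density g -> density (fun x u => f x u + g x u)
| density_mul f g : density f -> density g -> density (fun x u => f x u * g x u).

Definition local_functional (F : @functional R n) : Prop :=
  exists2 f, density f & F = fun t => cint (fun x => f x (jet_of t x)).

Definition poisson (U : set 'rV[C]_n) (P : bracket_expr C n) : Prop :=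
  is_local P /\
  forall F G H, local_functional F -> local_functional G -> local_functional H ->
  forall t : R -> 'rV[C]_n, mloop t -> (forall x, U (t x)) ->
    lb_bracket P F G t = - lb_bracket P G F t /\
    lb_bracket P F (lb_bracket P G H) t + lb_bracket P G (lb_bracket P H F) t
      + lb_bracket P H (lb_bracket P F G) t = 0.

Definition compatible (U : set 'rV[C]_n) (P P' : bracket_expr C n) : Prop :=
  forall l m : C, poisson U (lb_comb l P m P').

(* exact with respect to e = d/dt_k *)
Definition exact_poisson_pencil (U : set 'rV[C]_n) (k : 'I_n)
    (P2 P1 : bracket_expr C n) : Prop :=
  [/\ poisson U P2, poisson U P1, compatible U P2 P1,
      lb_eq U (lb_lie k P2) P1 & lb_eq0 U (lb_lie k P1)].

End Poisson.

(* [P] is the expression of [bracketN] in the coordinates t on the open set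
   z_2 <> 0: delta F/delta z_i = \sum_a (dt_a/dz_i) delta F/delta t_a, with
   [f], [g] the variational derivatives in the coordinates t. *)
Definition represents_bracketN {R : realType} (P : bracket_expr R[i] 3) : Prop :=
  forall (z f g : R -> 'rV[R[i]]_3) (F G : functional 3),
    mloop z -> (forall x, z x 0 1 != 0) -> mloop f -> mloop g ->
    is_gradient F z (fun x => f x *m tjac (z x)) ->
    is_gradient G z (fun x => g x *m tjac (z x)) ->
    bracketN F G z = lb_pair P (fun x => tmap (z x)) f g.

(** * Flat pencils of metrics

    All notions are taken in a coordinate chart with open domain [U]. *)

Section FlatPencils.
Context {K : numClosedFieldType} {n : nat}.
Implicit Types (U : set 'rV[K]_n) (O : 'rV[K]_n -> 'M[K]_n).

Definition contra_metric U O : Prop :=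
  [/\ forall i j, holo U (fun t => O t i j),
      forall t, U t -> (O t)^T = O t &
      exists2 V, open_dense_in U V & forall t, V t -> O t \in unitmx].

(* Gamma^j_{mk} of the Levi-Civita connection of the metric inverse to O *)
Definition christoffel O (j m k : 'I_n) (t : 'rV[K]_n) : K :=
  let g i l := fun s => invmx (O s) i l in
  2^-1 * \sum_l O t j l * (pd m (g l k) t + pd k (g l m) t - pd l (g m k) t).

(* Gamma^{ij}_k *)
Definition contra_christoffel O (i j k : 'I_n) (t : 'rV[K]_n) : K :=
  - \sum_m O t i m * christoffel O j m k t.

(* the curvature R^i_{jkl} of the metric inverse to O *)
Definition riemann O (i j k l : 'I_n) (t : 'rV[K]_n) : K :=
  pd k (christoffel O i l j) t - pd l (christoffel O i k j) t
  + \sum_m (christoffel O i k m t * christoffel O m l j t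
            - christoffel O i l m t * christoffel O m k j t).

Definition flat_metric U O : Prop :=
  contra_metric U O /\
  forall t, U t -> O t \in unitmx -> forall i j k l, riemann O i j k l t = 0.

Definition pencil O2 O1 (l : K) : 'rV[K]_n -> 'M[K]_n :=
  fun t => O2 t + l *: O1 t.

(* generic [l] means all but finitely many *)
Definition flat_pencil U O2 O1 : Prop :=
  [/\ flat_metric U O2, flat_metric U O1 &
      exists s : seq K, forall l, l \notin s ->
        flat_metric U (pencil O2 O1 l) /\
        forall t, U t -> O2 t \in unitmx -> O1 t \in unitmx ->
          pencil O2 O1 l t \in unitmx ->
          forall i j k, contra_christoffel (pencil O2 O1 l) i j k t =
            contra_christoffel O2 i j k t + l * contra_christoffel O1 i j k t].

Definition lie_bivector (X : 'rV[K]_n -> 'rV[K]_n) O (t : 'rV[K]_n) : 'M[K]_n :=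
  \matrix_(i, j) \sum_k (X t 0 k * pd k (fun s => O s i j) t
    - O t k j * pd k (fun s => X s 0 i) t - O t i k * pd k (fun s => X s 0 j) t).

Definition lie_vector (X Y : 'rV[K]_n -> 'rV[K]_n) (t : 'rV[K]_n) : 'rV[K]_n :=
  \row_i \sum_k (X t 0 k * pd k (fun s => Y s 0 i) t
                 - Y t 0 k * pd k (fun s => X s 0 i) t).

Definition grad_vector O (tau : 'rV[K]_n -> K) (t : 'rV[K]_n) : 'rV[K]_n :=
  \row_i \sum_j O t i j * pd j tau t.

Definition quasihomogeneous U O2 O1 (d : K) (tau : 'rV[K]_n -> K) : Prop :=
  let E := grad_vector O2 tau in
  let e := grad_vector O1 tau in
  holo U tau /\ forall t, U t ->
    [/\ lie_vector e E t = e t, lie_bivector E O2 t = (d - 1) *: O2 t,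
        lie_bivector e O2 t = O1 t & lie_bivector e O1 t = 0].

Definition regular_tensor O2 O1 (d : K) (tau : 'rV[K]_n -> K) (t : 'rV[K]_n) :
    'M[K]_n :=
  let E := grad_vector O2 tau in
  ((d - 1) / 2)%:M + \matrix_(i, j)
    (pd i (fun s => E s 0 j) t + \sum_m christoffel O1 j i m t * E t 0 m).

Definition regular_qh_flat_pencil U O2 O1 (d : K) : Prop :=
  flat_pencil U O2 O1 /\
  exists tau, quasihomogeneous U O2 O1 d tau /\
    forall t, U t -> O1 t \in unitmx -> regular_tensor O2 O1 d tau t \in unitmx.

(** * Dubrovin-Frobenius manifolds in flat coordinates *)

Implicit Types (F : 'rV[K]_n -> K) (E : 'rV[K]_n -> 'rV[K]_n) (eta : 'M[K]_n).

Definition pd3 F (i j k : 'I_n) : 'rV[K]_n -> K := pd i (pd j (pd k F)).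

(* d/dt_i . d/dt_j = \sum_k frob_mul F eta i j k t * d/dt_k *)
Definition frob_mul F eta (i j k : 'I_n) (t : 'rV[K]_n) : K :=
  \sum_p eta k p * pd3 F p i j t.

Definition frob_metric F (k : 'I_n) (t : 'rV[K]_n) : 'M[K]_n :=
  \matrix_(i, j) pd3 F k i j t.

Definition euler_action E F (t : 'rV[K]_n) : K := \sum_i E t 0 i * pd i F t.

(* potential [F], unit d/dt_k, flat contravariant metric [eta],
   Euler field [E], charge [d] *)
Definition frobenius_manifold U F (k : 'I_n) eta E (d : K) : Prop :=
  [/\ holo U F,
      eta \in unitmx /\ forall t, U t -> frob_metric F k t = invmx eta,
      forall t, U t -> forall i j l m,
        \sum_s frob_mul F eta i j s t * frob_mul F eta s l m t =
        \sum_s frob_mul F eta j l s t * frob_mul F eta i s m t,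
      exists (A : 'M[K]_n) (b : 'rV[K]_n), forall t, U t -> E t = t *m A + b &
      exists (A : 'M[K]_n) (b : 'rV[K]_n) (c : K), forall t, U t ->
        euler_action E F t = (3 - d) * F t
          + (t *m A *m t^T) 0 0 + (t *m b^T) 0 0 + c].

Definition intersection_form F eta E (t : 'rV[K]_n) : 'M[K]_n :=
  \matrix_(i, j) \sum_p \sum_k \sum_m E t 0 p * eta i k * eta j m * pd3 F p k m t.

Definition trivial_frobenius U F (k : 'I_n) eta : Prop :=
  forall t t', U t -> U t' -> frob_metric F k t = frob_metric F k t' /\
    forall i j m, frob_mul F eta i j m t = frob_mul F eta i j m t'.

End FlatPencils.

(** * Central invariants *)

Section CentralInvariants.
Context {K : numClosedFieldType} {n : nat}.
Implicit Types (U : set 'rV[K]_n) (P : bracket_expr K n).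

Definition Psi P2 P1 (l : K) (t : 'rV[K]_n) : K :=
  \det (lead P2 1 t - l *: lead P1 1 t).

(* \sum_{kl} d_k Psi d_l Psi M^{kl} *)
Definition dPsi_form P2 P1 (l : K) (t : 'rV[K]_n) (M : 'M[K]_n) : K :=
  \sum_i \sum_j pd i (Psi P2 P1 l) t * pd j (Psi P2 P1 l) t * M i j.

(* the S_2 coefficient of a bracket is [lead _ 3] *)
Definition cinv P2 P1 (l : K) (t : 'rV[K]_n) : K :=
  3^-1 * derive1 (fun m : K => Psi P2 P1 m t) l ^+ 2 *
  (dPsi_form P2 P1 l t (lead P2 3 t - l *: lead P1 3 t) /
   dPsi_form P2 P1 l t (lead P1 1 t) ^+ 2).

(* The [c i] are the central invariants attached to the roots [r i].  The
   formula [cinv] presupposes that the [1] terms vanish. *)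
Definition central_invariants U P2 P1 (r c : 'I_n -> 'rV[K]_n -> K) : Prop :=
  [/\ degree_vanishes U P2 2 /\ degree_vanishes U P1 2,
      forall i, holo U (r i),
      forall t, U t -> forall l, Psi P2 P1 l t = 0 <-> exists i, l = r i t,
      open_dense_in U [set t | U t /\ injective (r^~ t)] &
      forall t, U t -> injective (r^~ t) -> forall i,
        dPsi_form P2 P1 (r i t) t (lead P1 1 t) != 0 /\
        c i t = cinv P2 P1 (r i t) t].

Definition topological_type U P2 P1 : Prop :=
  exists r (c0 : K), central_invariants U P2 P1 r (fun _ _ => c0).

End CentralInvariants.

(** * The data of the example *)

Section Example.
Context {K : numClosedFieldType}.

Definition FF (t : 'rV[K]_3) : K :=
  let t1 := t 0 0 in let t2 := t 0 1 in let t3 := t 0 2 in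
  t1 ^+ 3 / 12 - t2 * t1 ^+ 2 / 4 + t2 ^+ 2 * t1 / 4 + t3 ^+ 2 * t1 / 4
  - t2 * t3 ^+ 2 / 4.

Definition Omega2 (t : 'rV[K]_3) : 'M[K]_3 :=
  let t1 := t 0 0 in let t2 := t 0 1 in let t3 := t 0 2 in
  mx_of [:: [:: 2 * t1; 2 * t2; 2 * t3];
            [:: 2 * t2; 2 * t2; 0];
            [:: 2 * t3; 0; 2 * t1 - 2 * t2]].

Definition Omega1 : 'M[K]_3 :=
  mx_of [:: [:: 0; 2; 0]; [:: 2; 2; 0]; [:: 0; 0; -2]].

Definition S22 : 'M[K]_3 :=
  mx_of [:: [:: - 2^-1; 0; 0]; [:: 0; 0; 0]; [:: 0; 0; - 2^-1]].

End Example.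

(* Main.v *)
Require Import Defs.
From HB Require Import structures.
From mathcomp Require Import all_boot all_order all_algebra.
From mathcomp Require Import complex ring.
From mathcomp Require Import all_classical all_reals all_analysis.
Set Implicit Arguments.
Unset Strict Implicit.
Unset Printing Implicit Defensive.
Import Order.TTheory GRing.Theory Num.Theory.
Import numFieldNormedType.Exports.
Local Open Scope classical_set_scope.
Local Open Scope ring_scope.
Local Open Scope complex_scope.

(** The functions y_0 = t_2, y_1 = t_1 - t_2 + t_3, y_2 = t_1 - t_2 - t_3 are
    linear in t and decouple everything.  In these coordinates the reduced
    bracket is a sum of three commuting brackets of Virasoro type, the first one
    without central term: the Hamiltonian operator of y_q is
      c_q (phi_q d/dx + phi_q' / 2) + kappa_q d^3/dx^3,  phi_q = y_q,
    with c = (2, 4, 4) and kappa = (0, -1, -1), and e = d/dt_2 moves y_q at the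
    constant rate m_q, where m = (1, -1, -1).  The claims are proved for all
    decoupled brackets of this form ([vir]), in any number of variables and with
    phi_q = nu y_q + mu_q.  This family is closed under linear combinations and
    under the Lie derivative along a coordinate field, which turns
    (kappa, nu, mu) into (0, 0, nu m): hence compatibility and exactness follow
    once every member of the family is Poisson.

    Where the reduced bracket comes from.  On N the matrix q consists of two
    diagonal 2x2 blocks.  The operator d/dx + [q, .] preserves the splitting of
    4x4 matrices into block diagonal and block off-diagonal ones, and these are
    orthogonal for the trace form.  The equations for the matrix variational
    derivative make it block diagonal for functionals of z_1, z_2, z_3 and
    off-diagonal for functionals of z_4, ..., z_7, so the mixed brackets vanish
    ([mixed_brackets]).  In the block diagonal case these equations determine the
    matrix entry by entry from the gradient ([dbar]).  Each block contributes a
    multiple of the second KdV operator 2 u d + u' - d^3/2 with u = z_1 + z_3 or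
    u = z_1 - z_3, and the traces of the blocks contribute d/dx in the variable
    z_2, which is 2 t_2 d + t_2' in the variable t_2 = z_2^2/2 ([bracketNE], [represents_vir]).

    The Jacobi identity ([poisson_vir]).  Let P be the Hamiltonian operator at t
    and let g, h be the gradients of G, H.  The gradient of {G, H} is
    Dg(P h) - Dh(P g) plus a vector of Wronskians of the components of g and h,
    which comes from the dependence of P on t ([bracket_gradient]).  In the cyclic
    sum the Hessian terms cancel, because Hessians are symmetric and P is skew.
    The Wronskian terms form the integral of a total derivative
    ([virop_jacobi]).  Existence and symmetry of the Hessians follow from
    expansions along the paths t + s w ([dop_variation], [local_gradient]);
    gradients are unique because the integral of |f|^2 vanishes only for f = 0.

    The geometry.  The dispersionless part is the contravariant metric with
    diagonal entries c_q phi_q in the coordinates y, and the q-th entry depends on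
    y_q only.  So the curvature vanishes, and the contravariant Christoffel
    symbols are nu c_q / 2, linear along the pencil
    ([riemann_dmetric], [contra_christoffel_dmetric]).  The function tau is
    the sum of the y_q / c_q; its gradients are the Euler field and e.  The
    potential is the sum of the y_q^3 / (6 c_q m_q^2), so its third derivatives,
    which are the structure constants, do not depend on the point.  The roots of
    Psi are y_q / m_q; in the formula for the central invariants the
    values of the remaining factors of Psi cancel, which leaves
    kappa_q / (3 c_q^2), that is 0, -1/48, -1/48 ([central_invariants_vir]). *)

(** * Smooth loops *)

Section SmoothReal.
Context {R : realType}.
Implicit Types f g : R -> R.

(** All derivatives up to the order [k.+1] exist.  The recursion peels the
    derivatives off at the function, and so gives inductive proofs for sums and
    products, for which the iterates [derive1n] are inconvenient. *)
Inductive Cn : nat -> (R -> R) -> Prop :=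
| Cn_O f : (forall x, derivable f x 1) -> Cn 0 f
| Cn_S k f : (forall x, derivable f x 1) -> Cn k (derive1 f) -> Cn k.+1 f.

Lemma Cn_derivable k f : Cn k f -> forall x, derivable f x 1.
Proof. by case. Qed.

Lemma Cn_derive k f : Cn k.+1 f -> Cn k (derive1 f).
Proof. by move=> h; inversion h. Qed.

Lemma CnP f : (forall k x, derivable (derive1n k f) x 1) <-> (forall k, Cn k f).
Proof.
split=> [h k|h k].
  elim: k f h => [|k IH] f h; first exact: Cn_O (h 0%N).
  apply: Cn_S (h 0%N) _; apply: IH => j x.
  by rewrite /derive1n -iterSr; exact: (h j.+1).
elim: k f h => [|k IH] f h x; first exact: Cn_derivable (h 0%N) x.
by rewrite /derive1n iterSr; apply: (IH (derive1 f)) => j; exact/Cn_derive/h.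
Qed.

Lemma CnS k f : Cn k.+1 f -> Cn k f.
Proof.
elim: k f => [|k IH] f h; first exact/Cn_O/Cn_derivable/h.
by apply: (Cn_S (Cn_derivable h)); apply: IH; exact: Cn_derive.
Qed.

Lemma derive1D f g : (forall x, derivable f x 1) -> (forall x, derivable g x 1) ->
  derive1 (f \+ g) = (derive1 f) \+ (derive1 g).
Proof.
move=> df dg; apply/funext => x.
by rewrite /= !derive1E (deriveD (df x) (dg x)).
Qed.

Lemma derive1M f g : (forall x, derivable f x 1) -> (forall x, derivable g x 1) ->
  derive1 (f \* g) = ((derive1 f) \* g) \+ (f \* (derive1 g)).
Proof.
move=> df dg; apply/funext => x; rewrite /= !derive1E (deriveM (df x) (dg x)).
by rewrite addrC; congr (_ + _); exact: mulrC.
Qed.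

Lemma derive1N f : (forall x, derivable f x 1) -> derive1 (\- f) = \- (derive1 f).
Proof.
by move=> df; apply/funext => x; rewrite /= !derive1E (deriveN (df x)).
Qed.

Lemma derivable_add f g : (forall x, derivable f x 1) -> (forall x, derivable g x 1) ->
  forall x, derivable (f \+ g) x 1.
Proof. by move=> df dg x; exact: derivableD (df x) (dg x). Qed.

Lemma derivable_mul f g : (forall x, derivable f x 1) -> (forall x, derivable g x 1) ->
  forall x, derivable (f \* g) x 1.
Proof. by move=> df dg x; exact: derivableM (df x) (dg x). Qed.

Lemma derivable_opp f : (forall x, derivable f x 1) ->
  forall x, derivable (\- f) x 1.
Proof. by move=> df x; exact: derivableN (df x). Qed.

Lemma CnD k f g : Cn k f -> Cn k g -> Cn k (f \+ g).
Proof.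
elim: k f g => [|k IH] f g hf hg.
  exact: Cn_O (derivable_add (Cn_derivable hf) (Cn_derivable hg)).
apply: Cn_S (derivable_add (Cn_derivable hf) (Cn_derivable hg)) _.
rewrite (derive1D (Cn_derivable hf) (Cn_derivable hg)).
exact: IH (Cn_derive hf) (Cn_derive hg).
Qed.

Lemma CnN k f : Cn k f -> Cn k (\- f).
Proof.
elim: k f => [|k IH] f hf; first exact: Cn_O (derivable_opp (Cn_derivable hf)).
apply: Cn_S (derivable_opp (Cn_derivable hf)) _.
by rewrite (derive1N (Cn_derivable hf)); exact: IH (Cn_derive hf).
Qed.

Lemma CnM k f g : Cn k f -> Cn k g -> Cn k (f \* g).
Proof.
elim: k f g => [|k IH] f g hf hg.
  exact: Cn_O (derivable_mul (Cn_derivable hf) (Cn_derivable hg)).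
apply: Cn_S (derivable_mul (Cn_derivable hf) (Cn_derivable hg)) _.
rewrite (derive1M (Cn_derivable hf) (Cn_derivable hg)).
exact: CnD (IH _ _ (Cn_derive hf) (CnS hg)) (IH _ _ (CnS hf) (Cn_derive hg)).
Qed.

Lemma Cn_cst k (c : R) : Cn k (fun=> c).
Proof.
elim: k c => [|k IH] c; first exact: Cn_O (fun x => derivable_cst c x 1).
apply: Cn_S (fun x => derivable_cst c x 1) _.
have -> : derive1 (fun _ : R => c) = fun=> 0 by apply/funext => x; exact: derive1_cst.
exact: IH.
Qed.

End SmoothReal.

Section SmoothLoops.
Context {R : realType}.
Notation C := R[i].
Implicit Types f g : R -> C.
Local Notation Re := (@complex.Re R).
Local Notation Im := (@complex.Im R).

(** [smooth_loop] as a record, so that smoothness hypotheses stay opaque to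
    unification. *)
Record smooth f : Prop := Smooth {
  smooth_periodic : forall x, f (x + 1) = f x;
  smooth_Re : forall k, Cn k (Re \o f);
  smooth_Im : forall k, Cn k (Im \o f) }.

Lemma smooth_loopP f : smooth_loop f <-> smooth f.
Proof.
split=> [[p h]|[p hR hI]].
  by split=> //; apply/CnP => k x; case: (h k x).
by split=> [|k x]; [exact: p|split; [move/CnP: hR|move/CnP: hI]; apply].
Qed.

Lemma cE (z w : C) : Re z = Re w -> Im z = Im w -> z = w.
Proof. by case: z w => [a b] [c d] /= -> ->. Qed.

Lemma cReD (z w : C) : Re (z + w) = Re z + Re w. Proof. by case: z w => [a b] []. Qed.
Lemma cImD (z w : C) : Im (z + w) = Im z + Im w. Proof. by case: z w => [a b] []. Qed.
Lemma cReM (z w : C) : Re (z * w) = Re z * Re w - Im z * Im w.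
Proof. by case: z w => [a b] []. Qed.
Lemma cImM (z w : C) : Im (z * w) = Re z * Im w + Im z * Re w.
Proof. by case: z w => [a b] [c d]. Qed.

Lemma smooth_cst (c : C) : smooth (fun=> c).
Proof.
by split=> [//|k|k]; [exact: (Cn_cst k (Re c))|exact: (Cn_cst k (Im c))].
Qed.

Lemma smoothD f g : smooth f -> smooth g -> smooth (fun x => f x + g x).
Proof.
move=> [pf rf jf] [pg rg jg]; split=> [x|k|k]; first by rewrite pf pg.
  rewrite (_ : _ \o _ = (Re \o f) \+ (Re \o g)); first exact: CnD.
  by apply/funext => x /=; rewrite cReD.
rewrite (_ : _ \o _ = (Im \o f) \+ (Im \o g)); first exact: CnD.
by apply/funext => x /=; rewrite cImD.
Qed.

Lemma smoothM f g : smooth f -> smooth g -> smooth (fun x => f x * g x).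
Proof.
move=> [pf rf jf] [pg rg jg]; split=> [x|k|k]; first by rewrite pf pg.
  rewrite (_ : _ \o _ = ((Re \o f) \* (Re \o g)) \+ (\- ((Im \o f) \* (Im \o g)))).
    by apply: CnD; [|apply: CnN]; apply: CnM.
  by apply/funext => x /=; rewrite cReM.
rewrite (_ : _ \o _ = ((Re \o f) \* (Im \o g)) \+ ((Im \o f) \* (Re \o g))).
  by apply: CnD; apply: CnM.
by apply/funext => x /=; rewrite cImM.
Qed.

Lemma smoothZ (c : C) f : smooth f -> smooth (fun x => c * f x).
Proof. by move=> hf; apply: smoothM => //; apply: smooth_cst. Qed.

Lemma eq_smooth f g : f =1 g -> smooth f -> smooth g.
Proof. by move=> /funext ->. Qed.

Lemma smoothN f : smooth f -> smooth (fun x => - f x).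
Proof.
by move=> hf; apply: eq_smooth (smoothZ (-1) hf) => x; rewrite mulN1r.
Qed.

Lemma smoothB f g : smooth f -> smooth g -> smooth (fun x => f x - g x).
Proof. by move=> hf hg; apply: smoothD => //; apply: smoothN. Qed.

Lemma smooth_sum (I : Type) (r : seq I) (F : I -> R -> C) :
  (forall i, smooth (F i)) -> smooth (fun x => \sum_(i <- r) F i x).
Proof.
move=> h; elim: r => [|i r IH].
  by apply: eq_smooth (smooth_cst 0) => x; rewrite big_nil.
by apply: eq_smooth (smoothD (h i) IH) => x; rewrite big_cons.
Qed.

Lemma smooth_conj f : smooth f -> smooth (fun x => conjc (f x)).
Proof.
move=> [pf rf jf]; split=> [x|k|k]; first by rewrite pf.
  by rewrite (_ : _ \o _ = Re \o f) //; apply/funext => x /=; case: (f x).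
rewrite (_ : _ \o _ = \- (Im \o f)); first exact: CnN.
by apply/funext => x /=; case: (f x).
Qed.

Lemma smooth_dRe f : smooth f -> forall x, derivable (Re \o f) x 1.
Proof. by move=> hf; exact: Cn_derivable (smooth_Re hf 0). Qed.

Lemma smooth_dIm f : smooth f -> forall x, derivable (Im \o f) x 1.
Proof. by move=> hf; exact: Cn_derivable (smooth_Im hf 0). Qed.

Lemma Re_dx f x : Re (dx f x) = derive1 (Re \o f) x. Proof. by []. Qed.
Lemma Im_dx f x : Im (dx f x) = derive1 (Im \o f) x. Proof. by []. Qed.

Lemma derive1_shift (h : R -> R) : (forall x, h (x + 1) = h x) ->
  (forall x, derivable h x 1) -> forall x, derive1 h (x + 1) = derive1 h x.
Proof.
move=> p d x; have e : h = h \o (fun y => y + 1) by apply/funext => y /=; rewrite p.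
have di y : derivable (@id R) y 1 by exact: derivable_id.
have dc y : derivable (fun _ : R => 1 : R) y 1 by exact: (derivable_cst (1 : R)).
have ds : derivable (id \+ (fun _ : R => 1 : R)) x 1 by apply: (derivable_add di dc).
rewrite {2}e (derive1_comp ds (d _)).
rewrite [X in _ * X](_ : _ = 1) ?mulr1 //.
rewrite -[LHS]/(derive1 (id \+ (fun _ : R => 1 : R)) x) (derive1D di dc) /=.
by rewrite derive1_id derive1_cst addr0.
Qed.

Lemma smooth_dx f : smooth f -> smooth (dx f).
Proof.
move=> hf; have dR := smooth_dRe hf; have dI := smooth_dIm hf.
case: hf => pf rf jf; split=> [x|k|k].
- apply: cE; rewrite ?Re_dx ?Im_dx.
    by apply: (derive1_shift _ dR) => y /=; rewrite pf.
  by apply: (derive1_shift _ dI) => y /=; rewrite pf.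
- exact: Cn_derive (rf k.+1).
- exact: Cn_derive (jf k.+1).
Qed.

Lemma smooth_iter f j : smooth f -> smooth (iter j dx f).
Proof. by move=> hf; elim: j => //= j; exact: smooth_dx. Qed.

Lemma dxD f g : smooth f -> smooth g ->
  dx (fun x => f x + g x) = fun x => dx f x + dx g x.
Proof.
move=> hf hg; apply/funext => x; apply: cE; rewrite ?cReD ?cImD ?Re_dx ?Im_dx.
  rewrite -[RHS]/((derive1 (Re \o f) \+ derive1 (Re \o g)) x).
  rewrite -(derive1D (smooth_dRe hf) (smooth_dRe hg)).
  by congr (derive1 _ x); apply/funext => y /=; rewrite cReD.
rewrite -[RHS]/((derive1 (Im \o f) \+ derive1 (Im \o g)) x).
rewrite -(derive1D (smooth_dIm hf) (smooth_dIm hg)).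
by congr (derive1 _ x); apply/funext => y /=; rewrite cImD.
Qed.

Lemma dxM f g : smooth f -> smooth g ->
  dx (fun x => f x * g x) = fun x => dx f x * g x + f x * dx g x.
Proof.
move=> hf hg; have [f1 f2] := (smooth_dRe hf, smooth_dIm hf).
have [g1 g2] := (smooth_dRe hg, smooth_dIm hg).
apply/funext => x; apply: cE; rewrite ?(cReD, cImD, cReM, cImM) ?Re_dx ?Im_dx.
  rewrite (_ : _ \o _ = ((Re \o f) \* (Re \o g)) \+ (\- ((Im \o f) \* (Im \o g)))).
    rewrite (derive1D (derivable_mul f1 g1)
                      (derivable_opp (derivable_mul f2 g2))) /=.
    rewrite (derive1N (derivable_mul f2 g2)) /=.
    by rewrite (derive1M f1 g1) (derive1M f2 g2) /=; ring.
  by apply/funext => y /=; rewrite cReM.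
rewrite (_ : _ \o _ = ((Re \o f) \* (Im \o g)) \+ ((Im \o f) \* (Re \o g))).
  rewrite (derive1D (derivable_mul f1 g2)
                    (derivable_mul f2 g1)) /=.
  by rewrite (derive1M f1 g2) (derive1M f2 g1) /=; ring.
by apply/funext => y /=; rewrite cImM.
Qed.

Lemma dx_cst (c : C) : dx (fun=> c) = fun=> 0.
Proof.
by apply/funext => x; apply: cE; rewrite ?Re_dx ?Im_dx; exact: derive1_cst.
Qed.

Lemma dxZ (c : C) f : smooth f -> dx (fun x => c * f x) = fun x => c * dx f x.
Proof.
move=> hf; rewrite dxM //; last exact: smooth_cst.
by rewrite dx_cst; apply/funext => x; rewrite mul0r add0r.
Qed.

Lemma dxN f : smooth f -> dx (fun x => - f x) = fun x => - dx f x.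
Proof.
move=> hf; have -> : (fun x => - f x) = (fun x => -1 * f x).
  by apply/funext => x; rewrite mulN1r.
by rewrite (dxZ _ hf); apply/funext => x; rewrite mulN1r.
Qed.

Lemma dxB f g : smooth f -> smooth g ->
  dx (fun x => f x - g x) = fun x => dx f x - dx g x.
Proof. by move=> hf hg; rewrite dxD ?dxN //; apply: smoothN. Qed.

Lemma dx_sum (I : Type) (r : seq I) (F : I -> R -> C) :
  (forall i, smooth (F i)) ->
  dx (fun x => \sum_(i <- r) F i x) = fun x => \sum_(i <- r) dx (F i) x.
Proof.
move=> h; elim: r => [|i r IH].
  have -> : (fun x => \sum_(i <- [::]) F i x) = fun=> 0.
    by apply/funext => x; rewrite big_nil.
  by rewrite dx_cst; apply/funext => x; rewrite big_nil.
have -> : (fun x => \sum_(j <- i :: r) F j x) = fun x => F i x + \sum_(j <- r) F j x.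
  by apply/funext => x; rewrite big_cons.
rewrite (dxD (h i) (smooth_sum r h)) IH.
by apply/funext => x; rewrite big_cons.
Qed.

Lemma iter_dxZ (c : C) f j : smooth f ->
  iter j dx (fun x => c * f x) = fun x => c * iter j dx f x.
Proof. by move=> hf; elim: j => //= j ->; rewrite dxZ //; exact: smooth_iter. Qed.

Lemma iter_dx_sum (I : Type) (r : seq I) (F : I -> R -> C) j :
  (forall i, smooth (F i)) ->
  iter j dx (fun x => \sum_(i <- r) F i x) = fun x => \sum_(i <- r) iter j dx (F i) x.
Proof.
by move=> h; elim: j => //= j ->; rewrite dx_sum // => i; exact: smooth_iter.
Qed.

End SmoothLoops.

(** * Integration over a period *)

Section Integration.
Context {R : realType}.
Notation C := R[i].
Implicit Types f g : R -> C.
Local Notation Re := (@complex.Re R).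
Local Notation Im := (@complex.Im R).
Local Notation mu := (@lebesgue_measure R).

Lemma derivable_continuous (h : R -> R) : (forall x, derivable h x 1) -> continuous h.
Proof.
by move=> d x; apply/differentiable_continuous/derivable1_diffP; exact: d.
Qed.

Lemma continuous_integrable (h : R -> R) a b : continuous h ->
  mu.-integrable `[a, b] (EFin \o h).
Proof.
move=> ch; apply: continuous_compact_integrable; first exact: segment_compact.
by apply: continuous_subspaceT.
Qed.

Lemma smooth_intRe f : smooth f -> mu.-integrable `[0, 1] (EFin \o (fun x => Re (f x))).
Proof. by move=> hf; apply/continuous_integrable/derivable_continuous/(smooth_dRe hf). Qed.

Lemma smooth_intIm f : smooth f -> mu.-integrable `[0, 1] (EFin \o (fun x => Im (f x))).
Proof. by move=> hf; apply/continuous_integrable/derivable_continuous/(smooth_dIm hf). Qed.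

Lemma Re_cint f : Re (cint f) = \int[mu]_(x in `[0, 1]) Re (f x). Proof. by []. Qed.
Lemma Im_cint f : Im (cint f) = \int[mu]_(x in `[0, 1]) Im (f x). Proof. by []. Qed.

Lemma eq_cint f g : f =1 g -> cint f = cint g.
Proof. by move=> /funext ->. Qed.

Lemma cintD f g : smooth f -> smooth g -> cint (fun x => f x + g x) = cint f + cint g.
Proof.
move=> hf hg; apply: cE; rewrite ?cReD ?cImD ?Re_cint ?Im_cint.
  rewrite -(RintegralD _ (smooth_intRe hf) (smooth_intRe hg)) //.
  by apply: eq_Rintegral => x _; rewrite cReD.
rewrite -(RintegralD _ (smooth_intIm hf) (smooth_intIm hg)) //.
by apply: eq_Rintegral => x _; rewrite cImD.
Qed.

Lemma integrableZ (h : R -> R) (c : R) : mu.-integrable `[0, 1] (EFin \o h) ->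
  mu.-integrable `[0, 1] (EFin \o (fun x => c * h x)).
Proof.
move=> ih; rewrite (_ : EFin \o _ = fun x => (c%:E * (EFin \o h) x)%E) //.
exact: integrableZl.
Qed.

Lemma cintZ (c : C) f : smooth f -> cint (fun x => c * f x) = c * cint f.
Proof.
move=> hf; have iR := smooth_intRe hf; have iI := smooth_intIm hf.
apply: cE; rewrite ?(Re_cint, Im_cint).
  rewrite (cReM c (cint f)) Re_cint Im_cint.
  rewrite -!RintegralZl // -(RintegralB _ (integrableZ _ iR) (integrableZ _ iI)) //.
  by apply: eq_Rintegral => x _; rewrite cReM.
rewrite (cImM c (cint f)) Re_cint Im_cint.
rewrite -!RintegralZl // -(RintegralD _ (integrableZ _ iI) (integrableZ _ iR)) //.
by apply: eq_Rintegral => x _; rewrite cImM.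
Qed.

Lemma cint0 : cint (fun _ : R => 0 : C) = 0.
Proof.
rewrite -[RHS](mul0r (cint (fun=> 0))) -(cintZ 0 (smooth_cst 0)).
by apply: eq_cint => x; rewrite mul0r.
Qed.

Lemma cintN f : smooth f -> cint (fun x => - f x) = - cint f.
Proof.
by move=> hf; rewrite -mulN1r -(cintZ _ hf); apply: eq_cint => x; rewrite mulN1r.
Qed.

Lemma cintB f g : smooth f -> smooth g -> cint (fun x => f x - g x) = cint f - cint g.
Proof. by move=> hf hg; rewrite (cintD hf (smoothN hg)) cintN. Qed.

Lemma cint_sum (I : Type) (r : seq I) (F : I -> R -> C) : (forall i, smooth (F i)) ->
  cint (fun x => \sum_(i <- r) F i x) = \sum_(i <- r) cint (F i).
Proof.
move=> h; elim: r => [|i r IH].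
  by rewrite big_nil -[RHS]cint0; apply: eq_cint => x; rewrite big_nil.
rewrite big_cons -IH -(cintD (h i) (smooth_sum r h)).
by apply: eq_cint => x; rewrite big_cons.
Qed.

Lemma FTC_loop (h : R -> R) : Cn 1 h -> h 1 = h 0 ->
  \int[mu]_(x in `[0, 1]) derive1 h x = 0.
Proof.
move=> ch e; have dh := Cn_derivable ch.
have ch0 := derivable_continuous dh.
rewrite /Rintegral (@continuous_FTC2 _ (derive1 h) h 0 1 ltr01); first last.
- by [].
- split=> [x _||]; first exact: dh.
    by apply: cvg_at_right_filter; exact: ch0.
  by apply: cvg_at_left_filter; exact: ch0.
- apply: continuous_subspaceT; apply: derivable_continuous.
  exact: Cn_derivable (Cn_derive ch).
- by rewrite -EFinB e subrr.
Qed.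

(** The fundamental theorem of calculus together with periodicity. *)
Lemma cint_dx f : smooth f -> cint (dx f) = 0.
Proof.
move=> hf; have p := smooth_periodic hf 0; rewrite add0r in p.
apply: cE; rewrite ?Re_cint ?Im_cint.
  by apply: (FTC_loop (smooth_Re hf 1)); rewrite /= p.
by apply: (FTC_loop (smooth_Im hf 1)); rewrite /= p.
Qed.

Lemma cint_parts f g : smooth f -> smooth g ->
  cint (fun x => f x * dx g x) = - cint (fun x => dx f x * g x).
Proof.
move=> hf hg; apply/eqP; rewrite -addr_eq0 addrC.
rewrite -(cintD (smoothM (smooth_dx hf) hg) (smoothM hf (smooth_dx hg))).
by rewrite -(dxM hf hg) cint_dx //; exact: smoothM.
Qed.

(** The integral of a nonnegative function up to [x] is squeezed between 0 and
    the vanishing total integral; its derivative in [x] is the value at [x]. *)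
Lemma Rintegral_ge0_eq0 (h : R -> R) : continuous h -> (forall x, 0 <= h x) ->
  \int[mu]_(x in `[0, 1]) h x = 0 -> forall x : R, 0 < x < 1 -> h x = 0.
Proof.
move=> ch h0 int0 x /andP[x0 x1].
have F0 y : y <= 1 -> \int[mu]_(t in `[0, y]) h t = 0.
  move=> y1; apply/eqP; rewrite eq_le; apply/andP; split; last first.
    by apply: Rintegral_ge0 => t _; exact: h0.
  apply: le_trans (_ : \int[mu]_(t in `[0, 1]) h t <= 0); last by rewrite int0.
  apply: fine_le.
  - apply: integrable_fin_num => //; exact: continuous_integrable.
  - apply: integrable_fin_num => //; exact: continuous_integrable.
  apply: ge0_subset_integral => //.
  - by have /integrableP[mf _] := continuous_integrable 0 1 ch; exact: mf.
  - by move=> t _; rewrite lee_fin.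
  - by apply: subset_itvl; rewrite bnd_simp.
have [||_ <-] := @continuous_FTC1 R h (BLeft 0) x 1 x1 (continuous_integrable 0 1 ch).
- by rewrite lte_fin.
- exact: ch.
rewrite derive1E (near_eq_derive (g := cst 0)) ?derive_cst //.
near=> y; apply: F0; near: y.
by apply: filterS (lt_nbhsl x1) => y /ltW.
Unshelve. all: by end_near. Qed.

Lemma periodic_int (h : R -> R) : (forall x, h (x + 1) = h x) ->
  forall (n : nat) x, h (x + n%:R) = h x /\ h (x - n%:R) = h x.
Proof.
move=> p; elim=> [|n IH] x; first by rewrite addr0 subr0.
rewrite -natr1 addrA p; split; first by case: (IH x).
rewrite opprD addrA -[LHS]p subrK; by case: (IH x).
Qed.

(** Continuity reaches the endpoint 0 and periodicity the rest of the line. *)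
Lemma periodic_ge0_eq0 (h : R -> R) : continuous h -> (forall x, h (x + 1) = h x) ->
  (forall x, 0 <= h x) -> \int[mu]_(x in `[0, 1]) h x = 0 -> forall x, h x = 0.
Proof.
move=> ch p h0 int0.
have hoo := Rintegral_ge0_eq0 ch h0 int0.
have hz : h 0 = 0.
  have c1 : h x @[x --> 0^'+] --> h 0 by apply: cvg_at_right_filter; exact: ch.
  have c2 : h x @[x --> (0:R)^'+] --> (0 : R).
    apply: cvg_near_cst; near=> y; apply: hoo; apply/andP; split; near: y.
      exact: nbhs_right_gt.
    exact: nbhs_right_lt.
  exact: (cvg_unique _ c1 c2).
move=> x; have /andP[f1 f2] := floor_itv x.
set m := Num.floor x in f1 f2; set y := x - m%:~R.
have y01 : 0 <= y < 1 by rewrite /y subr_ge0 f1 ltrBlDr addrC -intrD1.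
have hy : h y = 0.
  case/andP: y01; rewrite le_eqVlt => /predU1P[<- _ //|y0 y1].
  by rewrite hoo ?y0.
suff -> : h x = h y by [].
rewrite /y; case: m {f1 f2 y y01 hy} => n.
  by case: (periodic_int p n x).
by rewrite NegzE mulrNz opprK; case: (periodic_int p n.+1 x).
Unshelve. all: by end_near. Qed.

(** The fundamental lemma of the calculus of variations for complex-valued
    loops: the variation is the complex conjugate of the function itself. *)
Lemma cint_norm_eq0 f : smooth f -> cint (fun x => f x * conjc (f x)) = 0 ->
  forall x, f x = 0.
Proof.
move=> hf int0 x; pose h y := Re (f y * conjc (f y)).
have hE y : h y = Re (f y) ^+ 2 + Im (f y) ^+ 2.
  by rewrite /h; case: (f y) => a b /=; ring.
have sh := smoothM hf (smooth_conj hf).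
have hx : h x = 0.
  apply: (periodic_ge0_eq0 (h := h)).
  - exact: derivable_continuous (smooth_dRe sh).
  - by move=> y; rewrite /h (smooth_periodic hf).
  - by move=> y; rewrite hE addr_ge0 // sqr_ge0.
  - by have := congr1 Re int0; rewrite Re_cint.
move/eqP: hx; rewrite hE paddr_eq0 ?sqr_ge0 // !sqrf_eq0 => /andP[/eqP a /eqP b].
exact: cE.
Qed.

End Integration.

(** * Variational derivatives and paths of loops *)

Section Gradients.
Context {R : realType}.
Notation C := R[i].
Local Notation Re := (@complex.Re R).
Local Notation Im := (@complex.Im R).

Lemma mloop_smooth m n (A : R -> 'M[C]_(m, n)) :
  mloop A <-> forall i j, smooth (fun x => A x i j).
Proof. by split=> h i j; apply/smooth_loopP; exact: h. Qed.

Lemma rloopP n (t : R -> 'rV[C]_n) : mloop t <-> forall a, smooth (fun x => t x 0 a).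
Proof.
rewrite mloop_smooth; split=> [h a|h i a]; first exact: h.
by rewrite ord1; exact: h.
Qed.

Lemma rloop_shift n (q w : R -> 'rV[C]_n) (s : R) : mloop q -> mloop w ->
  mloop (fun x => q x + s%:C *: w x).
Proof.
move=> /rloopP hq /rloopP hw; apply/rloopP => a.
by apply: eq_smooth (smoothD (hq a) (smoothZ s%:C (hw a))) => x; rewrite !mxE.
Qed.

Lemma is_cderive_uniq (h : R -> C) s l l' :
  is_cderive h s l -> is_cderive h s l' -> l = l'.
Proof.
move=> [h1 h2] [h3 h4]; apply: cE.
  by rewrite -(@derive_val _ _ _ _ _ _ _ h1) -(@derive_val _ _ _ _ _ _ _ h3).
by rewrite -(@derive_val _ _ _ _ _ _ _ h2) -(@derive_val _ _ _ _ _ _ _ h4).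
Qed.

Lemma pairing_smooth n (v w : R -> 'rV[C]_n) : mloop v -> mloop w ->
  smooth (fun x => \sum_i v x 0 i * w x 0 i).
Proof.
by move=> /rloopP hv /rloopP hw; apply: smooth_sum => i; exact: smoothM.
Qed.

(** Tested against the variation supported in the coordinate [a], with value
    the conjugate of the difference. *)
Lemma pairing_inj n (v v' : R -> 'rV[C]_n) : mloop v -> mloop v' ->
  (forall w : R -> 'rV[C]_n, mloop w -> cint (fun x => \sum_i v x 0 i * w x 0 i) =
                        cint (fun x => \sum_i v' x 0 i * w x 0 i)) ->
  v = v'.
Proof.
move=> hv hv' e; apply/funext => x; apply/rowP => a.
have sv : smooth (fun y => v y 0 a) by move/rloopP: hv; apply.
have sv' : smooth (fun y => v' y 0 a) by move/rloopP: hv'; apply.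
pose d y := v y 0 a - v' y 0 a.
have sd : smooth d by exact: smoothB.
pose w y : 'rV[C]_n := conjc (d y) *: delta_mx 0 a.
have wE y i : w y 0 i = conjc (d y) * (i == a)%:R by rewrite !mxE eqxx.
have hw : mloop w.
  apply/rloopP => i; apply: eq_smooth (smoothM (smooth_conj sd) (smooth_cst (i == a)%:R)).
  by move=> y; rewrite wE.
suff : d x = 0 by move/eqP; rewrite subr_eq0 => /eqP.
apply: (cint_norm_eq0 sd); rewrite -[RHS](subrr (cint (fun x => \sum_i v' x 0 i * w x 0 i))).
rewrite -{1}(e w hw) -(cintB (pairing_smooth hv hw) (pairing_smooth hv' hw)).
apply: eq_cint => y; rewrite -sumrB (bigD1 a) //= big1 ?addr0.
  by rewrite wE eqxx mulr1 -mulrBl.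
by move=> i /negPf ia; rewrite wE ia !mulr0 subrr.
Qed.

Lemma is_gradient_uniq n (F : functional n) (q v v' : R -> 'rV[C]_n) :
  is_gradient F q v -> is_gradient F q v' -> v = v'.
Proof.
move=> [hv gv] [hv' gv']; apply: pairing_inj => // w hw.
exact: is_cderive_uniq (gv w hw) (gv' w hw).
Qed.

Lemma gradientE n (F : functional n) (q v : R -> 'rV[C]_n) :
  is_gradient F q v -> gradient F q = v.
Proof.
by move=> h; apply: xget_subset1 h _ => v1 v2; exact: is_gradient_uniq.
Qed.


(** The functions of [s] and [x] that arise when a loop is moved along
    t + s w: polynomials in the real parameter [s] with smooth loops as
    coefficients.  They can be differentiated in [s] under the integral
    without any analysis. *)
Inductive polypath : (R -> R -> C) -> Prop :=
| polypath_cst c : smooth c -> polypath (fun _ => c)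
| polypath_shift p : polypath p -> polypath (fun s x => s%:C * p s x)
| polypath_add p q : polypath p -> polypath q -> polypath (fun s x => p s x + q s x).

Lemma polypath_smooth p : polypath p -> forall s, smooth (p s).
Proof.
elim=> [c hc s //|{}p _ IH s|{}p q _ IHp _ IHq s].
- exact: smoothZ (IH s).
- exact: smoothD (IHp s) (IHq s).
Qed.

Lemma eq_polypath p q : (forall s x, p s x = q s x) -> polypath p -> polypath q.
Proof. by move=> e; have -> : p = q by apply/funext => s; apply/funext => x. Qed.

Lemma polypath_mul p q : polypath p -> polypath q -> polypath (fun s x => p s x * q s x).
Proof.
move=> hp hq; elim: hp => [c hc|{}p _ IH|{}p p' _ IH _ IH'].
- elim: hq => [d hd|{}q _ IH|{}q q' _ IH _ IH'].
  + by apply: polypath_cst; exact: smoothM.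
  + by apply: eq_polypath (polypath_shift IH) => s x; rewrite mulrCA.
  + by apply: eq_polypath (polypath_add IH IH') => s x; rewrite mulrDr.
- by apply: eq_polypath (polypath_shift IH) => s x; rewrite mulrA.
- by apply: eq_polypath (polypath_add IH IH') => s x; rewrite mulrDl.
Qed.

Lemma polypath_dx p : polypath p -> polypath (fun s => dx (p s)).
Proof.
elim=> [c hc|{}p hp IH|{}p q hp IHp hq IHq].
- by apply: polypath_cst; exact: smooth_dx.
- apply: eq_polypath (polypath_shift IH) => s x.
  by rewrite (dxZ _ (polypath_smooth hp s)).
- apply: eq_polypath (polypath_add IHp IHq) => s x.
  by rewrite (dxD (polypath_smooth hp s) (polypath_smooth hq s)).
Qed.

(** The integral over x is a polynomial in s. *)
Lemma polypath_derivable p : polypath p ->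
  (forall s : R, derivable (fun r : R => Re (cint (p r))) s 1) /\
  (forall s : R, derivable (fun r : R => Im (cint (p r))) s 1).
Proof.
have di (y : R) : derivable (@id R) y 1 by exact: derivable_id.
elim=> [c hc|{}p hp [h1 h2]|{}p q hp [p1 p2] hq [q1 q2]].
- by split=> s; exact: derivable_cst.
- have e r : cint (fun x => r%:C * p r x) = r%:C * cint (p r).
    exact: cintZ (polypath_smooth hp r).
  split.
    rewrite (_ : (fun r => _) = id \* (fun r => Re (cint (p r)))); first exact (derivable_mul di h1).
    by apply/funext => r; rewrite e cReM /= mul0r subr0.
  rewrite (_ : (fun r => _) = id \* (fun r => Im (cint (p r)))); first exact (derivable_mul di h2).
  by apply/funext => r; rewrite e cImM /= mul0r addr0.
- have e r : cint (fun x => p r x + q r x) = cint (p r) + cint (q r).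
    exact: cintD (polypath_smooth hp r) (polypath_smooth hq r).
  split.
    rewrite (_ : (fun r => _) = (fun r => Re (cint (p r))) \+ (fun r => Re (cint (q r)))).
      exact (derivable_add p1 q1).
    by apply/funext => r; rewrite e cReD.
  rewrite (_ : (fun r => _) = (fun r => Im (cint (p r))) \+ (fun r => Im (cint (q r)))).
    exact (derivable_add p2 q2).
  by apply/funext => r; rewrite e cImD.
Qed.

(** The expansion p s = c0 + s c1 + O(s^2), with a remainder that is s^2 times
    a polynomial path. *)
Definition path1 (p : R -> R -> C) (c0 c1 : R -> C) : Prop :=
  [/\ smooth c0, smooth c1 &
  exists2 r, polypath r & forall s x, p s x = c0 x + s%:C * c1 x + s%:C * (s%:C * r s x)].

Lemma eq_path1 p c0 c1 p' c0' c1' : path1 p c0 c1 ->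
  (forall s x, p s x = p' s x) -> c0 =1 c0' -> c1 =1 c1' -> path1 p' c0' c1'.
Proof.
move=> h e /funext <- /funext <-.
by rewrite (_ : p' = p) //; apply/funext => s; apply/funext => x.
Qed.

Lemma path1_polypath p c0 c1 : path1 p c0 c1 -> polypath p.
Proof.
move=> [h0 h1 [r hr e]].
apply: eq_polypath (polypath_add (polypath_add (polypath_cst h0)
  (polypath_shift (polypath_cst h1))) (polypath_shift (polypath_shift hr))) => s x.
by rewrite e.
Qed.

Lemma polypath_path1 p c0 c1 : smooth c0 -> smooth c1 ->
  (forall s x, p s x = c0 x + s%:C * c1 x) -> path1 p c0 c1.
Proof.
move=> h0 h1 e; split=> //; exists (fun _ _ => 0).
  by apply: polypath_cst; exact: smooth_cst.
by move=> s x; rewrite !mulr0 addr0.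
Qed.

Lemma path1_cst c : smooth c -> path1 (fun _ => c) c (fun=> 0).
Proof.
by move=> hc; apply: polypath_path1 => // [|s x]; [exact: smooth_cst|rewrite mulr0 addr0].
Qed.

Lemma path1D p c0 c1 q d0 d1 : path1 p c0 c1 -> path1 q d0 d1 ->
  path1 (fun s x => p s x + q s x) (fun x => c0 x + d0 x) (fun x => c1 x + d1 x).
Proof.
move=> [hc0 hc1 [r hr e]] [hd0 hd1 [u hu f]]; split; try exact: smoothD.
exists (fun s x => r s x + u s x); first exact: polypath_add.
by move=> s x; rewrite e f; ring.
Qed.

Lemma path1M p c0 c1 q d0 d1 : path1 p c0 c1 -> path1 q d0 d1 ->
  path1 (fun s x => p s x * q s x) (fun x => c0 x * d0 x)
        (fun x => c1 x * d0 x + c0 x * d1 x).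
Proof.
move=> hp hq; have [hc0 hc1 [r hr e]] := hp; have [hd0 hd1 [u hu f]] := hq.
split; [exact: smoothM|exact: smoothD (smoothM hc1 hd0) (smoothM hc0 hd1)|].
exists (fun s x => c1 x * d1 x + c0 x * u s x + r s x * q s x + s%:C * (c1 x * u s x)).
  apply: polypath_add; [|apply: polypath_shift; apply: polypath_mul => //; exact: polypath_cst].
  apply: polypath_add; [|apply: polypath_mul => //; exact: path1_polypath hq].
  apply: polypath_add; [|apply: polypath_mul => //; exact: polypath_cst].
  by apply: polypath_cst; exact: smoothM.
by move=> s x; rewrite e f; ring.
Qed.

Lemma path1_dx p c0 c1 : path1 p c0 c1 -> path1 (fun s => dx (p s)) (dx c0) (dx c1).
Proof.
move=> [hc0 hc1 [r hr e]]; split; try exact: smooth_dx.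
exists (fun s => dx (r s)); first exact: polypath_dx.
move=> s x; have hrs := polypath_smooth hr s.
have -> : p s = fun x => (c0 x + s%:C * c1 x) + s%:C * (s%:C * r s x).
  by apply/funext => y; rewrite e.
rewrite (dxD (smoothD hc0 (smoothZ _ hc1)) (smoothZ _ (smoothZ _ hrs))).
by rewrite (dxD hc0 (smoothZ _ hc1)) (dxZ _ hc1) (dxZ _ (smoothZ _ hrs)) (dxZ _ hrs).
Qed.

Lemma path1_sum (I : Type) (r : seq I) (p : I -> R -> R -> C) c0 c1 :
  (forall i, path1 (p i) (c0 i) (c1 i)) ->
  path1 (fun s x => \sum_(i <- r) p i s x)
        (fun x => \sum_(i <- r) c0 i x) (fun x => \sum_(i <- r) c1 i x).
Proof.
move=> h; elim: r => [|i r IH].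
  by apply: eq_path1 (path1_cst (smooth_cst 0)) _ _ _ => [s x|x|x]; rewrite big_nil.
by apply: eq_path1 (path1D (h i) IH) _ _ _ => [s x|x|x]; rewrite big_cons.
Qed.

(** Differentiation under the integral sign at s = 0. *)
Lemma path1_cint p c0 c1 : path1 p c0 c1 -> is_cderive (fun s => cint (p s)) 0 (cint c1).
Proof.
move=> [hc0 hc1 [r hr e]].
have E s : cint (p s) = cint c0 + s%:C * cint c1 + s%:C * (s%:C * cint (r s)).
  have hrs := polypath_smooth hr s.
  rewrite -(cintZ _ hrs) -(cintZ _ (smoothZ _ hrs)) -(cintZ _ hc1) -(cintD hc0 (smoothZ _ hc1)).
  rewrite -(cintD (smoothD hc0 (smoothZ _ hc1)) (smoothZ _ (smoothZ _ hrs))).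
  by apply: eq_cint => x; rewrite e.
have key (a b : R) (h : R -> R) : derivable h 0 1 ->
    is_derive (0 : R) 1 (fun s : R => a + s * b + s * (s * h s)) b.
  move=> dh; have dh' := derivableP dh.
  have h1 : is_derive (0 : R) 1 (fun s : R => a + s * b) b.
    have := is_deriveD (is_derive_cst a (0:R) (1:R))
              (is_deriveM (is_derive_id (0:R) 1) (is_derive_cst b (0:R) (1:R))).
    move/is_derive_eq; apply. by rewrite scaler0 !add0r; exact: mulr1.
  have h2 : is_derive (0 : R) 1 (fun s : R => s * (s * h s)) 0.
    have := is_deriveM (is_derive_id (0:R) 1) (is_deriveM (is_derive_id (0:R) 1) dh').
    move/is_derive_eq; apply; rewrite scale0r add0r /=.
    have -> : (id * h) 0 = 0 by exact: mul0r.
    by rewrite scale0r.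
  by have := is_deriveD h1 h2; rewrite addr0.
have [d1 d2] := polypath_derivable hr.
split.
  rewrite (_ : _ \o _ = fun s => Re (cint c0) + s * Re (cint c1) + s * (s * Re (cint (r s)))).
    exact: key (d1 0).
  by apply/funext => s; rewrite -[LHS]/(Re (cint (p s))) E !(cReD, cReM, cImM) /= !mul0r !subr0.
rewrite (_ : _ \o _ = fun s => Im (cint c0) + s * Im (cint c1) + s * (s * Im (cint (r s)))).
  exact: key (d2 0).
by apply/funext => s; rewrite -[LHS]/(Im (cint (p s))) E !(cImD, cReM, cImM) /= !mul0r !addr0.
Qed.

End Gradients.

(** * Gradients of local functionals *)

Section DiffOperators.
Context {R : realType} {n : nat}.
Notation C := R[i].
Notation loop := (R -> 'rV[C]_n).

(** Differential polynomials in the loop t, with smooth coefficients.  Unlike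
    [density] this class is visibly closed under d/dx, so integration by parts
    stays inside it, and gradients can be differentiated again. *)
Inductive dop : (loop -> R -> C) -> Prop :=
| dop_coef c : smooth c -> dop (fun _ => c)
| dop_var a : dop (fun t x => t x 0 a)
| dop_add p q : dop p -> dop q -> dop (fun t x => p t x + q t x)
| dop_mul p q : dop p -> dop q -> dop (fun t x => p t x * q t x)
| dop_dx p : dop p -> dop (fun t => dx (p t)).

Lemma dop_smooth p : dop p -> forall t, mloop t -> smooth (p t).
Proof.
elim=> [c hc t _ //|a t /rloopP //|{}p q _ hp _ hq t ht|{}p q _ hp _ hq t ht|{}p _ hp t ht].
- exact: smoothD (hp t ht) (hq t ht).
- exact: smoothM (hp t ht) (hq t ht).
- exact: smooth_dx (hp t ht).
Qed.

Lemma dop_iter p s : dop p -> dop (fun t => iter s dx (p t)).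
Proof. by move=> hp; elim: s => //= s; exact: dop_dx. Qed.

Lemma density_dop f : density f -> dop (fun t x => f x (jet_of t x)).
Proof.
elim=> [c hc|s a|{}f g _ hf _ hg|{}f g _ hf _ hg].
- by apply: dop_coef; exact/smooth_loopP.
- have := dop_iter s (dop_var a); congr dop.
  by apply/funext => t; apply/funext => x; rewrite mxE.
- exact: dop_add hf hg.
- exact: dop_mul hf hg.
Qed.

Local Notation shift t w s := (fun x => t x + s%:C *: w x).

Lemma path1_coord (t w : loop) a : mloop t -> mloop w ->
  path1 (fun s x => shift t w s x 0 a) (fun x => t x 0 a) (fun x => w x 0 a).
Proof.
move=> /rloopP ht /rloopP hw; apply: polypath_path1 (ht a) (hw a) _ => s x.
by rewrite !mxE.
Qed.

(** [D1 t w] and [D2 t v w] are the first and second variations of p, the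
    second one symmetric.  The last clause moves all derivatives away from the
    variation w: [E] is the adjoint of the linearised operator applied to q.
    Its quantification over all weights [q] makes the induction pass through
    products and derivatives. *)
Lemma dop_variation p : dop p -> exists D1 D2,
  [/\ forall t w, mloop t -> mloop w ->
        path1 (fun s => p (shift t w s)) (p t) (D1 t w),
      forall t v w, mloop t -> mloop v -> mloop w ->
        path1 (fun s => D1 (shift t w s) v) (D1 t v) (D2 t v w),
      forall t v w, mloop t -> mloop v -> mloop w -> D2 t v w = D2 t w v &
      forall q, dop q -> exists2 E : 'I_n -> loop -> R -> C, forall a, dop (E a) &
        forall t w, mloop t -> mloop w ->
          cint (fun x => q t x * D1 t w x) = cint (fun x => \sum_a E a t x * w x 0 a)].
Proof.
elim=> [c hc|a|{}p q hp [D1 [D2 [h1 h2 h3 h4]]] hq [D1' [D2' [h1' h2' h3' h4']]]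
  |{}p q hp [D1 [D2 [h1 h2 h3 h4]]] hq [D1' [D2' [h1' h2' h3' h4']]]
  |{}p hp [D1 [D2 [h1 h2 h3 h4]]]].
- exists (fun _ _ _ => 0), (fun _ _ _ _ => 0); split=> //.
  + by move=> t w _ _; exact: path1_cst.
  + by move=> t v w _ _ _; exact: path1_cst (smooth_cst 0).
  + move=> q _; exists (fun _ _ _ => 0); first by move=> a; exact: dop_coef (smooth_cst 0).
    move=> t w _ _; apply: eq_cint => x; rewrite mulr0 big1 // => a _.
    by rewrite mul0r.
- exists (fun _ w x => w x 0 a), (fun _ _ _ _ => 0); split=> //.
  + by move=> t w ht hw; exact: path1_coord.
  + by move=> t v w _ /rloopP hv _; exact: path1_cst.
  + move=> q hq; exists (fun b t x => if b == a then q t x else 0).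
      by move=> b; case: (b == a) => //; exact: dop_coef (smooth_cst 0).
    move=> t w _ _; apply: eq_cint => x; rewrite (bigD1 a) //= eqxx big1 ?addr0 //.
    by move=> b /negPf ->; rewrite mul0r.
- exists (fun t w x => D1 t w x + D1' t w x), (fun t v w x => D2 t v w x + D2' t v w x).
  split=> [t w ht hw|t v w ht hv hw|t v w ht hv hw|r hr].
  + exact: path1D (h1 t w ht hw) (h1' t w ht hw).
  + exact: path1D (h2 t v w ht hv hw) (h2' t v w ht hv hw).
  + by rewrite (h3 t v w) // (h3' t v w).
  + have [E hE e] := h4 r hr; have [E' hE' e'] := h4' r hr.
    exists (fun a t x => E a t x + E' a t x) => [a|t w ht hw]; first exact: dop_add.
    have [_ s1 _] := h1 t w ht hw; have [_ s1' _] := h1' t w ht hw.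
    have sr := dop_smooth hr ht.
    have sE a := smoothM (dop_smooth (hE a) ht) ((rloopP w).1 hw a).
    have sE' a := smoothM (dop_smooth (hE' a) ht) ((rloopP w).1 hw a).
    transitivity (cint (fun x => r t x * D1 t w x) + cint (fun x => r t x * D1' t w x)).
      rewrite -(cintD (smoothM sr s1) (smoothM sr s1')).
      by apply: eq_cint => x; rewrite mulrDr.
    rewrite e // e' // -(cintD (smooth_sum _ sE) (smooth_sum _ sE')).
    by apply: eq_cint => x; rewrite -big_split /=; apply: eq_bigr => a _; rewrite mulrDl.
- exists (fun t w x => D1 t w x * q t x + p t x * D1' t w x).
  exists (fun t v w x => (D2 t v w x * q t x + D1 t v x * D1' t w x) +
     (D1 t w x * D1' t v x + p t x * D2' t v w x)).
  split=> [t w ht hw|t v w ht hv hw|t v w ht hv hw|r hr].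
  + exact: path1M (h1 t w ht hw) (h1' t w ht hw).
  + exact: path1D (path1M (h2 t v w ht hv hw) (h1' t w ht hw))
                  (path1M (h1 t w ht hw) (h2' t v w ht hv hw)).
  + by rewrite (h3 t v w) // (h3' t v w) //; apply/funext => x; ring.
  + have [E hE e] := h4 _ (dop_mul hr hq); have [E' hE' e'] := h4' _ (dop_mul hr hp).
    exists (fun a t x => E a t x + E' a t x) => [a|t w ht hw]; first exact: dop_add.
    have [_ s1 _] := h1 t w ht hw; have [_ s1' _] := h1' t w ht hw.
    have sr := dop_smooth hr ht; have sp := dop_smooth hp ht; have sq := dop_smooth hq ht.
    have sE a := smoothM (dop_smooth (hE a) ht) ((rloopP w).1 hw a).
    have sE' a := smoothM (dop_smooth (hE' a) ht) ((rloopP w).1 hw a).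
    transitivity (cint (fun x => r t x * q t x * D1 t w x) +
                  cint (fun x => r t x * p t x * D1' t w x)).
      rewrite -(cintD (smoothM (smoothM sr sq) s1) (smoothM (smoothM sr sp) s1')).
      by apply: eq_cint => x; ring.
    rewrite e // e' // -(cintD (smooth_sum _ sE) (smooth_sum _ sE')).
    by apply: eq_cint => x; rewrite -big_split /=; apply: eq_bigr => a _; rewrite mulrDl.
- exists (fun t w => dx (D1 t w)), (fun t v w => dx (D2 t v w)).
  split=> [t w ht hw|t v w ht hv hw|t v w ht hv hw|r hr].
  + exact: path1_dx (h1 t w ht hw).
  + exact: path1_dx (h2 t v w ht hv hw).
  + by rewrite (h3 t v w).
  (* by parts, a weight r on the derivative is the weight - r' *)
  + have [E hE e] := h4 _ (dop_mul (dop_coef (smooth_cst (-1))) (dop_dx hr)).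
    exists E => // t w ht hw; rewrite -e //.
    have [_ s1 _] := h1 t w ht hw; have sr := dop_smooth hr ht.
    rewrite (cint_parts sr s1) -(cintN (smoothM (smooth_dx sr) s1)).
    by apply: eq_cint => x; rewrite mulN1r mulNr.
Qed.

Definition pairing (v w : loop) : C := cint (fun x => \sum_i v x 0 i * w x 0 i).

Lemma pairingC v w : pairing v w = pairing w v.
Proof. by apply: eq_cint => x; apply: eq_bigr => i _; rewrite mulrC. Qed.

(** [g] is the gradient map of F and [Dg] its derivative, the Hessian; both
    sides of its symmetry are the integral of the second variation of the
    density. *)
Lemma local_gradient (F : functional n) p : dop p ->
  (forall t, mloop t -> F t = cint (p t)) ->
  exists (g : loop -> loop) (Dg : loop -> loop -> loop),
  [/\ forall t, mloop t -> is_gradient F t (g t),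
      forall t w, mloop t -> mloop w -> mloop (Dg t w),
      forall t w, mloop t -> mloop w -> forall a,
        path1 (fun s x => g (shift t w s) x 0 a) (fun x => g t x 0 a)
              (fun x => Dg t w x 0 a) &
      forall t v w, mloop t -> mloop v -> mloop w ->
        pairing (Dg t w) v = pairing (Dg t v) w].
Proof.
move=> hp FE; have [D1 [D2 [h1 h2 h3 /(_ _ (dop_coef (smooth_cst 1)))[E hE e]]]] :=
  dop_variation hp.
have /choice[DE hDE] : forall a, exists D : loop -> loop -> R -> C,
    forall t w, mloop t -> mloop w ->
      path1 (fun s => E a (shift t w s)) (E a t) (D t w).
  by move=> a; have [D [_ [hD _ _ _]]] := dop_variation (hE a); exists D.
pose g t x : 'rV[C]_n := \row_a E a t x.
pose Dg t w x : 'rV[C]_n := \row_a DE a t w x.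
have pg t w a : mloop t -> mloop w ->
    path1 (fun s x => g (shift t w s) x 0 a) (fun x => g t x 0 a) (fun x => Dg t w x 0 a).
  move=> ht hw; apply: eq_path1 (hDE a t w ht hw) _ _ _ => [s x|x|x]; by rewrite mxE.
have gE t w : mloop t -> mloop w -> pairing (g t) w = cint (D1 t w).
  move=> ht hw; transitivity (cint (fun x => 1 * D1 t w x)).
    by rewrite e //; apply: eq_cint => x; apply: eq_bigr => i _; rewrite mxE.
  by apply: eq_cint => x; rewrite mul1r.
exists g, Dg; split.
- move=> t ht; split.
    apply/rloopP => a; apply: eq_smooth (dop_smooth (hE a) ht) => x; by rewrite mxE.
  move=> w hw; rewrite -[X in is_cderive _ _ X]/(pairing (g t) w) gE //.
  have := path1_cint (h1 t w ht hw); congr is_cderive.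
  by apply/funext => s; rewrite (FE _ (rloop_shift s ht hw)).
- by move=> t w ht hw; apply/rloopP => a; have [] := pg t w a ht hw.
- by move=> t w ht hw a; exact: pg.
- have key t v w : mloop t -> mloop v -> mloop w ->
      pairing (Dg t w) v = cint (D2 t v w).
    move=> ht hv hw; apply: is_cderive_uniq (path1_cint (h2 t v w ht hv hw)).
    have pv i : path1 (fun _ : R => fun x => v x 0 i) (fun x => v x 0 i) (fun=> 0).
      by apply: path1_cst; move/rloopP: hv.
    have := path1_cint (path1_sum (index_enum 'I_n) (fun i => path1M (pg t w i ht hw) (pv i))).
    rewrite (_ : (fun s => cint _) = fun s => cint (D1 (shift t w s) v)); last first.
      by apply/funext => s; rewrite -(gE _ _ (rloop_shift s ht hw) hv).
    congr is_cderive; apply: eq_cint => x; apply: eq_bigr => i _.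
    by rewrite mulr0 addr0.
  by move=> t v w ht hv hw; rewrite !key // h3.
Qed.

End DiffOperators.

(** * The Virasoro operator in one variable *)

Section IsDx.
Context {R : realType}.
Notation C := R[i].
Implicit Types f g : R -> C.

(** Smoothness and the value of the derivative together, so that a total
    derivative can be computed by structural recursion on the expression. *)
Record isdx f f' : Prop := IsDx { isdx_smooth : smooth f; isdxE : dx f = f' }.

Lemma isdx_dx f : smooth f -> isdx f (dx f).
Proof. by []. Qed.

Lemma isdx_cst (c : C) : isdx (fun=> c) (fun=> 0).
Proof. by split; [exact: smooth_cst|exact: dx_cst]. Qed.

Lemma isdxD f f' g g' : isdx f f' -> isdx g g' ->
  isdx (fun x => f x + g x) (fun x => f' x + g' x).
Proof.
by move=> [hf <-] [hg <-]; split; [exact: smoothD|exact: dxD].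
Qed.

Lemma isdxN f f' : isdx f f' -> isdx (fun x => - f x) (fun x => - f' x).
Proof. by move=> [hf <-]; split; [exact: smoothN|exact: dxN]. Qed.

Lemma isdxM f f' g g' : isdx f f' -> isdx g g' ->
  isdx (fun x => f x * g x) (fun x => f' x * g x + f x * g' x).
Proof.
by move=> [hf <-] [hg <-]; split; [exact: smoothM|exact: dxM].
Qed.

End IsDx.

Lemma two_neq0 (K : numDomainType) : 2 != 0 :> K. Proof. by rewrite pnatr_eq0. Qed.

(** The rules are applied to beta-expanded functions with explicit arguments,
    since higher-order unification would unfold the derivatives. *)
Ltac smooth_tac := lazymatch goal with
  | |- smooth (fun=> ?c) => exact (smooth_cst c)
  | |- smooth (fun x => @?f x + @?g x) =>
      refine (@smoothD _ f g _ _); smooth_tac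
  | |- smooth (fun x => - @?f x) => refine (@smoothN _ f _); smooth_tac
  | |- smooth (fun x => @?f x * @?g x) =>
      refine (@smoothM _ f g _ _); smooth_tac
  | |- smooth (fun x => dx ?f x) => refine (@smooth_dx _ f _); smooth_tac
  | |- smooth (fun x => ?f x) => change (smooth f); smooth_tac
  | |- smooth (dx ?f) => refine (@smooth_dx _ f _); smooth_tac
  | |- smooth _ => try assumption
  end.

Ltac isdx_tac := lazymatch goal with
  | |- isdx (fun=> ?c) _ => exact (isdx_cst c)
  | |- isdx (fun x => @?f x + @?g x) _ => refine (@isdxD _ f _ g _ _ _); isdx_tac
  | |- isdx (fun x => - @?f x) _ => refine (@isdxN _ f _ _); isdx_tac
  | |- isdx (fun x => @?f x * @?g x) _ => refine (@isdxM _ f _ g _ _ _); isdx_tac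
  | |- isdx (fun x => ?f x) _ => refine (@isdx_dx _ f _); smooth_tac
  | |- isdx ?f _ => refine (@isdx_dx _ f _); smooth_tac
  end.

(** The last summand on the right is the derivative of
    c p f g + k (f g'' - f' g' + f'' g). *)
Lemma virop_skew_alg (K : fieldType) (c k p p1 f f1 f2 f3 g g1 g2 g3 : K) : 2 != 0 :> K ->
  f * (c * (p * g1 + 2^-1 * p1 * g) + k * g3) =
  - (g * (c * (p * f1 + 2^-1 * p1 * f) + k * f3)) +
  (0 * (p * (f * g)) + c * (p1 * (f * g) + p * (f1 * g + f * g1)) +
   (0 * (f * g2 - f1 * g1 + f2 * g) +
    k * (f1 * g2 + f * g3 - (f2 * g1 + f1 * g2) + (f3 * g + f2 * g1)))).
Proof. by move=> n2; field. Qed.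

(** The last summand on the right is the derivative of (c/2) g p h. *)
Lemma virop_variation_alg (K : fieldType) (c p p1 g g1 h h1 h3 : K) : 2 != 0 :> K ->
  g * (c * (p * h1 + 2^-1 * p1 * h) + 0 * h3) =
  p * (c / 2 * (g * h1 - g1 * h)) +
  (0 * (g * (p * h)) + c / 2 * (g1 * (p * h) + g * (p1 * h + p * h1))).
Proof. by move=> n2; field. Qed.

(** The terms with p cancel in the cyclic sum, and those with k form the
    derivative of the cyclic sum of f'' (g h' - g' h). *)
Lemma virop_jacobi_alg (K : fieldType)
  (c k p p1 f f1 f2 f3 g g1 g2 g3 h h1 h2 h3 : K) : 2 != 0 :> K ->
  (c * (p * f1 + 2^-1 * p1 * f) + k * f3) * (g * h1 - g1 * h) +
  (c * (p * g1 + 2^-1 * p1 * g) + k * g3) * (h * f1 - h1 * f) +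
  (c * (p * h1 + 2^-1 * p1 * h) + k * h3) * (f * g1 - f1 * g) =
  0 + (0 * (f2 * (g * h1 - g1 * h) + g2 * (h * f1 - h1 * f) + h2 * (f * g1 - f1 * g)) +
  k * ((f3 * (g * h1 - g1 * h) + f2 * (g1 * h1 + g * h2 - (g2 * h + g1 * h1))) +
       (g3 * (h * f1 - h1 * f) + g2 * (h1 * f1 + h * f2 - (h2 * f + h1 * f1))) +
       (h3 * (f * g1 - f1 * g) + h2 * (f1 * g1 + f * g2 - (f2 * g + f1 * g1))))).
Proof. by move=> n2; field. Qed.

Section VirasoroScalar.
Context {R : realType}.
Notation C := R[i].
Implicit Types f g h phi : R -> C.

(** The operator c (phi d/dx + phi'/2) + k d^3/dx^3, the second Poisson operator of KdV. *)
Definition virop (c k : C) phi g : R -> C :=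
  fun x => c * (phi x * dx g x + 2^-1 * dx phi x * g x) + k * dx (dx (dx g)) x.

Definition wronskian g h : R -> C := fun x => g x * dx h x - dx g x * h x.

Lemma virop_smooth c k phi g : smooth phi -> smooth g -> smooth (virop c k phi g).
Proof. by move=> hphi hg; unfold virop; smooth_tac. Qed.

Lemma wronskian_smooth g h : smooth g -> smooth h -> smooth (wronskian g h).
Proof. by move=> hg hh; unfold wronskian; smooth_tac. Qed.

Lemma cint_eq_dx f g h h' : smooth g -> isdx h h' -> (forall x, f x = g x + h' x) ->
  cint f = cint g.
Proof.
move=> hg [hh <-] e; rewrite -[RHS]addr0 -(cint_dx hh) -(cintD hg (smooth_dx hh)).
exact: eq_cint.
Qed.

Lemma virop_skew c k phi f g : smooth phi -> smooth f -> smooth g ->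
  cint (fun x => f x * virop c k phi g x) = - cint (fun x => g x * virop c k phi f x).
Proof.
move=> hphi hf hg; have sg := smoothM hg (virop_smooth c k hphi hf).
rewrite -(cintN sg).
apply: (@cint_eq_dx _ _ (fun x => c * (phi x * (f x * g x)) +
  k * (f x * dx (dx g) x - dx f x * dx g x + dx (dx f) x * g x))).
- exact: smoothN.
- by isdx_tac.
- by move=> x; exact (virop_skew_alg c k (phi x) (dx phi x) (f x) (dx f x) (dx (dx f) x)
    (dx (dx (dx f)) x) (g x) (dx g x) (dx (dx g) x) (dx (dx (dx g)) x) (two_neq0 C)).
Qed.

(** The operator is linear in phi, and its adjoint in this argument is the
    Wronskian. *)
Lemma virop_variation c psi g h :
  smooth psi -> smooth g -> smooth h ->
  cint (fun x => g x * virop c 0 psi h x) =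
  cint (fun x => psi x * (c / 2 * wronskian g h x)).
Proof.
move=> hpsi hg hh.
apply: (@cint_eq_dx _ _ (fun x => c / 2 * (g x * (psi x * h x)))).
- by unfold wronskian; smooth_tac.
- by isdx_tac.
- by move=> x; exact (virop_variation_alg c (psi x) (dx psi x)
    (g x) (dx g x) (h x) (dx h x) (dx (dx (dx h)) x) (two_neq0 C)).
Qed.

(** The Jacobi identity of one Virasoro algebra, for arbitrary gradients. *)
Lemma virop_jacobi c k phi f g h : smooth phi -> smooth f -> smooth g -> smooth h ->
  cint (fun x => virop c k phi f x * wronskian g h x + virop c k phi g x * wronskian h f x
                 + virop c k phi h x * wronskian f g x) = 0.
Proof.
move=> hphi hf hg hh; rewrite -[RHS](cint0 (R := R)).
apply: (@cint_eq_dx _ _ (fun x =>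
  k * (dx (dx f) x * (g x * dx h x - dx g x * h x) +
       dx (dx g) x * (h x * dx f x - dx h x * f x) +
       dx (dx h) x * (f x * dx g x - dx f x * g x)))).
- exact: smooth_cst.
- by isdx_tac.
- by move=> x; exact (virop_jacobi_alg c k (phi x) (dx phi x)
    (f x) (dx f x) (dx (dx f) x) (dx (dx (dx f)) x)
    (g x) (dx g x) (dx (dx g) x) (dx (dx (dx g)) x)
    (h x) (dx h x) (dx (dx h) x) (dx (dx (dx h)) x) (two_neq0 C)).
Qed.

End VirasoroScalar.

(** * Decoupled brackets *)

Section VirasoroBracket.
Context {K : numClosedFieldType} {n : nat}.

Definition lin (M : 'M[K]_n) (q : 'I_n) (t : 'rV[K]_n) : K := \sum_a M q a * t 0 a.

(** The entry (i, j) of the sum of d_q b_q (x) b_q over the rows b_q of [b]. *)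
Definition diag_form (b : 'M[K]_n) (d : 'I_n -> K) (i j : 'I_n) : K :=
  \sum_q d q * (b q i * b q j).

(** The bracket that is diagonal in the linear coordinates y_q = [lin bt q t].
    The rows of [bt] are the differentials of the y_q, the rows of [b] the dual
    vector fields; the q-th operator is [virop] with phi_q = nu y_q + mu_q. *)
Definition vir (bt b : 'M[K]_n) (c kap : 'I_n -> K) (nu : K) (mu : 'I_n -> K) :
    bracket_expr K n :=
  BracketExpr 3 (fun d j a a' u => match d, j with
    | 1%N, 1%N => diag_form b (fun q => c q * (nu * lin bt q (u 0%N) + mu q)) a a'
    | 1%N, 0%N => diag_form b (fun q => c q * (2^-1 * (nu * lin bt q (u 1%N)))) a a'
    | 3%N, 3%N => diag_form b kap a a'
    | _, _ => 0
    end).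

Lemma diffpoly_sum (I : Type) (r : seq I) (F : I -> jet K n -> K) :
  (forall i, diffpoly (F i)) -> diffpoly (fun u => \sum_(i <- r) F i u).
Proof.
move=> h; elim: r => [|i r IH].
  have -> : (fun u => \sum_(i <- [::]) F i u) = fun _ : jet K n => 0.
    by apply/funext => u; rewrite big_nil.
  exact: diffpoly_const.
have -> : (fun u => \sum_(j <- i :: r) F j u) = fun u => F i u + \sum_(j <- r) F j u.
  by apply/funext => u; rewrite big_cons.
exact: diffpoly_add.
Qed.

Lemma linZ M q k t : lin M q (k *: t) = k * lin M q t.
Proof. by rewrite /lin mulr_sumr; apply: eq_bigr => a _; rewrite mxE mulrCA. Qed.

Lemma linD M q t t' : lin M q (t + t') = lin M q t + lin M q t'.
Proof. by rewrite /lin -big_split; apply: eq_bigr => a _; rewrite mxE mulrDr. Qed.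

Lemma diffpoly_lin M q s : diffpoly (fun u : jet K n => lin M q (u s)).
Proof.
apply: diffpoly_sum => a; apply: diffpoly_mul; first exact: diffpoly_const.
exact: diffpoly_var.
Qed.

Lemma vir_local bt b c kap nu mu : is_local (vir bt b c kap nu mu).
Proof.
split.
- have df d : (forall q, diffpoly (d q)) -> forall i j,
      diffpoly (fun u : jet K n => diag_form b (fun q => d q u) i j).
    move=> hd i j; apply: diffpoly_sum => q; apply: diffpoly_mul => //.
    exact: diffpoly_const.
  case=> [|[|[|[|d]]]] [|[|[|[|j]]]] a a' /=; try exact: diffpoly_const.
  + apply: (df (fun q (u : jet K n) => c q * (2^-1 * (nu * lin bt q (u 1%N))))) => q.
    do 3 (apply: diffpoly_mul; first exact: diffpoly_const).
    exact: diffpoly_lin.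
  + apply: (df (fun q (u : jet K n) => c q * (nu * lin bt q (u 0%N) + mu q))) => q.
    apply: diffpoly_mul; first exact: diffpoly_const.
    apply: diffpoly_add; last exact: diffpoly_const.
    apply: diffpoly_mul; first exact: diffpoly_const.
    exact: diffpoly_lin.
- case=> [|[|[|[|d]]]] [|[|[|[|j]]]] a a' m u //= _; rewrite ?mulr0 ?subnn ?expr0 ?mul1r //.
    rewrite subn0 expr1 /diag_form mulr_sumr; apply: eq_bigr => q _.
    by rewrite linZ ?expr1; ring.
  by rewrite ?expr0 scale1r.
- by case=> [|[|[|[|d]]]] [|[|[|[|j]]]] a a' u.
Qed.

End VirasoroBracket.

Section DualFrames.
Context {K : numClosedFieldType} {n : nat}.
Variables (bt b : 'M[K]_n).
Hypothesis dual : bt *m b^T = 1%:M.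

Lemma dualT : b^T *m bt = 1%:M. Proof. exact: mulmx1C. Qed.

Lemma sum_dual q p : \sum_a bt q a * b p a = (q == p)%:R.
Proof.
by have /matrixP/(_ q p) := dual; rewrite !mxE => <-; apply: eq_bigr => a _; rewrite mxE.
Qed.

Lemma sum_dualT i j : \sum_q b q i * bt q j = (i == j)%:R.
Proof.
by have /matrixP/(_ i j) := dualT; rewrite !mxE => <-; apply: eq_bigr => a _; rewrite mxE.
Qed.

Lemma sum_delta (f : 'I_n -> K) q : \sum_p (q == p)%:R * f p = f q.
Proof.
rewrite (bigD1 q) //= eqxx mul1r big1 ?addr0 // => p pq.
by rewrite eq_sym (negPf pq) mul0r.
Qed.

Lemma lin_sum_dual (d : 'I_n -> K) q : lin bt q (\row_i \sum_p d p * b p i) = d q.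
Proof.
rewrite /lin; under eq_bigr do rewrite mxE mulr_sumr.
rewrite exchange_big /= -[RHS](sum_delta d); apply: eq_bigr => p _.
by rewrite -sum_dual mulr_suml; apply: eq_bigr => a _; ring.
Qed.

Lemma sum_lin_dual t i : \sum_q b q i * lin bt q t = t 0 i.
Proof.
under eq_bigr do rewrite /lin mulr_sumr.
rewrite exchange_big /= -[RHS](sum_delta (fun j => t 0 j)); apply: eq_bigr => j _.
by rewrite -sum_dualT mulr_suml; apply: eq_bigr => q _; ring.
Qed.

End DualFrames.

Lemma sum_triangle4 (V : nmodType) (F : nat -> nat -> V) :
  \sum_(d < 4) \sum_(j < d.+1) F d j =
  F 0%N 0%N + (F 1%N 0%N + F 1%N 1%N) + (F 2%N 0%N + F 2%N 1%N + F 2%N 2%N) +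
  (F 3%N 0%N + F 3%N 1%N + F 3%N 2%N + F 3%N 3%N).
Proof. by rewrite !big_ord_recr /= !big_ord0 /= ?big_ord_recr ?big_ord0 /= !add0r. Qed.

Section VirasoroPoisson.
Context {R : realType} {n : nat}.
Notation C := R[i].
Notation loop := (R -> 'rV[C]_n).
Variables (bt b : 'M[C]_n) (c kap mu : 'I_n -> C) (nu : C).
Hypothesis dual : bt *m b^T = 1%:M.
Implicit Types t f g h v w : loop.

Local Notation P := (vir bt b c kap nu mu).
Local Notation shift t w s := (fun x => t x + s%:C *: w x).

(** With [M := b] and [g] a gradient this is the component of the gradient
    along y_q; with [M := bt] and [g] a loop it is y_q along the loop. *)
Definition cpt (M : 'M[C]_n) q g : R -> C := fun x => lin M q (g x).

Definition phi q t : R -> C := fun x => nu * cpt bt q t x + mu q.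

Definition vop q t g : R -> C := virop (c q) (kap q) (phi q t) (cpt b q g).

(** The Hamiltonian operator of the bracket applied to the covector [g]; [vop]
    is its q-th component in the coordinates y. *)
Definition ham t g : loop := fun x => \row_a \sum_q b q a * vop q t g x.

Lemma cpt_smooth M q g : mloop g -> smooth (cpt M q g).
Proof.
by move=> /rloopP hg; apply: smooth_sum => a; exact: smoothZ.
Qed.

Lemma phi_smooth q t : mloop t -> smooth (phi q t).
Proof.
by move=> ht; apply: smoothD (smoothZ _ (cpt_smooth _ _ ht)) (smooth_cst _).
Qed.

Lemma dx_phi q t : mloop t -> dx (phi q t) = fun x => nu * dx (cpt bt q t) x.
Proof.
move=> ht; have hc := cpt_smooth bt q ht.
rewrite /phi (dxD (smoothZ _ hc) (smooth_cst _)) (dxZ _ hc) dx_cst.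
by apply/funext => x; rewrite addr0.
Qed.

Lemma iter_dx_cpt M q g j : mloop g ->
  iter j dx (cpt M q g) = fun x => \sum_a M q a * iter j dx (fun y => g y 0 a) x.
Proof.
move=> /rloopP hg; rewrite iter_dx_sum => [|a]; last exact: smoothZ.
by apply/funext => x; apply: eq_bigr => a _; rewrite iter_dxZ.
Qed.

Lemma vop_smooth q t g : mloop t -> mloop g -> smooth (vop q t g).
Proof.
by move=> ht hg; apply: virop_smooth; [exact: phi_smooth|exact: cpt_smooth].
Qed.

Lemma ham_loop t g : mloop t -> mloop g -> mloop (ham t g).
Proof.
move=> ht hg; apply/rloopP => a.
apply: (@eq_smooth _ (fun x => \sum_q b q a * vop q t g x)) => [x|]; first by rewrite mxE.
by apply: smooth_sum => q; apply: smoothZ; exact: vop_smooth.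
Qed.

Lemma diag_form_sum (d : 'I_n -> C) a g x j : mloop g ->
  \sum_a' diag_form b d a a' * iter j dx (fun y => g y 0 a') x =
  \sum_q b q a * (d q * iter j dx (cpt b q g) x).
Proof.
move=> hg; under eq_bigr do rewrite /diag_form mulr_suml.
rewrite exchange_big /=; apply: eq_bigr => q _.
rewrite iter_dx_cpt // !mulr_sumr; apply: eq_bigr => a' _; ring.
Qed.

(** Of the ten terms with j <= d <= 3 only three survive; together they form
    [vop]. *)
Lemma lb_op_vir t g a x : mloop t -> mloop g -> lb_op P t g a x = ham t g x 0 a.
Proof.
move=> ht hg.
pose S d j := \sum_a' lb_coef P d j a a' (jet_of t x) * iter j dx (fun y => g y 0 a') x.
have S0 d j : (forall a', lb_coef P d j a a' (jet_of t x) = 0) -> S d j = 0.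
  by move=> h; rewrite /S big1 // => a' _; rewrite h mul0r.
have [S00 S20 S21 S22] := And4 (S0 0 0 (fun=> erefl)) (S0 2 0 (fun=> erefl))
  (S0 2 1 (fun=> erefl)) (S0 2 2 (fun=> erefl)).
have [S30 S31 S32] := And3 (S0 3 0 (fun=> erefl)) (S0 3 1 (fun=> erefl))
  (S0 3 2 (fun=> erefl)).
have jx0 q : lin bt q (jet_of t x 0%N) = cpt bt q t x.
  by apply: eq_bigr => i _; rewrite mxE.
have jx1 q : lin bt q (jet_of t x 1%N) = dx (cpt bt q t) x.
  rewrite -[dx _]/(iter 1 dx (cpt bt q t)) iter_dx_cpt //.
  by apply: eq_bigr => i _; rewrite mxE.
have S10 : S 1%N 0%N =
    \sum_q b q a * (c q * (2^-1 * (nu * dx (cpt bt q t) x)) * cpt b q g x).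
  by rewrite [LHS](diag_form_sum _ _ _ 0 hg); apply: eq_bigr => q _; rewrite jx1.
have S11 : S 1%N 1%N = \sum_q b q a * (c q * phi q t x * dx (cpt b q g) x).
  by rewrite [LHS](diag_form_sum _ _ _ 1 hg); apply: eq_bigr => q _; rewrite jx0.
have S33 : S 3%N 3%N = \sum_q b q a * (kap q * dx (dx (dx (cpt b q g))) x).
  by rewrite [LHS](diag_form_sum _ _ _ 3 hg).
transitivity (\sum_(d < 4) \sum_(j < d.+1) S d j); first by [].
rewrite sum_triangle4 S00 S20 S21 S22 S30 S31 S32 S10 S11 S33 !add0r !addr0.
rewrite mxE -!big_split /=; apply: eq_bigr => q _.
by rewrite /vop /virop dx_phi //; ring.
Qed.

Lemma pairing_ham v t g : mloop v -> mloop t -> mloop g ->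
  pairing v (ham t g) = \sum_q cint (fun x => cpt b q v x * vop q t g x).
Proof.
move=> hv ht hg; rewrite -cint_sum => [|q]; last first.
  by apply: smoothM; [exact: cpt_smooth|exact: vop_smooth].
apply: eq_cint => x; under eq_bigr do rewrite mxE mulr_sumr.
rewrite exchange_big /=; apply: eq_bigr => q _.
rewrite /cpt /lin mulr_suml; apply: eq_bigr => a _; ring.
Qed.

Lemma lb_pair_vir t f g : mloop t -> mloop g -> lb_pair P t f g = pairing f (ham t g).
Proof.
move=> ht hg; apply: eq_cint => x; apply: eq_bigr => a _.
by rewrite lb_op_vir.
Qed.

Lemma ham_skew t f g : mloop t -> mloop f -> mloop g ->
  pairing f (ham t g) = - pairing g (ham t f).
Proof.
move=> ht hf hg; rewrite !pairing_ham // -sumrN; apply: eq_bigr => q _.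
by apply: virop_skew; [exact: phi_smooth|exact: cpt_smooth|exact: cpt_smooth].
Qed.

End VirasoroPoisson.

(** * The Jacobi identity *)

Lemma path1_virop_alg (K : comPzRingType) (c k e p p1 q q1 h h1 h3 m m1 m3 : K) :
  0 * (p * h1 + e * p1 * h) +
    c * ((q * h1 + p * m1) + ((0 * p1 + e * q1) * h + e * p1 * m)) + (0 * h3 + k * m3) =
  c * (p * m1 + e * p1 * m) + k * m3 + (c * (q * h1 + e * q1 * h) + 0 * h3).
Proof. by ring. Qed.

Lemma jacobi_alg (V : comPzRingType) (a a' b b' c c' w1 w2 w3 : V) :
  a = a' -> b = b' -> c = c' -> w1 + w2 + w3 = 0 ->
  c - b - w1 + (a - c' - w2) + (b' - a' - w3) = 0.
Proof.
move=> -> -> -> w; rewrite -[RHS]oppr0 -w; ring.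
Qed.

Lemma sum3_alg (V : nmodType) (a a' b b' c c' : V) :
  a = a' -> b = b' -> c = c' -> a' + b' + c' = 0 -> a + b + c = 0.
Proof. by move=> -> -> ->. Qed.

Lemma jacobi_dist_alg (V : comPzRingType) (n u v w u' v' w' : V) :
  n * u' * u + n * v' * v + n * w' * w = n * (u * u' + v * v' + w * w').
Proof. by ring. Qed.

Section VirasoroJacobi.
Context {R : realType} {n : nat}.
Notation C := R[i].
Notation loop := (R -> 'rV[C]_n).
Implicit Types t f g h v w : loop.
Local Notation shift t w s := (fun x => t x + s%:C *: w x).

(** Leibniz rule: the operator is affine in phi and linear in its argument. *)
Lemma path1_virop (c k : C) p p0 p1 q q0 q1 : path1 p p0 p1 -> path1 q q0 q1 ->
  path1 (fun s => virop c k (p s) (q s)) (virop c k p0 q0)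
        (fun x => virop c k p0 q1 x + virop c 0 p1 q0 x).
Proof.
move=> hp hq; have cc (a : C) := path1_cst (smooth_cst a : smooth (fun _ : R => a)).
apply: eq_path1 (path1D
  (path1M (cc c) (path1D (path1M hp (path1_dx hq))
                         (path1M (path1M (cc 2^-1) (path1_dx hp)) hq)))
  (path1M (cc k) (path1_dx (path1_dx (path1_dx hq))))) _ _ _ => [s x|x|x].
- by rewrite /virop.
- by rewrite /virop.
rewrite /virop; exact (path1_virop_alg c k 2^-1 (p0 x) (dx p0 x) (p1 x) (dx p1 x)
  (q0 x) (dx q0 x) (dx (dx (dx q0)) x) (q1 x) (dx q1 x) (dx (dx (dx q1)) x)).
Qed.

Lemma path1_cpt M q (p : R -> loop) (p0 p1 : loop) :
  (forall a, path1 (fun s x => p s x 0 a) (fun x => p0 x 0 a) (fun x => p1 x 0 a)) ->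
  path1 (fun s => cpt M q (p s)) (cpt M q p0) (cpt M q p1).
Proof.
move=> h; have hM a := path1M (path1_cst (smooth_cst (M q a) : smooth (fun _ : R => M q a))) (h a).
apply: eq_path1 (path1_sum (index_enum 'I_n) hM) _ _ _ => // x.
by apply: eq_bigr => a _; rewrite mul0r add0r.
Qed.

Lemma pairingDr v f g : mloop v -> mloop f -> mloop g ->
  pairing v (fun x => f x + g x) = pairing v f + pairing v g.
Proof.
move=> hv hf hg; rewrite -(cintD (pairing_smooth hv hf) (pairing_smooth hv hg)).
by apply: eq_cint => x; rewrite -big_split; apply: eq_bigr => i _; rewrite mxE mulrDr.
Qed.

Lemma pairingNr v f : mloop v -> mloop f -> pairing v (fun x => - f x) = - pairing v f.
Proof.
move=> hv hf; rewrite -(cintN (pairing_smooth hv hf)).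
by apply: eq_cint => x; rewrite -sumrN; apply: eq_bigr => i _; rewrite mxE mulrN.
Qed.

Lemma rloopD f g : mloop f -> mloop g -> mloop (fun x => f x + g x).
Proof.
move=> /rloopP hf /rloopP hg; apply/rloopP => a.
by apply: eq_smooth (smoothD (hf a) (hg a)) => x; rewrite mxE.
Qed.

Lemma rloopN f : mloop f -> mloop (fun x => - f x).
Proof.
move=> /rloopP hf; apply/rloopP => a.
by apply: eq_smooth (smoothN (hf a)) => x; rewrite mxE.
Qed.

(** [g] behaves like the gradient map of a functional: its derivative [Dg] along
    paths exists and is symmetric. *)
Record hessian (g : loop -> loop) (Dg : loop -> loop -> loop) : Prop := Hessian {
  hessian_loop : forall t, mloop t -> mloop (g t);
  hessian_Dloop : forall t w, mloop t -> mloop w -> mloop (Dg t w);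
  hessian_path : forall t w, mloop t -> mloop w -> forall a,
    path1 (fun s x => g (shift t w s) x 0 a) (fun x => g t x 0 a) (fun x => Dg t w x 0 a);
  hessian_sym : forall t v w, mloop t -> mloop v -> mloop w ->
    pairing (Dg t w) v = pairing (Dg t v) w }.

Lemma local_functional_gradient (F : functional n) : local_functional F ->
  exists (g : loop -> loop) Dg, hessian g Dg /\ forall t, mloop t -> is_gradient F t (g t).
Proof.
move=> [f hf ->]; have [//|g [Dg [h1 h2 h3 h4]]] := local_gradient (density_dop hf)
  (F := fun t => cint (fun x => f x (jet_of t x))).
exists g, Dg; split; last exact: h1.
apply: Hessian; [move=> t ht|exact: h2|exact: h3|exact: h4].
exact: (h1 t ht).1.
Qed.

Variables (bt b : 'M[C]_n) (c kap mu : 'I_n -> C) (nu : C).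
Hypothesis dual : bt *m b^T = 1%:M.
Local Notation P := (vir bt b c kap nu mu).
Local Notation ham := (ham bt b c kap mu nu).
Local Notation vop := (vop bt b c kap mu nu).
Local Notation phi := (phi bt mu nu).

(** The derivative in t of the operator [ham t], contracted with g and h,
    after integration by parts. *)
Definition wronskian_vec g h : loop := fun x =>
  \row_a \sum_q bt q a * (nu * (c q / 2) * wronskian (cpt b q g) (cpt b q h) x).

Lemma wronskian_vec_loop g h : mloop g -> mloop h -> mloop (wronskian_vec g h).
Proof.
move=> hg hh; apply/rloopP => a.
apply: (@eq_smooth _ (fun x => \sum_q bt q a * (nu * (c q / 2) *
  wronskian (cpt b q g) (cpt b q h) x))) => [x|]; first by rewrite mxE.
apply: smooth_sum => q; do 2 apply: smoothZ.
by apply: wronskian_smooth; exact: cpt_smooth.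
Qed.

Lemma pairing_wronskian v g h : mloop v -> mloop g -> mloop h ->
  pairing (wronskian_vec g h) v =
  \sum_q cint (fun x => (nu * (c q / 2) * wronskian (cpt b q g) (cpt b q h) x) * cpt bt q v x).
Proof.
move=> hv hg hh; rewrite -cint_sum => [|q]; last first.
  apply: smoothM; last exact: cpt_smooth.
  by apply: smoothZ; apply: wronskian_smooth; exact: cpt_smooth.
apply: eq_cint => x; under eq_bigr do rewrite mxE mulr_suml.
rewrite exchange_big /=; apply: eq_bigr => q _.
by rewrite /cpt /lin mulr_sumr; apply: eq_bigr => a _; rewrite mulrAC mulrC.
Qed.

Lemma cpt_ham q t g : cpt bt q (ham t g) = vop q t g.
Proof.
apply/funext => x; rewrite -[RHS](lin_sum_dual dual (fun q => vop q t g x)).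
congr (lin bt q _); apply/rowP => a; rewrite !mxE.
by apply: eq_bigr => p _; rewrite mulrC.
Qed.

Lemma pairing_wronskian_ham t f g h : mloop t -> mloop f -> mloop g -> mloop h ->
  pairing (wronskian_vec g h) (ham t f) =
  \sum_q cint (fun x => (nu * (c q / 2) * wronskian (cpt b q g) (cpt b q h) x) * vop q t f x).
Proof.
move=> ht hf hg hh; have hP : mloop (ham t f) by exact: ham_loop.
rewrite (pairing_wronskian hP hg hh); apply: eq_bigr => q _.
by rewrite cpt_ham.
Qed.

(** The derivative of the pairing of g and P h along w has three
    terms, from g, from h and from P.  Skewness of P and symmetry of the
    Hessians move w to one side in the first two, [virop_variation] in the
    third. *)
Lemma bracket_gradient (g h : loop -> loop) Dg Dh (B : functional n) : hessian g Dg -> hessian h Dh ->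
  (forall t, mloop t -> B t = pairing (g t) (ham t (h t))) ->
  forall t, mloop t -> is_gradient B t (fun x =>
    (Dg t (ham t (h t)) x - Dh t (ham t (g t)) x) + wronskian_vec (g t) (h t) x).
Proof.
move=> Hg Hh BE t ht.
have lg := hessian_loop Hg ht; have lh := hessian_loop Hh ht.
have lPh : mloop (ham t (h t)) by exact: ham_loop.
have lPg : mloop (ham t (g t)) by exact: ham_loop.
have lDg := hessian_Dloop Hg ht lPh; have lDh := hessian_Dloop Hh ht lPg.
have lw := wronskian_vec_loop lg lh.
have l1 := rloopD lDg (rloopN lDh); have l2 := rloopD l1 lw.
split=> // w hw.
have lDgw := hessian_Dloop Hg ht hw; have lDhw := hessian_Dloop Hh ht hw.
have pphi q : path1 (fun s => phi q (shift t w s)) (phi q t) (fun x => nu * cpt bt q w x).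
  have hc := cpt_smooth bt q ht; have hcw := cpt_smooth bt q hw.
  apply: polypath_path1; first exact: phi_smooth.
    exact: smoothZ.
  by move=> s x; rewrite /phi /cpt linD linZ; ring.
have pB q := path1M (path1_cpt b q (hessian_path Hg ht hw))
  (path1_virop (c q) (kap q) (pphi q) (path1_cpt b q (hessian_path Hh ht hw))).
have := path1_cint (path1_sum (index_enum 'I_n) pB).
have -> : (fun s : R => cint (fun x => \sum_(q <- index_enum 'I_n)
    cpt b q (g (shift t w s)) x * virop (c q) (kap q) (phi q (shift t w s))
                                      (cpt b q (h (shift t w s))) x)) =
    fun s => B (shift t w s).
  apply/funext => s; have hs := rloop_shift s ht hw.
  have lgs := hessian_loop Hg hs; have lhs := hessian_loop Hh hs.
  rewrite (BE _ hs) (pairing_ham _ _ _ _ _ _ lgs hs lhs) -cint_sum.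
    by apply: eq_cint => x; apply: eq_bigr => q _; rewrite /vop.
  by move=> q; apply: smoothM; [exact: cpt_smooth|exact: vop_smooth].
congr is_cderive; rewrite -/(pairing _ w).
transitivity (pairing (Dg t w) (ham t (h t)) + pairing (g t) (ham t (Dh t w)) +
              pairing (wronskian_vec (g t) (h t)) w); last first.
  rewrite (ham_skew _ _ _ _ _ _ ht lg lDhw) !(pairingC _ w).
  rewrite (pairingDr hw l1 lw) (pairingDr hw lDg (rloopN lDh)) (pairingNr hw lDh).
  by rewrite (hessian_sym Hg ht lPh hw) (pairingC _ (Dh _ _)) (hessian_sym Hh ht lPg hw)
    !(pairingC w).
rewrite (pairing_ham _ _ _ _ _ _ lDgw ht lh) (pairing_ham _ _ _ _ _ _ lg ht lDhw).
rewrite (pairing_wronskian hw lg lh) -!big_split cint_sum => [|q]; last first.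
  by case: (pB q).
apply: eq_bigr => q _.
have sG := cpt_smooth b q lg; have sH := cpt_smooth b q lh.
have sGw := cpt_smooth b q lDgw; have sHw := cpt_smooth b q lDhw.
have sw := cpt_smooth bt q hw; have sp := phi_smooth bt mu nu q ht.
have s1 := smoothM sGw (virop_smooth (c q) (kap q) sp sH).
have s2 := smoothM sG (virop_smooth (c q) (kap q) sp sHw).
have s3 := smoothM sG (virop_smooth (c q) 0 (smoothZ nu sw) sH).
transitivity (cint (fun x => cpt b q (Dg t w) x * virop (c q) (kap q) (phi q t) (cpt b q (h t)) x)
  + cint (fun x => cpt b q (g t) x * virop (c q) (kap q) (phi q t) (cpt b q (Dh t w)) x)
  + cint (fun x => cpt b q (g t) x * virop (c q) 0 (fun x => nu * cpt bt q w x) (cpt b q (h t)) x)).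
  rewrite -(cintD s1 s2) -(cintD (smoothD s1 s2) s3).
  apply: eq_cint => x; set u1 := (X in X + _ = _); set u2 := cpt b q (g t) x.
  set v1 := virop _ _ _ (cpt b q (Dh t w)) x; set v2 := virop _ 0 _ _ x.
  by rewrite mulrDr addrA.
congr (_ + _).
rewrite [LHS](virop_variation (c q) (smoothZ nu sw) sG sH).
by apply: eq_cint => x; set w1 := wronskian _ _ x; ring.
Qed.

(** Skewness of P turns the pairing of f with P applied to the gradient of
    {G, H} into Hessian and Wronskian terms paired with P f.  The six Hessian
    terms cancel in pairs by symmetry. *)
Lemma jacobi_vir (f g h : loop -> loop) Df Dg Dh t :
  hessian f Df -> hessian g Dg -> hessian h Dh -> mloop t ->
  let grad (g : loop -> loop) (Dg : loop -> loop -> loop) (h : loop -> loop)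
    (Dh : loop -> loop -> loop) := fun x : R =>
    (Dg t (ham t (h t)) x - Dh t (ham t (g t)) x) + wronskian_vec (g t) (h t) x in
  pairing (f t) (ham t (grad g Dg h Dh)) + pairing (g t) (ham t (grad h Dh f Df)) +
  pairing (h t) (ham t (grad f Df g Dg)) = 0.
Proof.
move=> Hf Hg Hh ht grad.
have E (f1 : loop -> loop) Df1 (g1 : loop -> loop) Dg1 (h1 : loop -> loop) Dh1 :
    hessian f1 Df1 -> hessian g1 Dg1 -> hessian h1 Dh1 ->
    pairing (f1 t) (ham t (grad g1 Dg1 h1 Dh1)) =
    pairing (Dh1 t (ham t (g1 t))) (ham t (f1 t)) - pairing (Dg1 t (ham t (h1 t))) (ham t (f1 t))
    - pairing (wronskian_vec (g1 t) (h1 t)) (ham t (f1 t)).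
  move=> Hf1 Hg1 Hh1.
  have lf := hessian_loop Hf1 ht; have lg := hessian_loop Hg1 ht; have lh := hessian_loop Hh1 ht.
  have lPf : mloop (ham t (f1 t)) by exact: ham_loop.
  have lPh : mloop (ham t (h1 t)) by exact: ham_loop.
  have lPg : mloop (ham t (g1 t)) by exact: ham_loop.
  have lDg := hessian_Dloop Hg1 ht lPh; have lDh := hessian_Dloop Hh1 ht lPg.
  have lw := wronskian_vec_loop lg lh.
  have l1 := rloopD lDg (rloopN lDh).
  rewrite (ham_skew _ _ _ _ _ _ ht lf (rloopD l1 lw)) pairingC.
  rewrite (pairingDr lPf l1 lw) (pairingDr lPf lDg (rloopN lDh)) (pairingNr lPf lDh).
  by rewrite !(pairingC (ham t (f1 t))); ring.
rewrite (E _ _ _ _ _ _ Hf Hg Hh) (E _ _ _ _ _ _ Hg Hh Hf) (E _ _ _ _ _ _ Hh Hf Hg).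
have lf := hessian_loop Hf ht; have lg := hessian_loop Hg ht; have lh := hessian_loop Hh ht.
have lPf : mloop (ham t (f t)) by exact: ham_loop.
have lPh : mloop (ham t (h t)) by exact: ham_loop.
have lPg : mloop (ham t (g t)) by exact: ham_loop.
refine (jacobi_alg (hessian_sym Hf ht lPg lPh) (hessian_sym Hg ht lPf lPh)
  (hessian_sym Hh ht lPf lPg) _).
refine (sum3_alg (pairing_wronskian_ham ht lf lg lh) (pairing_wronskian_ham ht lg lh lf)
  (pairing_wronskian_ham ht lh lf lg) _).
rewrite -!big_split big1 // => q _.
have sF := cpt_smooth b q lf; have sG := cpt_smooth b q lg; have sH := cpt_smooth b q lh.
have sp := phi_smooth bt mu nu q ht.
have T (u v1 w1 : R -> C) : smooth u -> smooth v1 -> smooth w1 ->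
    smooth (fun x => (nu * (c q / 2) * wronskian u v1 x) * virop (c q) (kap q) (phi q t) w1 x).
  by move=> hu hv hw; apply: smoothM (virop_smooth _ _ sp hw); apply/smoothZ/wronskian_smooth.
have S (u v1 w1 : R -> C) : smooth u -> smooth v1 -> smooth w1 ->
    smooth (fun x => virop (c q) (kap q) (phi q t) w1 x * wronskian u v1 x).
  by move=> hu hv hw; apply: smoothM (virop_smooth _ _ sp hw) (wronskian_smooth hu hv).
have j := virop_jacobi (c q) (kap q) sp sF sG sH.
have z := cintZ (nu * (c q / 2))
  (smoothD (smoothD (S _ _ _ sG sH sF) (S _ _ _ sH sF sG)) (S _ _ _ sF sG sH)).
refine (etrans (esym (etrans (cintD (smoothD (T _ _ _ sG sH sF) (T _ _ _ sH sF sG))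
  (T _ _ _ sF sG sH)) (congr1 (fun y => y + _) (cintD (T _ _ _ sG sH sF) (T _ _ _ sH sF sG))))) _).
refine (etrans (etrans (eq_cint _) z) (etrans (congr1 (fun y => _ * y) j) (mulr0 _))) => x.
exact: jacobi_dist_alg.
Qed.

(** Gradients of local functionals and of their brackets exist and are
    unique, so the iterated brackets are pairings of the gradients computed in
    [bracket_gradient]. *)
Theorem poisson_vir U : poisson U P.
Proof.
split; first exact: vir_local.
move=> F G H hF hG hH t ht _.
have [f [Df [Hf gf]]] := local_functional_gradient hF.
have [g [Dg [Hg gg]]] := local_functional_gradient hG.
have [h [Dh [Hh gh]]] := local_functional_gradient hH.
have LB A B a a' : (forall s, mloop s -> is_gradient A s (a s)) ->
    (forall s, mloop s -> is_gradient B s (a' s)) ->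
    forall s, mloop s -> lb_bracket P A B s = pairing (a s) (ham s (a' s)).
  move=> gA gB s hs; rewrite /lb_bracket (gradientE (gA s hs)) (gradientE (gB s hs)).
  by rewrite (lb_pair_vir _ _ _ _ _ _ _ hs (gB s hs).1).
have gGH := bracket_gradient Hg Hh (LB _ _ _ _ gg gh).
have gHF := bracket_gradient Hh Hf (LB _ _ _ _ gh gf).
have gFG := bracket_gradient Hf Hg (LB _ _ _ _ gf gg).
split.
  rewrite (LB _ _ _ _ gf gg _ ht) (LB _ _ _ _ gg gf _ ht).
  exact: ham_skew ht (hessian_loop Hf ht) (hessian_loop Hg ht).
have L3 A B a k : (forall s, mloop s -> is_gradient A s (a s)) -> is_gradient B t k ->
    lb_bracket P A B t = pairing (a t) (ham t k).
  move=> gA gB; rewrite /lb_bracket (gradientE (gA t ht)) (gradientE gB).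
  by rewrite (lb_pair_vir _ _ _ _ _ _ _ ht gB.1).
rewrite (L3 _ _ _ _ gf (gGH t ht)) (L3 _ _ _ _ gg (gHF t ht)) (L3 _ _ _ _ gh (gFG t ht)).
exact: jacobi_vir.
Qed.

End VirasoroJacobi.

(** * Partial derivatives and matrices diagonal in the dual frame *)

Section DirectionalDerivatives.
Context {K : numFieldType} {V : normedModType K}.
Implicit Types (t v : V) (f g : V -> K).

Lemma deriv_add f g t v a b : is_derive t v f a -> is_derive t v g b ->
  is_derive t v (fun s => f s + g s) (a + b).
Proof. by move=> df dg; exact: is_deriveD df dg. Qed.

Lemma deriv_mul f g t v a b : is_derive t v f a -> is_derive t v g b ->
  is_derive t v (fun s => f s * g s) (a * g t + f t * b).
Proof.
move=> df dg; apply: is_derive_eq (is_deriveM df dg) _.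
by rewrite addrC [g t *: _]mulrC.
Qed.

Lemma deriv_cst c t v : is_derive t v (fun _ : V => c : K) 0.
Proof. exact: is_derive_cst. Qed.

Lemma deriv_scale c f t v a : is_derive t v f a -> is_derive t v (fun s => c * f s) (c * a).
Proof.
move=> df; apply: is_derive_eq (deriv_mul (deriv_cst c t v) df) _.
by rewrite mul0r add0r.
Qed.

Lemma deriv_inv f t v a : f t != 0 -> is_derive t v f a ->
  is_derive t v (fun s => (f s)^-1) (- (f t) ^- 2 * a).
Proof.
move=> nz [df <-]; apply: DeriveDef; first exact: derivableV.
exact: deriveV.
Qed.

Lemma deriv_sum (I : Type) (r : seq I) (h : I -> V -> K) t v (a : I -> K) :
  (forall i, is_derive t v (h i) (a i)) ->
  is_derive t v (fun s => \sum_(i <- r) h i s) (\sum_(i <- r) a i).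
Proof.
move=> hi; elim: r => [|i r IH].
  rewrite big_nil (_ : (fun _ => _) = fun=> 0); first exact: deriv_cst.
  by apply/funext => s; rewrite big_nil.
rewrite big_cons.
have -> : (fun s => \sum_(j <- i :: r) h j s) = fun s => h i s + \sum_(j <- r) h j s.
  by apply/funext => s; rewrite big_cons.
exact: deriv_add (hi i) IH.
Qed.

Lemma deriv_linear (l : V -> K) t v : (forall k, l (k *: v + t) = k * l v + l t) ->
  is_derive t v l (l v).
Proof.
move=> hl; have c : (fun h => h^-1 *: ((l \o shift t) (h *: v) - l t)) @ 0^' --> l v.
  apply: cvg_near_cst; near=> h.
  rewrite /= hl addrK; apply: mulKf; near: h; exact: nbhs_dnbhs_neq.
apply: DeriveDef; first by apply/cvg_ex; exists (l v).
exact: cvg_lim c.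
Unshelve. all: by end_near. Qed.

Lemma deriv_prod (I : Type) (r : seq I) (P : pred I) (h : I -> V -> K) t v (a : I -> K) :
  (forall i, is_derive t v (h i) (a i)) ->
  exists d, is_derive t v (fun s => \prod_(i <- r | P i) h i s) d.
Proof.
move=> hi; elim: r => [|i r [d hd]].
  exists 0; rewrite (_ : (fun _ => _) = fun=> 1); first exact: deriv_cst.
  by apply/funext => s; rewrite big_nil.
case Pi : (P i); last first.
  exists d; rewrite (_ : (fun _ => _) = fun s => \prod_(j <- r | P j) h j s) //.
  by apply/funext => s; rewrite big_cons Pi.
exists (a i * \prod_(j <- r | P j) h j t + h i t * d).
have -> : (fun s => \prod_(j <- i :: r | P j) h j s) =
    fun s => h i s * \prod_(j <- r | P j) h j s.
  by apply/funext => s; rewrite big_cons Pi.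
exact: deriv_mul.
Qed.

(** At a zero of the factor [p], the Leibniz rule for the product keeps only the
    term in which that factor is differentiated. *)
Lemma deriv_prod_root (I : finType) (h : I -> V -> K) t v (a : I -> K) p :
  (forall i, is_derive t v (h i) (a i)) -> h p t = 0 ->
  is_derive t v (fun s => \prod_i h i s) (a p * \prod_(i | i != p) h i t).
Proof.
move=> hi z; have [d hd] := deriv_prod (index_enum I) (predC1 p) hi.
have -> : (fun s => \prod_i h i s) = fun s => h p s * \prod_(i | i != p) h i s.
  by apply/funext => s; rewrite (bigD1 p).
by apply: is_derive_eq (deriv_mul (hi p) hd) _; rewrite z mul0r addr0.
Qed.

End DirectionalDerivatives.

Section PartialDerivatives.
Context {K : numClosedFieldType} {n : nat}.
Notation V := 'rV[K]_n.
Implicit Types (t v : V) (f g : V -> K).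

Lemma deriv_lin (M : 'M[K]_n) q t v : is_derive t v (lin M q) (lin M q v).
Proof. by apply: deriv_linear => k; rewrite linD linZ. Qed.

Lemma deriv_coord k i t : is_derive t (delta_mx 0 k) (fun s : V => s 0 i) (k == i)%:R.
Proof.
apply: is_derive_eq (deriv_linear _) _; first by move=> h; rewrite !mxE.
by rewrite mxE eqxx eq_sym.
Qed.

Lemma pdE k f t a : is_derive t (delta_mx 0 k) f a -> pd k f t = a.
Proof. by case. Qed.

Lemma pd_coord k i t : pd k (fun s : V => s 0 i) t = (k == i)%:R.
Proof. exact: pdE (deriv_coord k i t). Qed.

Lemma pd_near k f g t : (\forall s \near t, f s = g s) -> pd k f t = pd k g t.
Proof. exact: near_eq_derive. Qed.

Lemma lin_delta (M : 'M[K]_n) q k : lin M q (delta_mx 0 k) = M q k.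
Proof.
rewrite /lin (bigD1 k) //= mxE !eqxx mulr1 big1 ?addr0 // => a /negPf ak.
by rewrite mxE ak andbF mulr0.
Qed.

Lemma differentiable_lin (M : 'M[K]_n) q t : differentiable (lin M q) t.
Proof.
have -> : lin M q = \sum_(a < n) (M q a *: (fun s : V => s 0 a)).
  by apply/funext => s; rewrite fct_sumE.
by apply: differentiable_sum => a; apply/differentiableZ/differentiable_coord.
Qed.

End PartialDerivatives.

Section Decoupled.
Context {K : numClosedFieldType} {n : nat}.
Notation V := 'rV[K]_n.
Variables (bt b : 'M[K]_n) (c : 'I_n -> K).
Hypothesis dual : bt *m b^T = 1%:M.
Hypothesis c_neq0 : forall q, c q != 0.

(** The symmetric matrix with diagonal entries [d] in the coordinates y. *)
Definition diag_mat (M : 'M[K]_n) (d : 'I_n -> K) : 'M[K]_n :=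
  \matrix_(i, j) diag_form M d i j.

Lemma diag_matE M d : diag_mat M d = M^T *m diag_mx (\row_q d q) *m M.
Proof.
apply/matrixP => i j; rewrite mul_mx_diag !mxE; apply: eq_bigr => q _.
by rewrite !mxE; ring.
Qed.

Lemma diag_mat_inv d : (forall q, d q != 0) ->
  diag_mat b d *m diag_mat bt (fun q => (d q)^-1) = 1%:M.
Proof.
move=> d0; rewrite !diag_matE; set D := diag_mx _; set D' := diag_mx _.
have -> : b^T *m D *m b *m (bt^T *m D' *m bt) = b^T *m (D *m ((b *m bt^T) *m D')) *m bt.
  by rewrite !mulmxA.
have -> : b *m bt^T = 1%:M by rewrite -[LHS]trmxK trmx_mul trmxK dual trmx1.
have -> : D *m (1%:M *m D') = 1%:M.
  rewrite mul1mx mulmx_diag; apply/matrixP => i j; rewrite !mxE.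
  by case: eqP => [->|]; rewrite ?mulr1n ?mulr0n // mulfV.
by rewrite mulmx1 (dualT dual).
Qed.

Lemma det_b_neq0 : \det b != 0.
Proof.
have := congr1 (@determinant _ _) dual; rewrite det_mulmx det_tr det1 => e.
by apply/eqP => z; move: e; rewrite z mulr0 => /eqP; rewrite eq_sym oner_eq0.
Qed.

Lemma det_diag_mat d : \det (diag_mat b d) = \det b ^+ 2 * \prod_q d q.
Proof.
rewrite diag_matE !det_mulmx det_tr det_diag (eq_bigr d) => [|q _]; last by rewrite mxE.
by ring.
Qed.

Lemma diag_mat_unit d : (diag_mat b d \in unitmx) = [forall q, d q != 0].
Proof.
rewrite unitmxE det_diag_mat unitfE mulf_eq0 expf_eq0 /= (negPf det_b_neq0) /=.
rewrite prodf_seq_neq0; apply/allP/forallP => h q.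
  exact: h q (mem_index_enum q).
by move=> _; exact: h.
Qed.

Lemma diag_mat_invmx d : (forall q, d q != 0) ->
  invmx (diag_mat b d) = diag_mat bt (fun q => (d q)^-1).
Proof.
move=> d0; have e := diag_mat_inv d0.
have u : diag_mat b d \in unitmx by rewrite diag_mat_unit; apply/forallP.
by rewrite -[LHS]mulmx1 -e mulKmx.
Qed.

End Decoupled.

(** * Curvature of the decoupled metrics *)

Lemma cvg_neq0 (K : numFieldType) T (F : set_system T) (FF : Filter F) (f : T -> K) y :
  f @ F --> y -> y != 0 -> \forall s \near F, f s != 0.
Proof. by move=> cc h; have := cvgr_neq0 _ cc; apply. Qed.

Section DecoupledMetric.
Context {K : numClosedFieldType} {n : nat}.
Notation V := 'rV[K]_n.
Variables (bt b : 'M[K]_n) (c : 'I_n -> K).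
Hypothesis dual : bt *m b^T = 1%:M.
Hypothesis c_neq0 : forall q, c q != 0.
Implicit Types (nu : K) (mu : 'I_n -> K) (t v : V).

Definition aff nu mu q t : K := nu * lin bt q t + mu q.

(** The contravariant metric with diagonal entries c_q (nu y_q + mu_q) in the coordinates y. *)
Definition dmetric nu mu t : 'M[K]_n := diag_mat b (fun q => c q * aff nu mu q t).

(** Coefficients of the tensors of type (1,2) that are diagonal in the dual frames. *)
Definition tri (A : 'I_n -> K) (j m k : 'I_n) : K :=
  \sum_q A q * (b q j * (bt q m * bt q k)).

Lemma deriv_aff nu mu q t v : is_derive t v (aff nu mu q) (nu * lin bt q v).
Proof.
rewrite -[nu * _]addr0.
exact: deriv_add (deriv_scale nu (deriv_lin bt q t v)) (deriv_cst (mu q) t v).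
Qed.

Lemma differentiable_aff nu mu q t : differentiable (aff nu mu q) t.
Proof.
have -> : aff nu mu q = nu *: lin bt q + cst (mu q) by [].
by apply: differentiableD; [apply/differentiableZ/differentiable_lin|].
Qed.

Lemma continuous_aff nu mu q : continuous (aff nu mu q).
Proof. by move=> t; exact: differentiable_continuous (differentiable_aff nu mu q t). Qed.

Lemma differentiable_diag_form (d : 'I_n -> V -> K) i j t :
  (forall q, differentiable (d q) t) ->
  differentiable (fun s => diag_form b (fun q => d q s) i j) t.
Proof.
move=> hd; have -> : (fun s => diag_form b (fun q => d q s) i j) =
    \sum_(q < n) ((b q i * b q j) *: (d q)).
  apply/funext => s; rewrite fct_sumE; apply: eq_bigr => q _.
  exact: mulrC.
by apply: differentiable_sum => q; exact: differentiableZ.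
Qed.

Lemma dmetric_holo U nu mu i j : holo U (fun t => dmetric nu mu t i j).
Proof.
move=> t _; rewrite (_ : (fun _ => _) = fun s => diag_form b (fun q => c q * aff nu mu q s) i j).
  apply: differentiable_diag_form => q.
  rewrite (_ : (fun _ => _) = c q *: aff nu mu q) //.
  by apply: differentiableZ; exact: differentiable_aff.
by apply/funext => s; rewrite mxE.
Qed.

Lemma dmetric_sym nu mu t : (dmetric nu mu t)^T = dmetric nu mu t.
Proof.
by apply/matrixP => i j; rewrite !mxE; apply: eq_bigr => q _; rewrite [b q j * _]mulrC.
Qed.

Lemma dmetric_unit nu mu t : (dmetric nu mu t \in unitmx) = [forall q, aff nu mu q t != 0].
Proof.
rewrite (diag_mat_unit dual); apply: eq_forallb => q.
by rewrite mulf_eq0 (negPf (c_neq0 q)).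
Qed.

Lemma near_unit nu mu t : (forall q, aff nu mu q t != 0) ->
  \forall s \near t, forall q, aff nu mu q s != 0.
Proof.
move=> h; apply: (@filter_forall V 'I_n (fun q s => aff nu mu q s != 0) (nbhs t)) => q.
have cc : aff nu mu q s @[s --> t] --> aff nu mu q t by exact: continuous_aff.
by apply: (cvg_neq0 _ cc); exact: h.
Qed.

(** Diagonal tensors are contracted entrywise, since the frames are dual. *)
Lemma tri_sum A B i k l j :
  \sum_m tri A i k m * tri B m l j =
  \sum_q A q * B q * (b q i * (bt q k * (bt q l * bt q j))).
Proof.
transitivity (\sum_q \sum_p (q == p)%:R *
    (A q * B p * (b q i * (bt q k * (bt p l * bt p j))))); last first.
  by apply: eq_bigr => q _; rewrite sum_delta.
transitivity (\sum_m \sum_q \sum_p (bt q m * b p m) *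
    (A q * B p * (b q i * (bt q k * (bt p l * bt p j))))).
  apply: eq_bigr => m _; rewrite /tri mulr_suml; apply: eq_bigr => q _.
  by rewrite mulr_sumr; apply: eq_bigr => p _; ring.
rewrite exchange_big; apply: eq_bigr => q _; rewrite exchange_big; apply: eq_bigr => p _.
by rewrite -mulr_suml sum_dual.
Qed.

Lemma form_tri (d A : 'I_n -> K) i j k :
  \sum_m diag_form b d i m * tri A j m k = \sum_q d q * A q * (b q i * (b q j * bt q k)).
Proof.
transitivity (\sum_q \sum_p (q == p)%:R * (A q * d p * (b p i * (b q j * bt q k)))); last first.
  by apply: eq_bigr => q _; rewrite sum_delta; ring.
transitivity (\sum_m \sum_q \sum_p (bt q m * b p m) * (A q * d p * (b p i * (b q j * bt q k)))).
  apply: eq_bigr => m _; rewrite /tri /diag_form mulrC mulr_suml; apply: eq_bigr => q _.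
  by rewrite mulr_sumr; apply: eq_bigr => p _; ring.
rewrite exchange_big; apply: eq_bigr => q _; rewrite exchange_big; apply: eq_bigr => p _.
by rewrite -mulr_suml sum_dual.
Qed.

Lemma pd_inverse_metric nu mu t i l m : (forall q, aff nu mu q t != 0) ->
  pd m (fun s => invmx (dmetric nu mu s) i l) t =
  \sum_q (- nu * (c q)^-1 * (aff nu mu q t) ^- 2) * (bt q m * (bt q i * bt q l)).
Proof.
move=> h; pose g (s : V) := \sum_q ((c q)^-1 * (bt q i * bt q l)) * (aff nu mu q s)^-1.
rewrite (@pd_near _ _ _ _ g).
  apply: pdE; apply: is_derive_eq (deriv_sum (index_enum 'I_n) (fun q =>
    deriv_scale _ (deriv_inv (h q) (deriv_aff nu mu q t (delta_mx 0 m))))) _.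
  by apply: eq_bigr => q _; rewrite lin_delta; ring.
near=> s; have hs : forall q, aff nu mu q s != 0 by near: s; exact: near_unit.
rewrite /dmetric (diag_mat_invmx dual) => [|q]; last by rewrite mulf_neq0.
by rewrite mxE; apply: eq_bigr => q _; rewrite invfM; ring.
Unshelve. all: by end_near. Qed.

(** The inverse metric has entries 1 / (c_q phi_q) with phi_q a function of y_q
    alone, so only the symbols with three equal indices survive, as in
    dimension one. *)
Lemma christoffel_dmetric nu mu t j m k : (forall q, aff nu mu q t != 0) ->
  christoffel (dmetric nu mu) j m k t = tri (fun q => - (nu / 2) * (aff nu mu q t)^-1) j m k.
Proof.
move=> h; rewrite /christoffel.
under eq_bigr => l _ do rewrite !pd_inverse_metric // mxE.
pose A q := - nu * (c q)^-1 * (aff nu mu q t) ^- 2.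
transitivity (2^-1 * \sum_l \sum_q \sum_p (bt q l * b p l) *
    ((c p * aff nu mu p t) * A q * (b p j * (bt q m * bt q k)))).
  congr (_ * _); apply: eq_bigr => l _; rewrite /diag_form mulr_suml exchange_big.
  apply: eq_bigr => p _; rewrite -sumrN -!big_split mulr_sumr; apply: eq_bigr => q _ /=.
  by rewrite -/(A q); ring.
rewrite exchange_big mulr_sumr; apply: eq_bigr => q _; rewrite exchange_big /=.
transitivity (2^-1 * \sum_p (q == p)%:R *
    ((c p * aff nu mu p t) * A q * (b p j * (bt q m * bt q k)))).
  by congr (_ * _); apply: eq_bigr => p _; rewrite -(sum_dual dual) mulr_suml.
rewrite sum_delta /A; have := h q; set x := aff _ _ _ _ => x0; have c0 := c_neq0 q.
by field; rewrite x0 c0.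
Qed.

(** Raising the index cancels the denominator phi_q.  The result does
    not depend on mu and is linear in nu, hence it adds up along the pencil. *)
Lemma contra_christoffel_dmetric nu mu t i j k : (forall q, aff nu mu q t != 0) ->
  contra_christoffel (dmetric nu mu) i j k t =
  nu * \sum_q c q / 2 * (b q i * (b q j * bt q k)).
Proof.
move=> h; rewrite /contra_christoffel.
under eq_bigr => m _ do rewrite (christoffel_dmetric _ _ _ h) mxE.
rewrite form_tri -sumrN mulr_sumr; apply: eq_bigr => q _.
have := h q; set x := aff _ _ _ _ => x0.
by field.
Qed.

(** Both the derivatives and the products of the Christoffel symbols are diagonal
    tensors, hence symmetric in the antisymmetrised pair of indices. *)
Lemma riemann_dmetric nu mu t i j k l : (forall q, aff nu mu q t != 0) ->
  riemann (dmetric nu mu) i j k l t = 0.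
Proof.
move=> h; have pdG k' l' : pd k' (christoffel (dmetric nu mu) i l' j) t =
    \sum_q nu / 2 * (aff nu mu q t) ^- 2 * nu * (b q i * (bt q k' * (bt q l' * bt q j))).
  pose g (s : V) := \sum_q (- (nu / 2) * (b q i * (bt q l' * bt q j))) * (aff nu mu q s)^-1.
  rewrite (@pd_near _ _ _ _ g).
    apply: pdE; apply: is_derive_eq (deriv_sum (index_enum 'I_n) (fun q =>
      deriv_scale _ (deriv_inv (h q) (deriv_aff nu mu q t (delta_mx 0 k'))))) _.
    by apply: eq_bigr => q _; rewrite lin_delta; ring.
  near=> s; have hs : forall q, aff nu mu q s != 0 by near: s; exact: near_unit.
  by rewrite christoffel_dmetric //; apply: eq_bigr => q _; ring.
rewrite /riemann !pdG.
pose A q := - (nu / 2) * (aff nu mu q t)^-1.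
rewrite [X in _ + X](_ : _ =
    \sum_m (tri A i k m * tri A m l j - tri A i l m * tri A m k j)); last first.
  by apply: eq_bigr => m _; rewrite !(christoffel_dmetric _ _ _ h).
rewrite big_split sumrN /= !tri_sum -!sumrN -!big_split big1 //= => q _.
by ring.
Unshelve. all: by end_near. Qed.

(** Along the line t + s v each of the finitely many functions is affine in s,
    and it does not vanish identically near s = 0. *)
Lemma generic_dense (I : finType) (U : set V) (r : I -> V -> K) (v : V) (a : I -> K) :
  open U -> (forall i, continuous (r i)) ->
  (forall i s t, r i (t + s *: v) = r i t + s * a i) ->
  (forall i t, r i t = 0 -> a i != 0) ->
  open_dense_in U [set t | U t /\ forall i, r i t != 0].
Proof.
move=> oU cr rE a0; split.
- apply: openI => //; rewrite openE => t h.
  apply: (@filter_forall V I (fun i s => r i s != 0) (nbhs t)) => i.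
  by apply: (cvg_neq0 _ (cr i t)); exact: h.
- by move=> t [].
move=> t Ut B tB.
have cl : (fun s : K => t + s *: v) @ 0^' --> t.
  rewrite -[X in _ --> X](addr0 t) -[X in _ --> t + X](scale0r v).
  apply: (cvgD (f := cst t) (g := fun s : K => s *: v)); first exact: cvg_cst.
  by apply: cvgZr_tmp; apply: cvg_within_filter; exact: cvg_id.
have Us : \forall s \near (0:K)^', U (t + s *: v) /\ B (t + s *: v).
  by apply: filterI; apply: cl => //; exact: open_nbhs_nbhs.
have ns : \forall s \near (0:K)^', forall i, r i (t + s *: v) != 0.
  apply: (@filter_forall K I (fun i s => r i (t + s *: v) != 0) (0:K)^') => i.
  have [z|nz] := eqVneq (r i t) 0.
    near=> s; rewrite rE z add0r mulf_neq0 ?(a0 i t z) //.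
    by near: s; exact: nbhs_dnbhs_neq.
  have cc : (fun s : K => r i (t + s *: v)) @ 0^' --> r i t.
    exact: (cvg_comp _ _ cl (cr i t)).
  by apply: (cvg_neq0 _ cc).
have [s [[h1 h2] h3]] := filter_ex (filterI Us ns).
by exists (t + s *: v).
Unshelve. all: by end_near. Qed.

End DecoupledMetric.

(** * The flat pencil and the Frobenius manifold *)

Section DecoupledPencil.
Context {K : numClosedFieldType} {n : nat}.
Notation V := 'rV[K]_n.
Variables (bt b : 'M[K]_n) (c m : 'I_n -> K).
Hypothesis dual : bt *m b^T = 1%:M.
Hypothesis c_neq0 : forall q, c q != 0.
Hypothesis m_neq0 : forall q, m q != 0.
Local Notation faff := (aff bt).
Local Notation dmetric := (dmetric bt b c).
Implicit Types (U : set V) (t : V).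

Lemma aff_shift nu mu q t s (v : V) :
  faff nu mu q (t + s *: v) = faff nu mu q t + s * (nu * lin bt q v).
Proof. by rewrite /aff linD linZ; ring. Qed.

Lemma form_lin (d : 'I_n -> K) i q : \sum_k diag_form b d i k * bt q k = d q * b q i.
Proof.
transitivity (\sum_p (q == p)%:R * (d p * b p i)); last by rewrite sum_delta.
under eq_bigr do rewrite mulr_suml.
rewrite exchange_big; apply: eq_bigr => p _; rewrite -(sum_dual dual) mulr_suml.
by apply: eq_bigr => k _; ring.
Qed.

(** For the dense set of nondegenerate points move in the direction in which
    every y_q grows at rate 1. *)
Lemma dmetric_flat U nu mu : open U -> (forall q, nu != 0 \/ mu q != 0) ->
  flat_metric U (dmetric nu mu).
Proof.
move=> oU h; split; last first.
  move=> t _; rewrite (dmetric_unit dual c_neq0) => /forallP a0 i j k l.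
  exact: riemann_dmetric.
split; [by move=> i j; exact: dmetric_holo|by move=> t _; exact: dmetric_sym|].
exists [set t | U t /\ forall q, faff nu mu q t != 0]; last first.
  by move=> t [_ /forallP]; rewrite (dmetric_unit dual c_neq0).
apply: (generic_dense (v := \row_i \sum_p 1 * b p i) (a := fun=> nu)) => //.
- by move=> q; exact: continuous_aff.
- by move=> q s t; rewrite aff_shift (lin_sum_dual dual) mulr1.
- move=> q t a0; case: (h q) => // mu0; apply/eqP => nu0.
  by move: a0 mu0; rewrite /aff nu0 mul0r add0r => ->; rewrite eqxx.
Qed.

Lemma pencil_dmetric l :
  pencil (dmetric 1 (fun=> 0)) (dmetric 0 m) l = dmetric 1 (fun q => l * m q).
Proof.
apply/funext => t; apply/matrixP => i j; rewrite !mxE mulr_sumr -big_split.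
by apply: eq_bigr => q _; rewrite /aff /=; ring.
Qed.

Lemma decoupled_flat_pencil U : open U -> flat_pencil U (dmetric 1 (fun=> 0)) (dmetric 0 m).
Proof.
move=> oU; split.
- by apply: dmetric_flat => // q; left; exact: oner_neq0.
- by apply: dmetric_flat => // q; right.
(* no value of l is exceptional: the pencil has the same form with mu = l m *)
exists [::] => l _; rewrite pencil_dmetric; split.
  by apply: dmetric_flat => // q; left; exact: oner_neq0.
move=> t _; rewrite !(dmetric_unit dual c_neq0) => /forallP h2 /forallP h1 /forallP h i j k.
by rewrite !(contra_christoffel_dmetric dual c_neq0) // mul1r mul0r mulr0 addr0.
Qed.

(** A potential whose gradient for the metric with entries c_q phi_q has the
    components phi_q. *)
Definition tau t : K := \sum_q (c q)^-1 * lin bt q t.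

Lemma pd_tau j t : pd j tau t = \sum_q (c q)^-1 * bt q j.
Proof.
apply: pdE; apply: is_derive_eq (deriv_sum (index_enum 'I_n) (fun q =>
  deriv_scale _ (deriv_lin bt q t (delta_mx 0 j)))) _.
by apply: eq_bigr => q _; rewrite lin_delta.
Qed.

Lemma differentiable_tau t : differentiable tau t.
Proof.
have -> : tau = \sum_(q < n) ((c q)^-1 *: lin bt q).
  by apply/funext => s; rewrite fct_sumE.
by apply: differentiable_sum => q; apply/differentiableZ/differentiable_lin.
Qed.

Lemma grad_tau nu mu t :
  grad_vector (dmetric nu mu) tau t = \row_i \sum_q faff nu mu q t * b q i.
Proof.
apply/rowP => i; rewrite !mxE; under eq_bigr do rewrite pd_tau mulr_sumr.
rewrite exchange_big; apply: eq_bigr => q _ /=.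
under eq_bigr => j _ do rewrite mxE mulrCA.
by rewrite -mulr_sumr form_lin -mulrA mulKf.
Qed.

(** Here phi_q = y_q, so the gradient is the Euler field. *)
Lemma grad_tau_euler : grad_vector (dmetric 1 (fun=> 0)) tau = id.
Proof.
apply/funext => t; rewrite grad_tau; apply/rowP => i; rewrite mxE -[RHS](sum_lin_dual dual).
by apply: eq_bigr => q _; rewrite /aff; ring.
Qed.

Lemma grad_tau_unit : grad_vector (dmetric 0 m) tau = fun=> \row_i \sum_q m q * b q i.
Proof.
apply/funext => t; rewrite grad_tau; apply/rowP => i; rewrite !mxE.
by apply: eq_bigr => q _; rewrite /aff; ring.
Qed.

Lemma pd_dmetric nu mu k i j t :
  pd k (fun s => dmetric nu mu s i j) t = diag_form b (fun q => c q * (nu * bt q k)) i j.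
Proof.
rewrite (_ : (fun s => _) = fun s => \sum_q (b q i * b q j * c q) * faff nu mu q s).
  apply: pdE; apply: is_derive_eq (deriv_sum (index_enum 'I_n) (fun q =>
    deriv_scale _ (deriv_aff bt nu mu q t (delta_mx 0 k)))) _.
  by apply: eq_bigr => q _; rewrite lin_delta; ring.
by apply/funext => s; rewrite mxE; apply: eq_bigr => q _; ring.
Qed.

Lemma pd_cst k (a : K) t : pd k (fun=> a) t = 0.
Proof. exact: pdE (deriv_cst a t _). Qed.

Lemma lie_const_dmetric (w : V) nu mu t :
  lie_bivector (fun=> w) (dmetric nu mu) t = dmetric 0 (fun q => nu * lin bt q w) t.
Proof.
apply/matrixP => i j; rewrite !mxE.
under eq_bigr => k _ do rewrite !pd_cst !mulr0 !subr0 pd_dmetric mulr_sumr.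
rewrite exchange_big; apply: eq_bigr => q _ /=.
rewrite /aff mul0r add0r /lin !mulr_sumr mulr_suml.
by apply: eq_bigr => k _; ring.
Qed.

Lemma lie_euler_dmetric t :
  lie_bivector id (dmetric 1 (fun=> 0)) t = - dmetric 1 (fun=> 0) t.
Proof.
apply/matrixP => i j; rewrite !mxE.
under eq_bigr => k _ do rewrite !pd_coord pd_dmetric [k == i]eq_sym [k == j]eq_sym
  ![_ * (_ == _)%:R]mulrC !mxE.
rewrite !big_split !sumrN /= !sum_delta.
rewrite (_ : \sum_k _ = diag_form b (fun q => c q * faff 1 (fun=> 0) q t) i j).
  by rewrite subrr add0r.
under eq_bigr do rewrite mulr_sumr.
rewrite exchange_big; apply: eq_bigr => q _ /=.
rewrite /aff mul1r addr0 /lin mulr_sumr mulr_suml.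
by apply: eq_bigr => k _; ring.
Qed.

(** The Christoffel symbols of the second metric vanish, since its entries are
    constant in t; so the regularity tensor is -1/2 + 1. *)
Lemma regular_qh_decoupled U : open U ->
  regular_qh_flat_pencil U (dmetric 1 (fun=> 0)) (dmetric 0 m) 0.
Proof.
move=> oU; split; first exact: decoupled_flat_pencil.
exists tau; split.
  split; first by move=> t _; exact: differentiable_tau.
  move=> t _; rewrite grad_tau_euler grad_tau_unit; split.
  - apply/rowP => i; rewrite !mxE.
    under eq_bigr => k _ do rewrite pd_coord pd_cst mulr0 subr0 mulrC eq_sym.
    by rewrite sum_delta mxE.
  - by rewrite lie_euler_dmetric sub0r scaleN1r.
  - rewrite lie_const_dmetric; congr (dmetric 0 _ t).
    by apply/funext => q; rewrite mul1r (lin_sum_dual dual).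
  - rewrite lie_const_dmetric; apply/matrixP => i j; rewrite !mxE /diag_form big1 // => q _.
    by rewrite /aff !mul0r addr0 mulr0 mul0r.
move=> t Ut; rewrite (dmetric_unit dual c_neq0) => /forallP h.
rewrite /regular_tensor grad_tau_euler.
rewrite (_ : _ + _ = (2^-1)%:M).
  by rewrite unitmxE det_scalar unitfE expf_neq0 // invr_neq0 // pnatr_eq0.
apply/matrixP => i j; rewrite !mxE pd_coord big1 => [|k _]; last first.
  rewrite (christoffel_dmetric dual c_neq0 _ _ _ h) /tri big1 ?mul0r // => q _.
  by rewrite ?mul0r oppr0 !mul0r.
have n2 := two_neq0 K.
by rewrite addr0 sub0r mulNr mul1r; case: (i == j); rewrite ?mulr1n ?mulr0n; field.
Qed.


Lemma deriv_pow (f : V -> K) (t v : V) (a : K) (p : nat) : is_derive t v f a ->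
  is_derive t v (fun s : V => f s ^+ p) (p%:R * f t ^+ p.-1 * a : K).
Proof.
move=> df; elim: p => [|p IH].
  by apply: is_derive_eq (deriv_cst 1 t v) _; rewrite !mul0r.
have -> : (fun s => f s ^+ p.+1) = fun s => f s * f s ^+ p.
  by apply/funext => s; rewrite exprS.
apply: is_derive_eq (deriv_mul df IH) _ => /=.
by case: p IH => [|p] _ /=; rewrite ?expr0 -?natr1 ?exprS; ring.
Qed.

Definition powsum (a : 'I_n -> K) p t : K := \sum_q a q * lin bt q t ^+ p.

Lemma pd_powsum a p k :
  pd k (powsum a p) = powsum (fun q => a q * p%:R * bt q k) p.-1.
Proof.
apply/funext => t; apply: pdE; apply: is_derive_eq (deriv_sum (index_enum 'I_n) (fun q =>
  deriv_scale _ (deriv_pow p (deriv_lin bt q t (delta_mx 0 k))))) _.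
by apply: eq_bigr => q _; rewrite lin_delta; ring.
Qed.

(** Its third derivative along m is the inverse of the metric with entries
    c_q m_q. *)
Definition cubic_potential : V -> K := powsum (fun q => (6 * (c q * m q ^+ 2))^-1) 3.

Lemma pd3_cubic i j k t :
  pd3 cubic_potential i j k t = \sum_q (c q * m q ^+ 2)^-1 * (bt q i * (bt q j * bt q k)).
Proof.
rewrite /pd3 /cubic_potential !pd_powsum; apply: eq_bigr => q _.
have c0 := c_neq0 q; have m0 := m_neq0 q.
have n6 : 6 != 0 :> K by rewrite pnatr_eq0.
by rewrite /= expr0; field; rewrite c0 m0.
Qed.

Lemma differentiable_powsum a p t : differentiable (powsum a p) t.
Proof.
have dexp q r : differentiable (fun s : V => lin bt q s ^+ r) t.
  elim: r => [|r IH]; first exact: (differentiable_cst (1 : K) t).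
  have -> : (fun s => lin bt q s ^+ r.+1) = lin bt q \* (fun s => lin bt q s ^+ r).
    by apply/funext => s; rewrite exprS.
  exact: differentiableM (differentiable_lin bt q t) IH.
have -> : powsum a p = \sum_(q < n) (a q *: (fun s : V => lin bt q s ^+ p)).
  by apply/funext => s; rewrite fct_sumE.
by apply: differentiable_sum => q; exact: differentiableZ.
Qed.

Local Notation eta := (diag_mat b (fun q => c q * m q)).

Lemma frob_mul_cubic i j k t :
  frob_mul cubic_potential eta i j k t = tri bt b (fun q => (m q)^-1) k i j.
Proof.
rewrite /frob_mul; under eq_bigr do rewrite pd3_cubic mulr_sumr.
rewrite exchange_big; apply: eq_bigr => q _ /=.
under eq_bigr => p _ do rewrite mxE mulrCA mulrA.
rewrite -[LHS](_ : (c q * m q ^+ 2)^-1 * (bt q i * bt q j) *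
  \sum_p diag_form b (fun q => c q * m q) k p * bt q p = _); last first.
  by rewrite mulr_sumr; apply: eq_bigr => p _; ring.
rewrite form_lin; have c0 := c_neq0 q; have m0 := m_neq0 q.
by field; rewrite c0 m0.
Qed.

Lemma euler_cubic t : euler_action id cubic_potential t = 3 * cubic_potential t.
Proof.
rewrite /euler_action /cubic_potential.
under eq_bigr do rewrite pd_powsum mulr_sumr.
rewrite exchange_big mulr_sumr; apply: eq_bigr => q _ /=.
rewrite -[LHS](_ : (6 * (c q * m q ^+ 2))^-1 * 3 * lin bt q t ^+ 2 *
  \sum_i bt q i * t 0 i = _); last by rewrite mulr_sumr; apply: eq_bigr => i _; ring.
by rewrite -/(lin bt q t); ring.
Qed.

Lemma intersection_cubic t :
  intersection_form cubic_potential eta id t = dmetric 1 (fun=> 0) t.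
Proof.
apply/matrixP => i j; rewrite !mxE.
transitivity (\sum_q (c q * m q ^+ 2)^-1 * ((\sum_p bt q p * t 0 p) *
  ((\sum_k diag_form b (fun q => c q * m q) i k * bt q k) *
   (\sum_k diag_form b (fun q => c q * m q) j k * bt q k)))).
  under eq_bigr => p _ do under eq_bigr => k _ do under eq_bigr => l _ do
    rewrite pd3_cubic mulr_sumr.
  under eq_bigr => p _ do under eq_bigr => k _ do rewrite exchange_big.
  under eq_bigr => p _ do rewrite exchange_big.
  rewrite exchange_big; apply: eq_bigr => q _ /=.
  rewrite mulr_suml mulr_sumr; apply: eq_bigr => p _.
  rewrite mulr_suml !mulr_sumr; apply: eq_bigr => k _.
  rewrite !mulr_sumr; apply: eq_bigr => l _.
  by rewrite !mxE; ring.
apply: eq_bigr => q _; rewrite !form_lin -/(lin bt q t) /aff.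
have c0 := c_neq0 q; have m0 := m_neq0 q.
by field; rewrite c0 m0.
Qed.

Lemma trivial_decoupled U k : trivial_frobenius U cubic_potential k eta.
Proof.
have E s : frob_metric cubic_potential k s =
    \matrix_(i, j) \sum_q (c q * m q ^+ 2)^-1 * (bt q k * (bt q i * bt q j)).
  by apply/matrixP => i j; rewrite !mxE pd3_cubic.
move=> t t' _ _; split; first exact: etrans (E t) (esym (E t')).
move=> i j l; exact: etrans (frob_mul_cubic i j l t) (esym (frob_mul_cubic i j l t')).
Qed.

(** The algebra is the product of n lines with idempotents proportional to the
    frame vectors, whence associativity; the unit has the components m_q, so it
    is d/dt_k exactly when these are the coordinates of d/dt_k. *)
Lemma frobenius_decoupled U k : (forall q, m q = bt q k) ->
  frobenius_manifold U cubic_potential k eta id 0.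
Proof.
move=> mk; split.
- by move=> t _; exact: differentiable_powsum.
- split; first by rewrite (diag_mat_unit dual); apply/forallP => q; rewrite mulf_neq0.
  move=> t _; rewrite (diag_mat_invmx dual) => [|q]; last by rewrite mulf_neq0.
  apply/matrixP => i j; rewrite !mxE pd3_cubic; apply: eq_bigr => q _.
  rewrite -mk; have c0 := c_neq0 q; have m0 := m_neq0 q.
  by field; rewrite c0 m0.
- move=> t _ i j l p.
  transitivity (\sum_s tri bt b (fun q => (m q)^-1) p l s * tri bt b (fun q => (m q)^-1) s i j).
    apply: eq_bigr => s _; rewrite !frob_mul_cubic mulrC; congr (_ * _).
    by apply: eq_bigr => q _; ring.
  transitivity (\sum_s tri bt b (fun q => (m q)^-1) p i s * tri bt b (fun q => (m q)^-1) s j l).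
    by rewrite !(tri_sum dual); apply: eq_bigr => q _; ring.
  by apply: eq_bigr => s _; rewrite !frob_mul_cubic mulrC.
(* E is linear, and E F = 3 F holds without a quadratic remainder *)
- by exists 1%:M, 0 => t _; rewrite mulmx1 addr0.
- exists 0, 0, 0 => t _; rewrite mulmx0 mul0mx trmx0 mulmx0 !mxE !addr0 subr0.
  exact: euler_cubic.
Qed.

End DecoupledPencil.

(** * Exactness and central invariants *)

Section VirasoroPencil.
Context {K : numClosedFieldType} {n : nat}.
Notation V := 'rV[K]_n.
Variables (bt b : 'M[K]_n) (c : 'I_n -> K).
Local Notation P := (vir bt b c).
Local Notation dmetric := (dmetric bt b c).
Implicit Types (t : V) (kap mu : 'I_n -> K) (nu l : K).

Lemma lead_vir0 kap nu mu t : lead (P kap nu mu) 0 t = 0.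
Proof. by apply/matrixP => i j; rewrite !mxE. Qed.

Lemma lead_vir1 kap nu mu : lead (P kap nu mu) 1 = dmetric nu mu.
Proof. by apply/funext => t; apply/matrixP => i j; rewrite !mxE. Qed.

Lemma lead_vir2 kap nu mu t : lead (P kap nu mu) 2 t = 0.
Proof. by apply/matrixP => i j; rewrite !mxE. Qed.

Lemma lead_vir3 kap nu mu t : lead (P kap nu mu) 3 t = diag_mat b kap.
Proof. by apply/matrixP => i j; rewrite !mxE. Qed.

Lemma derive1_affine (A B : K) (f : K -> K) : (forall s, f s = A + s * B) -> derive1 f 0 = B.
Proof.
move=> e; have -> : f = fun s => A + B * s by apply/funext => s; rewrite e mulrC.
rewrite derive1E; have [_ ->] := deriv_add (deriv_cst A (0 : K) (1 : K))
  (deriv_scale B (is_derive_id (0 : K) (1 : K))).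
by rewrite add0r mulr1.
Qed.

Lemma diag_form_affine (d d0 d1 : 'I_n -> K) i j s : (forall q, d q = d0 q + s * d1 q) ->
  diag_form b d i j = diag_form b d0 i j + s * diag_form b d1 i j.
Proof.
move=> e; rewrite /diag_form mulr_sumr -big_split; apply: eq_bigr => q _.
by rewrite e /=; ring.
Qed.

Lemma diag_form0 i j : diag_form b (fun=> 0) i j = 0.
Proof. by rewrite /diag_form big1 // => q _; rewrite mul0r. Qed.

(** Only phi_q depends on t, at the rate nu (bt q k) along d/dt_k; the third-order
    term and the term with t_x disappear. *)
Lemma lie_vir k kap nu mu :
  lb_lie k (P kap nu mu) = P (fun=> 0) 0 (fun q => nu * bt q k).
Proof.
rewrite /lb_lie /vir /=; congr BracketExpr.
apply/funext => d; apply/funext => j; apply/funext => a; apply/funext => a'.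
apply/funext => u; rewrite /pdjet.
have cst (A : K) : derive1 (fun _ : K => A) 0 = 0.
  by apply: (@derive1_affine A 0) => s; rewrite mulr0 addr0.
case: d j => [|[|[|[|d]]]] [|[|[|[|j]]]] //=.
- rewrite cst /diag_form big1 // => q _; by rewrite !mul0r !mulr0 mul0r.
- apply: (@derive1_affine (diag_form b (fun q => c q * (nu * lin bt q (u 0%N) + mu q)) a a')).
  move=> s; apply: diag_form_affine => q.
  by rewrite linD linZ lin_delta mul0r add0r; ring.
- by rewrite cst diag_form0.
Qed.

Lemma comb_vir l l' kap nu mu kap' nu' mu' :
  lb_comb l (P kap nu mu) l' (P kap' nu' mu') =
  P (fun q => l * kap q + l' * kap' q) (l * nu + l' * nu') (fun q => l * mu q + l' * mu' q).
Proof.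
rewrite /lb_comb /vir /=; congr BracketExpr.
apply/funext => d; apply/funext => j; apply/funext => a; apply/funext => a'.
apply/funext => u.
have comb (d0 d1 d2 : 'I_n -> K) : (forall q, l * d0 q + l' * d1 q = d2 q) ->
    l * diag_form b d0 a a' + l' * diag_form b d1 a a' = diag_form b d2 a a'.
  move=> e; rewrite /diag_form !mulr_sumr -big_split; apply: eq_bigr => q _ /=.
  by rewrite -e; ring.
case: d j => [|[|[|[|d]]]] [|[|[|[|j]]]] //=; rewrite ?mulr0 ?addr0 //;
  by apply: comb => q; ring.
Qed.

Lemma lb_eq0_vir U : lb_eq0 U (P (fun=> 0) 0 (fun=> 0)).
Proof.
move=> d j a a' u _; case: d j => [|[|[|[|d]]]] [|[|[|[|j]]]] //=;
  by rewrite /diag_form big1 // => q _; ring.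
Qed.

Lemma vir_degree2 U kap nu mu : degree_vanishes U (P kap nu mu) 2.
Proof. by case=> [|[|[|j]]]. Qed.

Hypothesis dual : bt *m b^T = 1%:M.
Hypothesis c_neq0 : forall q, c q != 0.
Variables (m kap : 'I_n -> K).
Hypothesis m_neq0 : forall q, m q != 0.

Local Notation P2 := (P kap 1 (fun=> 0)).
Local Notation P1 := (P (fun=> 0) 0 m).

(** The root of y_q - l m_q in l. *)
Definition root_vir q t : K := lin bt q t / m q.

Lemma pencil_lead l t :
  lead P2 1 t - l *: lead P1 1 t = dmetric 1 (fun q => - l * m q) t.
Proof. by rewrite !lead_vir1 -scaleNr -pencil_dmetric. Qed.

Lemma Psi_vir l t :
  Psi P2 P1 l t = \det b ^+ 2 * (\prod_q c q * \prod_q aff bt 1 (fun q => - l * m q) q t).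
Proof. by rewrite /Psi pencil_lead det_diag_mat big_split. Qed.

(** Psi is a nonzero constant times the product of the y_q - l m_q. *)
Lemma Psi_root l t : Psi P2 P1 l t = 0 <-> exists q, l = root_vir q t.
Proof.
have c0 : \prod_q c q != 0 by apply/prodf_neq0 => q _.
rewrite Psi_vir; split=> [/eqP|[q ->]].
  rewrite mulf_eq0 expf_eq0 /= (negPf (det_b_neq0 dual)) /= mulf_eq0 (negPf c0) /=.
  move=> /prodf_eq0[q _ /eqP z]; exists q; have m0 := m_neq0 q.
  apply: (mulIf m0); rewrite /root_vir divfK //; apply/eqP; rewrite eq_sym -subr_eq0.
  by rewrite -z /aff; apply/eqP; ring.
rewrite [X in _ * (_ * X)](bigD1 q) //= [X in _ * (_ * (X * _))](_ : _ = 0) ?mul0r ?mulr0 //.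
by rewrite /aff /root_vir; have m0 := m_neq0 q; field.
Qed.

(** The product of the factors of Psi that do not vanish at l = [root_vir p t].
    Both the derivative of Psi in l and the differential of Psi in t are
    multiples of it. *)
Definition cofactor_vir p t : K :=
  \det b ^+ 2 * (\prod_q c q *
    \prod_(q | q != p) aff bt 1 (fun q => - root_vir p t * m q) q t).

Lemma aff_root p t : aff bt 1 (fun q => - root_vir p t * m q) p t = 0.
Proof. by rewrite /aff /root_vir; have m0 := m_neq0 p; field. Qed.

Lemma cofactor_neq0 p t : injective (root_vir^~ t) -> cofactor_vir p t != 0.
Proof.
move=> ir; rewrite /cofactor_vir !mulf_neq0 ?expf_neq0 ?(det_b_neq0 dual) //.
  by apply/prodf_neq0 => q _.
apply/prodf_neq0 => q qp; have m0 := m_neq0 q.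
have -> : aff bt 1 (fun q => - root_vir p t * m q) q t =
    m q * (root_vir q t - root_vir p t).
  by rewrite /aff {2}/root_vir; field.
by rewrite mulf_neq0 // subr_eq0; apply/eqP => /ir e; rewrite e eqxx in qp.
Qed.

Lemma pd_Psi p t i : pd i (Psi P2 P1 (root_vir p t)) t = bt p i * cofactor_vir p t.
Proof.
set l := root_vir p t.
have -> : Psi P2 P1 l = fun s => \det b ^+ 2 * (\prod_q c q *
    \prod_q aff bt 1 (fun q => - l * m q) q s).
  by apply/funext => s; exact: Psi_vir.
apply: pdE; apply: is_derive_eq (deriv_scale _ (deriv_scale _
  (deriv_prod_root (fun q => deriv_aff bt 1 (fun q => - l * m q) q t (delta_mx 0 i))
    (aff_root p t)))) _.
by rewrite lin_delta /cofactor_vir -/l; ring.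
Qed.

Lemma derive1_Psi p t :
  derive1 (fun l : K => Psi P2 P1 l t) (root_vir p t) = - m p * cofactor_vir p t.
Proof.
have -> : (fun l => Psi P2 P1 l t) = fun l => \det b ^+ 2 * (\prod_q c q *
    \prod_q (lin bt q t + (- m q) * l)).
  apply/funext => l; rewrite Psi_vir; do 2 congr (_ * _).
  by apply: eq_bigr => q _; rewrite /aff; ring.
have d q (l : K) : is_derive l 1 (fun l => lin bt q t + (- m q) * l) (- m q).
  apply: is_derive_eq (deriv_add (deriv_cst (lin bt q t) l (1 : K))
    (deriv_scale (- m q) (is_derive_id l (1 : K)))) _.
  by rewrite add0r mulr1.
have z : lin bt p t + (- m p) * root_vir p t = 0.
  by rewrite /root_vir; have m0 := m_neq0 p; field.
rewrite derive1E; have [_ ->] := deriv_scale (\det b ^+ 2) (deriv_scale (\prod_q c q)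
  (deriv_prod_root (fun q => d q (root_vir p t)) z)).
have -> : \prod_(q | q != p) (lin bt q t + - m q * root_vir p t) =
    \prod_(q | q != p) aff bt 1 (fun q => - root_vir p t * m q) q t.
  by apply: eq_bigr => q _; rewrite /aff; ring.
by rewrite /cofactor_vir; ring.
Qed.

Lemma dPsi_form_vir p t d :
  dPsi_form P2 P1 (root_vir p t) t (diag_mat b d) = cofactor_vir p t ^+ 2 * d p.
Proof.
rewrite /dPsi_form.
under eq_bigr => i _ do under eq_bigr => j _ do rewrite !pd_Psi mxE.
set w := cofactor_vir p t.
transitivity (w ^+ 2 * \sum_i bt p i * (\sum_j diag_form b d i j * bt p j)).
  rewrite mulr_sumr; apply: eq_bigr => i _; rewrite !mulr_sumr.
  by apply: eq_bigr => j _; ring.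
congr (_ * _); under eq_bigr => i _ do rewrite (form_lin dual) mulrCA.
by rewrite -mulr_sumr (sum_dual dual) eqxx mulr1.
Qed.

(** The numerator of [cinv] and its denominator are both proportional
    to the fourth power of the cofactor. *)
Lemma cinv_vir p t : injective (root_vir^~ t) ->
  cinv P2 P1 (root_vir p t) t = kap p / (3 * c p ^+ 2).
Proof.
move=> ir; rewrite /cinv derive1_Psi lead_vir1 dPsi_form_vir.
have -> : lead P2 3 t - root_vir p t *: lead P1 3 t = diag_mat b kap.
  apply/matrixP => i j; rewrite !lead_vir3 !mxE diag_form0 mulr0 subr0 //.
rewrite dPsi_form_vir /aff.
have w0 := cofactor_neq0 p ir; have c0 := c_neq0 p; have m0 := m_neq0 p.
have n3 : 3 != 0 :> K by rewrite pnatr_eq0.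
move: (cofactor_vir p t) w0 => w w0.
by field; rewrite w0 c0 m0.
Qed.

Lemma differentiable_root q t : differentiable (root_vir q) t.
Proof.
have -> : root_vir q = (m q)^-1 *: lin bt q.
  by apply/funext => s; rewrite /root_vir mulrC.
by apply: differentiableZ; exact: differentiable_lin.
Qed.

(** In the direction in which the q-th root grows at the rate q, the difference of
    two roots is a nonconstant affine function. *)
Lemma roots_dense U : open U -> open_dense_in U [set t | U t /\ injective (root_vir^~ t)].
Proof.
move=> oU; pose I : finType := ('I_n * 'I_n)%type.
(* the pairs on the diagonal get the nonvanishing function 1 *)
pose r (pq : I) t := if pq.1 == pq.2 then 1 else root_vir pq.1 t - root_vir pq.2 t.
pose a (pq : I) : K := if pq.1 == pq.2 then 0 else pq.1%:R - pq.2%:R.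
have rs q s t v : root_vir q (t + s *: v) = root_vir q t + s * (lin bt q v / m q).
  by rewrite /root_vir linD linZ mulrDl mulrA.
have -> : [set t | U t /\ injective (root_vir^~ t)] = [set t | U t /\ forall pq, r pq t != 0].
  apply/seteqP; split=> t [Ut h]; split=> //.
    move=> [p q]; rewrite /r /=; case: (eqVneq p q) => [_|pq]; first exact: oner_neq0.
    by rewrite subr_eq0; apply/eqP => /h e; rewrite e eqxx in pq.
  move=> p q e; apply/eqP; move: (h (p, q)); rewrite /r /=.
  by case: (p == q) => //; rewrite e subrr eqxx.
apply: (generic_dense (v := \row_i \sum_p (m p * p%:R) * b p i) (a := a)) => //.
- move=> [p q]; rewrite /r /=; case: (p == q); first exact: cst_continuous.
  move=> t; exact: differentiable_continuous
    (differentiableB (differentiable_root p t) (differentiable_root q t)).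
- move=> [p q] s t; rewrite /r /a /=; case: (p == q); first by rewrite mulr0 addr0.
  rewrite !rs !(lin_sum_dual dual); have m0 := m_neq0 p; have m0' := m_neq0 q.
  by field; rewrite m0 m0'.
- move=> [p q] t; rewrite /r /a /=; case: (eqVneq p q) => [_ /eqP|pq _]; first by rewrite oner_eq0.
  by rewrite subr_eq0 eqr_nat.
Qed.

Lemma central_invariants_vir U : open U ->
  central_invariants U P2 P1 root_vir (fun q _ => kap q / (3 * c q ^+ 2)).
Proof.
move=> oU; split.
- by split; exact: vir_degree2.
- by move=> q t _; exact: differentiable_root.
- by move=> t _ l; exact: Psi_root.
- exact: roots_dense.
- move=> t _ ir q; split; last by rewrite cinv_vir.
  rewrite lead_vir1 dPsi_form_vir mulf_neq0 ?expf_neq0 ?cofactor_neq0 //.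
  by rewrite /aff mul0r add0r mulf_neq0.
Qed.

(** The roots of Psi and the formula [cinv] do not refer to an enumeration, so
    equal invariants for one choice of roots would force kappa_q / (3 c_q^2) to be
    equal for all q. *)
Lemma not_topological_vir U p q : open U -> U !=set0 ->
  kap p / (3 * c p ^+ 2) != kap q / (3 * c q ^+ 2) -> ~ topological_type U P2 P1.
Proof.
move=> oU [t Ut] ne [r [c0 [_ _ roots [oV VU UV] vals]]].
have [oW WU UW] := roots_dense oU.
(* a point at which both enumerations of the roots are injective *)
have [t1 [Wt1 _]] := UW t Ut setT filterT.
have [t2 [Vt2 Wt2]] := UV t1 (WU t1 Wt1) _ (open_nbhs_nbhs (conj oW Wt1)).
have [Ut2 ir'] := Vt2; have [_ ir] := Wt2.
have E i : c0 = kap i / (3 * c i ^+ 2).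
  have z : Psi P2 P1 (root_vir i t2) t2 = 0 by apply/Psi_root; exists i.
  have [j e] := (roots t2 Ut2 _).1 z.
  by have [_ ->] := vals t2 Ut2 ir' j; rewrite -e cinv_vir.
by move/eqP: ne; apply; rewrite -!E.
Qed.

End VirasoroPencil.

Section VirasoroExact.
Context {R : realType} {n : nat}.
Notation C := R[i].
Variables (bt b : 'M[C]_n) (c kap : 'I_n -> C).
Hypothesis dual : bt *m b^T = 1%:M.

(** Both brackets and all their combinations belong to the family [vir]. *)
Lemma exact_pencil_vir U k :
  exact_poisson_pencil U k (vir bt b c kap 1 (fun=> 0))
    (lb_lie k (vir bt b c kap 1 (fun=> 0))).
Proof.
rewrite lie_vir; split.
- exact: poisson_vir.
- exact: poisson_vir.
- by move=> l l'; rewrite comb_vir; exact: poisson_vir.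
- by rewrite lie_vir.
- rewrite lie_vir (_ : (fun q => 0 * bt q k) = fun=> 0); first exact: lb_eq0_vir.
  by apply/funext => q; rewrite mul0r.
Qed.

End VirasoroExact.

(** * Block structure of the slice over N *)

Local Notation form := Defs.form.
Local Notation o4 k := (@Ordinal 4 k isT).
Local Notation o7 k := (@Ordinal 7 k isT).

Section Blocks.
Context {K : numClosedFieldType}.
Implicit Types (A B M : 'M[K]_4).

Lemma sum4 (F : 'I_4 -> K) : \sum_k F k = F (o4 0) + F (o4 1) + F (o4 2) + F (o4 3).
Proof.
rewrite !big_ord_recl big_ord0 addr0 !addrA.
by do ?[congr (_ + _)]; congr F; exact: val_inj.
Qed.

Lemma sum3 (F : 'I_3 -> K) : \sum_k F k = F 0 + F 1 + F 2.
Proof.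
rewrite !big_ord_recl big_ord0 addr0 !addrA.
by do ?[congr (_ + _)]; congr F; exact: val_inj.
Qed.

Lemma forall4 (Q : 'I_4 -> Prop) : Q (o4 0) -> Q (o4 1) -> Q (o4 2) -> Q (o4 3) -> forall i, Q i.
Proof.
move=> h0 h1 h2 h3 [[|[|[|[|//]]]] hi];
  by rewrite (eq_irrelevance hi isT).
Qed.

Lemma trace_L1f : \tr (L1 *m fmx : 'M[K]_4) = 2.
Proof. by rewrite /mxtrace !sum4 !mxE !sum4 !mxE /=; ring. Qed.

Lemma trace_formE A B : form A B = (\sum_i \sum_k A i k * B k i) / 2.
Proof.
rewrite /form trace_L1f; congr (_ / _).
by apply: eq_bigr => i _; rewrite mxE.
Qed.

Lemma fmxE : fmx = delta_mx (o4 1) (o4 0) + delta_mx (o4 3) (o4 2) :> 'M[K]_4.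
Proof. by congr (delta_mx _ _ + delta_mx _ _); exact: val_inj. Qed.

(** The centraliser of f in sl_4: block by block lower triangular with equal diagonal entries. *)
Lemma in_gfP M : in_gf M <->
  [/\ M (o4 0) (o4 1) = 0, M (o4 0) (o4 3) = 0, M (o4 2) (o4 1) = 0 & M (o4 2) (o4 3) = 0] /\
  [/\ M (o4 0) (o4 0) = M (o4 1) (o4 1), M (o4 0) (o4 2) = M (o4 1) (o4 3),
      M (o4 2) (o4 0) = M (o4 3) (o4 1), M (o4 2) (o4 2) = M (o4 3) (o4 3) &
      M (o4 2) (o4 2) = - M (o4 0) (o4 0)].
Proof.
have n2 := two_neq0 K.
have bE i j : brk fmx M i j = (i == o4 1)%:R * M (o4 0) j + (i == o4 3)%:R * M (o4 2) j
    - (M i (o4 1) * (j == o4 0)%:R + M i (o4 3) * (j == o4 2)%:R).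
  rewrite /brk fmxE !mxE !sum4 !mxE /= ?andbT ?andbF /=.
  ring.
have trE : \tr M = M (o4 0) (o4 0) + M (o4 1) (o4 1) + M (o4 2) (o4 2) + M (o4 3) (o4 3).
  by rewrite /mxtrace sum4.
split.
  move=> [tr0 /matrixP b0]; have e i j : brk fmx M i j = 0 by rewrite b0 mxE.
  move: tr0; rewrite /in_sl4 trE => tr0.
  have := e (o4 0) (o4 0); have := e (o4 0) (o4 2); have := e (o4 2) (o4 0).
  have := e (o4 2) (o4 2); have := e (o4 1) (o4 0); have := e (o4 1) (o4 2).
  have := e (o4 3) (o4 0); have := e (o4 3) (o4 2).
  rewrite !bE /= !mul0r !mul1r !mulr0 !mulr1 ?add0r ?addr0 ?sub0r.
  move=> /eqP; rewrite subr_eq0 => /eqP e32 /eqP; rewrite subr_eq0 => /eqP e30.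
  move=> /eqP; rewrite subr_eq0 => /eqP e12 /eqP; rewrite subr_eq0 => /eqP e10.
  move=> /eqP; rewrite oppr_eq0 => /eqP e23 /eqP; rewrite oppr_eq0 => /eqP e21.
  move=> /eqP; rewrite oppr_eq0 => /eqP e03 /eqP; rewrite oppr_eq0 => /eqP e01.
  split; split=> //; apply: (mulfI n2); move: tr0; rewrite -e10 -e32 => tr0.
  apply/eqP; rewrite -subr_eq0 -[X in _ == X]tr0; apply/eqP; ring.
move=> [[e01 e03 e21 e23] [e00 e02 e20 e22 e]]; split.
  by rewrite /in_sl4 trE -e00 -e22 e; ring.
apply/matrixP => i j; rewrite bE mxE.
by move: i j; do 2 apply: forall4; rewrite /= ?e01 ?e03 ?e21 ?e23 -?e00 -?e02 -?e20 -?e22; ring.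
Qed.

Lemma half_sum_diff (a b s d : K) : (a + b) / 2 = s -> (a - b) / 2 = d ->
  a = s + d /\ b = s - d.
Proof.
have n2 := two_neq0 K.
by move=> <- <-; split; field.
Qed.

Lemma half_sum_diff0 (a b : K) : (a + b) / 2 = 0 -> (a - b) / 2 = 0 -> a = 0 /\ b = 0.
Proof. by move=> s d; have := half_sum_diff s d; rewrite addr0 subr0. Qed.

(** The matrix q over N: p = z_2 / sqrt 2, and u_1, u_2 = z_1 + z_3, z_1 - z_3. *)
Definition qN (p u1 u2 : K) : 'M[K]_4 := mx_of
  [:: [:: p; 1; 0; 0]; [:: u1; p; 0; 0]; [:: 0; 0; - p; 1]; [:: 0; 0; u2; - p]].

Lemma brk_qN p u1 u2 A : let M := brk (qN p u1 u2) A in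
  [/\ M (o4 0) (o4 0) = A (o4 1) (o4 0) - u1 * A (o4 0) (o4 1),
      M (o4 0) (o4 1) = A (o4 1) (o4 1) - A (o4 0) (o4 0),
      M (o4 1) (o4 0) = u1 * (A (o4 0) (o4 0) - A (o4 1) (o4 1)) &
      M (o4 1) (o4 1) = u1 * A (o4 0) (o4 1) - A (o4 1) (o4 0)] /\
  [/\ M (o4 2) (o4 2) = A (o4 3) (o4 2) - u2 * A (o4 2) (o4 3),
      M (o4 2) (o4 3) = A (o4 3) (o4 3) - A (o4 2) (o4 2),
      M (o4 3) (o4 2) = u2 * (A (o4 2) (o4 2) - A (o4 3) (o4 3)) &
      M (o4 3) (o4 3) = u2 * A (o4 2) (o4 3) - A (o4 3) (o4 2)].
Proof. by rewrite /brk; split; split; rewrite !mxE !sum4 !mxE /=; ring. Qed.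

Lemma brk_qN_off p u1 u2 A : let M := brk (qN p u1 u2) A in
  [/\ M (o4 0) (o4 2) = 2 * p * A (o4 0) (o4 2) + A (o4 1) (o4 2) - u2 * A (o4 0) (o4 3),
      M (o4 0) (o4 3) = 2 * p * A (o4 0) (o4 3) + A (o4 1) (o4 3) - A (o4 0) (o4 2) &
      M (o4 1) (o4 3) = u1 * A (o4 0) (o4 3) + 2 * p * A (o4 1) (o4 3) - A (o4 1) (o4 2)] /\
  [/\ M (o4 2) (o4 0) = - 2 * p * A (o4 2) (o4 0) + A (o4 3) (o4 0) - u1 * A (o4 2) (o4 1),
      M (o4 2) (o4 1) = - 2 * p * A (o4 2) (o4 1) + A (o4 3) (o4 1) - A (o4 2) (o4 0) &
      M (o4 3) (o4 1) = u2 * A (o4 2) (o4 1) - 2 * p * A (o4 3) (o4 1) - A (o4 3) (o4 0)].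
Proof. by rewrite /brk; split; split; rewrite !mxE !sum4 !mxE /=; ring. Qed.

Lemma qmxN (z : 'rV[K]_3) : qmx (row_mx z (0 : 'rV[K]_4)) =
  qN (z 0 1 / sqrtC 2) (z 0 0 + z 0 2) (z 0 0 - z 0 2).
Proof.
have el (i : 'I_7) (j : 'I_3) : i = lshift 4 j :> nat -> row_mx z (0 : 'rV[K]_4) 0 i = z 0 j.
  by move=> e; rewrite (_ : i = lshift 4 j) ?row_mxEl //; exact: val_inj.
have er (i : 'I_7) (j : 'I_4) : i = rshift 3 j :> nat -> row_mx z (0 : 'rV[K]_4) 0 i = 0.
  by move=> e; rewrite (_ : i = rshift 3 j) ?row_mxEr ?mxE //; exact: val_inj.
rewrite /qmx (el 0 0) // (el 1 1) // (el 2 2) // (er 3 0) // (er 4 1) // (er 5 2) // (er 6 3) //.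
by rewrite !addr0 !subr0 mul0r.
Qed.

(** Tells the first 2x2 block from the second. *)
Definition blk (i : 'I_4) : bool := (i < 2)%N.

Definition block_diag A : Prop := forall i j, blk i != blk j -> A i j = 0.
Definition block_off A : Prop := forall i j, blk i = blk j -> A i j = 0.

Lemma qN_block p u1 u2 : block_diag (qN p u1 u2).
Proof. by move=> i j; move: i j; do 2 apply: forall4; rewrite mxE. Qed.

Lemma form_diag_off A B : block_diag A -> block_off B -> form A B = 0.
Proof.
move=> dA oB; rewrite trace_formE big1 ?mul0r // => i _; rewrite big1 // => k _.
have [e|ne] := eqVneq (blk i) (blk k); first by rewrite (oB k i) ?mulr0.
by rewrite dA // mul0r.
Qed.

Lemma trace_formC A B : form A B = form B A.
Proof. by rewrite /form mxtrace_mulC. Qed.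

Lemma brk_diag A B : block_diag A -> block_diag B -> block_diag (brk A B).
Proof.
move=> dA dB i j ij; rewrite !mxE !big1 ?subr0 // => k _.
  have [e|ne] := eqVneq (blk i) (blk k); last by rewrite (dB i k) // mul0r.
  by rewrite (dA k j) ?mulr0 // -e.
have [e|ne] := eqVneq (blk i) (blk k); last by rewrite (dA i k) // mul0r.
by rewrite (dB k j) ?mulr0 // -e.
Qed.

Lemma brk_off A B : block_diag A -> block_off B -> block_off (brk A B).
Proof.
move=> dA oB i j ij; rewrite !mxE !big1 ?subr0 // => k _.
  have [e|ne] := eqVneq (blk i) (blk k); first by rewrite (oB i k) // mul0r.
  by rewrite (dA k j) ?mulr0 // -ij eq_sym.
have [e|ne] := eqVneq (blk i) (blk k); last by rewrite (dA i k) // mul0r.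
by rewrite (oB k j) ?mulr0 // -e.
Qed.

Lemma qmxE (z : 'rV[K]_7) : let r := sqrtC 2 in qmx z = L1 + mx_of
  [:: [:: z 0 (o7 1) / r; 0; (z 0 (o7 4) - z 0 (o7 5)) / r; 0];
      [:: z 0 (o7 0) + z 0 (o7 2); z 0 (o7 1) / r; z 0 (o7 3) + z 0 (o7 6);
          (z 0 (o7 4) - z 0 (o7 5)) / r];
      [:: (z 0 (o7 4) + z 0 (o7 5)) / r; 0; - (z 0 (o7 1) / r); 0];
      [:: z 0 (o7 6) - z 0 (o7 3); (z 0 (o7 4) + z 0 (o7 5)) / r; z 0 (o7 0) - z 0 (o7 2);
          - (z 0 (o7 1) / r)]].
Proof.
have e (i j : 'I_7) : i = j :> nat -> z 0 i = z 0 j by move=> ij; congr (z 0 _); exact: val_inj.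
have L1E : L1 = delta_mx (o4 0) (o4 1) + delta_mx (o4 2) (o4 3) :> 'M[K]_4.
  by congr (delta_mx _ _ + delta_mx _ _); exact: val_inj.
rewrite /qmx (e 0 (o7 0)) // (e 1 (o7 1)) // (e 2 (o7 2)) // (e 3 (o7 3)) //.
rewrite (e 4 (o7 4)) // (e 5 (o7 5)) // (e 6 (o7 6)) // L1E.
apply/matrixP => i j; move: i j.
by do 2 apply: forall4; rewrite !mxE /= ?add0r ?addr0.
Qed.

Lemma form_Xb A k : let r := sqrtC 2 in let d j := (k == j)%:R in
  form A (Xb k) =
  (A (o4 0) (o4 1) * (d (o7 0) + d (o7 2)) + A (o4 2) (o4 3) * (d (o7 0) - d (o7 2)) +
   (A (o4 0) (o4 0) + A (o4 1) (o4 1) - A (o4 2) (o4 2) - A (o4 3) (o4 3)) * (d (o7 1) / r) +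
   A (o4 2) (o4 1) * (d (o7 3) + d (o7 6)) + A (o4 0) (o4 3) * (d (o7 6) - d (o7 3)) +
   (A (o4 2) (o4 0) + A (o4 3) (o4 1)) * ((d (o7 4) - d (o7 5)) / r) +
   (A (o4 0) (o4 2) + A (o4 1) (o4 3)) * ((d (o7 4) + d (o7 5)) / r)) / 2.
Proof.
move=> r d; rewrite trace_formE /Xb qmxE addrAC subrr add0r !sum4; congr (_ / _).
have dE j : (delta_mx 0 k : 'rV[K]_7) 0 j = d j by rewrite mxE eqxx eq_sym.
rewrite !dE; set d0 := d _; set d2 := d _; set d1 := _ / r; set d3 := d (o7 3).
set d6 := d (o7 6); set d45 := _ / r; set d45' := _ / r.
by rewrite !mxE /=; ring.
Qed.

Lemma form_Xb_diag A : let r := sqrtC 2 in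
  [/\ form A (Xb (o7 0)) = (A (o4 0) (o4 1) + A (o4 2) (o4 3)) / 2,
      form A (Xb (o7 1)) =
        (A (o4 0) (o4 0) + A (o4 1) (o4 1) - A (o4 2) (o4 2) - A (o4 3) (o4 3)) / r / 2 &
      form A (Xb (o7 2)) = (A (o4 0) (o4 1) - A (o4 2) (o4 3)) / 2].
Proof. by move=> r; split; rewrite form_Xb /=; ring. Qed.

Lemma form_Xb_off A : let r := sqrtC 2 in
  [/\ form A (Xb (o7 3)) = (A (o4 2) (o4 1) - A (o4 0) (o4 3)) / 2,
      form A (Xb (o7 4)) =
        ((A (o4 2) (o4 0) + A (o4 3) (o4 1)) + (A (o4 0) (o4 2) + A (o4 1) (o4 3))) / 2 / r,
      form A (Xb (o7 5)) = - (((A (o4 2) (o4 0) + A (o4 3) (o4 1)) -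
        (A (o4 0) (o4 2) + A (o4 1) (o4 3))) / 2 / r) &
      form A (Xb (o7 6)) = (A (o4 2) (o4 1) + A (o4 0) (o4 3)) / 2].
Proof. by move=> r; split; rewrite form_Xb /=; ring. Qed.

End Blocks.

Section GradientMatrices.
Context {R : realType}.
Notation C := R[i].
Implicit Types (A : R -> 'M[C]_4) (z v : R -> 'rV[C]_3).
Local Notation r := (sqrtC (2 : C)).

Lemma r_neq0 : r != 0. Proof. by rewrite sqrtC_eq0 pnatr_eq0. Qed.

Lemma dx0 (f : R -> C) : (forall x, f x = 0) -> forall x, dx f x = 0.
Proof.
by move=> h x; rewrite (_ : f = fun=> 0) ?dx_cst //; apply/funext.
Qed.

Lemma dx_ext (f g : R -> C) : (forall x, f x = g x) -> dx f = dx g.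
Proof. by move=> /funext ->. Qed.

Definition diag_entry z x := z x 0 1 / r.
Definition pot1 z x := z x 0 0 + z x 0 2.
Definition pot2 z x := z x 0 0 - z x 0 2.

(** The equations for a matrix variational derivative other than the gradient condition. *)
Definition along_gf z A : Prop := forall x,
  in_sl4 (A x) /\ in_gf (mdx A x + brk (qN (diag_entry z x) (pot1 z x) (pot2 z x)) (A x)).

Lemma mdxE A x i j : mdx A x i j = dx (fun y => A y i j) x.
Proof. by rewrite mxE. Qed.

Lemma sl4E A x : in_sl4 (A x) ->
  A x (o4 0) (o4 0) + A x (o4 1) (o4 1) = - (A x (o4 2) (o4 2) + A x (o4 3) (o4 3)).
Proof.
rewrite /in_sl4 /mxtrace sum4 => e; apply/eqP; rewrite -subr_eq0 -[X in _ == X]e.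
by apply/eqP; ring.
Qed.

Lemma along_gfE z A : along_gf z A -> forall x,
  let a i j := A x i j in let d i j := dx (fun y => A y i j) x in
  let p := diag_entry z x in let u1 := pot1 z x in let u2 := pot2 z x in
  [/\ d (o4 0) (o4 1) + (a (o4 1) (o4 1) - a (o4 0) (o4 0)) = 0,
      d (o4 2) (o4 3) + (a (o4 3) (o4 3) - a (o4 2) (o4 2)) = 0,
      d (o4 0) (o4 0) + (a (o4 1) (o4 0) - u1 * a (o4 0) (o4 1)) =
      d (o4 1) (o4 1) + (u1 * a (o4 0) (o4 1) - a (o4 1) (o4 0)) &
      d (o4 2) (o4 2) + (a (o4 3) (o4 2) - u2 * a (o4 2) (o4 3)) =
      d (o4 3) (o4 3) + (u2 * a (o4 2) (o4 3) - a (o4 3) (o4 2))] /\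
  [/\ d (o4 0) (o4 3) + (2 * p * a (o4 0) (o4 3) + a (o4 1) (o4 3) - a (o4 0) (o4 2)) = 0,
      d (o4 2) (o4 1) + (- 2 * p * a (o4 2) (o4 1) + a (o4 3) (o4 1) - a (o4 2) (o4 0)) = 0,
      d (o4 0) (o4 2) + (2 * p * a (o4 0) (o4 2) + a (o4 1) (o4 2) - u2 * a (o4 0) (o4 3)) =
      d (o4 1) (o4 3) + (u1 * a (o4 0) (o4 3) + 2 * p * a (o4 1) (o4 3) - a (o4 1) (o4 2)) &
      d (o4 2) (o4 0) + (- 2 * p * a (o4 2) (o4 0) + a (o4 3) (o4 0) - u1 * a (o4 2) (o4 1)) =
      d (o4 3) (o4 1) + (u2 * a (o4 2) (o4 1) - 2 * p * a (o4 3) (o4 1) - a (o4 3) (o4 0))].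
Proof.
move=> h x a d p u1 u2; have [_] := h x.
have mE i j : (mdx A x + brk (qN p u1 u2) (A x)) i j = d i j + brk (qN p u1 u2) (A x) i j.
  by rewrite mxE mdxE.
move=> /in_gfP[[m01 m03 m21 m23] [m00 m02 m20 m22 _]].
have [[b00 b01 b10 b11] [b22 b23 b32 b33]] := brk_qN p u1 u2 (A x).
have [[b02 b03 b13] [b20 b21 b31]] := brk_qN_off p u1 u2 (A x).
split; split.
- exact: etrans (esym (etrans (mE _ _) (congr1 _ b01))) m01.
- exact: etrans (esym (etrans (mE _ _) (congr1 _ b23))) m23.
- exact: etrans (esym (etrans (mE _ _) (congr1 _ b00))) (etrans m00 (etrans (mE _ _) (congr1 _ b11))).
- exact: etrans (esym (etrans (mE _ _) (congr1 _ b22))) (etrans m22 (etrans (mE _ _) (congr1 _ b33))).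
- exact: etrans (esym (etrans (mE _ _) (congr1 _ b03))) m03.
- exact: etrans (esym (etrans (mE _ _) (congr1 _ b21))) m21.
- exact: etrans (esym (etrans (mE _ _) (congr1 _ b02))) (etrans m02 (etrans (mE _ _) (congr1 _ b13))).
- exact: etrans (esym (etrans (mE _ _) (congr1 _ b20))) (etrans m20 (etrans (mE _ _) (congr1 _ b31))).
Qed.

Lemma halve (a b : C) : a + b = 0 -> b - a = 0 -> a = 0 /\ b = 0.
Proof.
move=> s d; have [] : b = 0 /\ a = 0; last by [].
by apply: half_sum_diff0; rewrite ?d ?[b + a]addrC ?s mul0r.
Qed.

Lemma double0 (a : C) : a = - a -> a = 0.
Proof. move=> e; have n2 := two_neq0 C.
by apply: (mulfI n2); rewrite mulr0 mulr_natl mulr2n {2}e subrr. Qed.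

(** The entries 03 and 21, and then 02 + 13 and 20 + 31, vanish by the
    pairing with X_4, ..., X_7.  Since the image lies in g^f, the
    differences 02 - 13, 20 - 31 and finally the entries 12, 30 vanish
    too. *)
Lemma along_gf_diag z A : along_gf z A ->
  (forall k : 'I_7, (2 < k)%N -> forall x, form (A x) (Xb k) = 0) ->
  forall x, block_diag (A x).
Proof.
move=> hA h0.
have [F3 F4 F5 F6] := And4 (h0 (o7 3) isT) (h0 (o7 4) isT) (h0 (o7 5) isT) (h0 (o7 6) isT).
have A2103 y : A y (o4 2) (o4 1) = 0 /\ A y (o4 0) (o4 3) = 0.
  have [e3 _ _ e6] := form_Xb_off (A y).
  exact: half_sum_diff0 (etrans (esym e6) (F6 y)) (etrans (esym e3) (F3 y)).
have A21 y := (A2103 y).1; have A03 y := (A2103 y).2.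
have ri : r^-1 != 0 by rewrite invr_eq0 r_neq0.
have S y : (A y (o4 2) (o4 0) + A y (o4 3) (o4 1) = 0) /\
    (A y (o4 0) (o4 2) + A y (o4 1) (o4 3) = 0).
  have [_ e4 e5 _] := form_Xb_off (A y).
  rewrite (F4 y) in e4; rewrite (F5 y) in e5; move: e4 e5 => /esym e4 /esym e5.
  have {}e4 := mulIf ri (etrans e4 (esym (mul0r _))).
  have {}e5 := mulIf ri (etrans (oppr_inj (etrans e5 (esym (oppr0 _)))) (esym (mul0r _))).
  exact: half_sum_diff0 e4 e5.
have Z y : [/\ A y (o4 0) (o4 2) = 0, A y (o4 1) (o4 3) = 0,
               A y (o4 2) (o4 0) = 0 & A y (o4 3) (o4 1) = 0].
  have [_ [k03 k21 _ _]] := along_gfE hA y; have [s20 s02] := S y.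
  move: k03 k21; rewrite (dx0 A03) (dx0 A21) A03 A21 !mulr0 !add0r => k03 k21.
  by have [-> ->] := halve s02 k03; have [-> ->] := halve s20 k21.
have [A02 A13 A20 A31] : [/\ forall y, A y (o4 0) (o4 2) = 0, forall y, A y (o4 1) (o4 3) = 0,
    forall y, A y (o4 2) (o4 0) = 0 & forall y, A y (o4 3) (o4 1) = 0].
  by split=> y; have [] := Z y.
move=> x; have [_ [_ _ k12 k30]] := along_gfE hA x.
move: k12 k30; rewrite (dx0 A02) (dx0 A13) (dx0 A20) (dx0 A31) A02 A13 A20 A31 A03 A21.
rewrite !mulr0 !subr0 !add0r => /double0 A12 /double0 A30.
by move=> i j; move: i j; do 2 apply: forall4.
Qed.

(** The same elimination as for the off-diagonal blocks, started from the
    pairing with X_1, X_2, X_3. *)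
Lemma along_gf_off z A : along_gf z A ->
  (forall k : 'I_7, (k < 3)%N -> forall x, form (A x) (Xb k) = 0) ->
  forall x, block_off (A x).
Proof.
move=> hA h0.
have [F0 F1 F2] := And3 (h0 (o7 0) isT) (h0 (o7 1) isT) (h0 (o7 2) isT).
have A0123 y : A y (o4 0) (o4 1) = 0 /\ A y (o4 2) (o4 3) = 0.
  have [e0 _ e2] := form_Xb_diag (A y).
  exact: half_sum_diff0 (etrans (esym e0) (F0 y)) (etrans (esym e2) (F2 y)).
have A01 y := (A0123 y).1; have A23 y := (A0123 y).2.
have ri : r^-1 != 0 by rewrite invr_eq0 r_neq0.
have i2 : 2^-1 != 0 :> C by rewrite invr_eq0 pnatr_eq0.
have S y : (A y (o4 0) (o4 0) + A y (o4 1) (o4 1) = 0) /\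
    (A y (o4 2) (o4 2) + A y (o4 3) (o4 3) = 0).
  have [_ e1 _] := form_Xb_diag (A y); move: e1; rewrite F1 => /esym e1.
  have {}e1 := mulIf ri (etrans (mulIf i2 (etrans e1 (esym (mul0r _)))) (esym (mul0r _))).
  have t := sl4E (hA y).1; move: e1; rewrite t => e1.
  have e2 : A y (o4 2) (o4 2) + A y (o4 3) (o4 3) = 0.
    apply: double0; apply/eqP; rewrite -subr_eq0 opprK; apply/eqP.
    by rewrite -[RHS]oppr0 -e1; ring.
  by rewrite e2 oppr0.
have Z y : [/\ A y (o4 0) (o4 0) = 0, A y (o4 1) (o4 1) = 0,
               A y (o4 2) (o4 2) = 0 & A y (o4 3) (o4 3) = 0].
  have [[k01 k23 _ _] _] := along_gfE hA y; have [s0 s2] := S y.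
  move: k01 k23; rewrite (dx0 A01) (dx0 A23) !add0r => k01 k23.
  by have [-> ->] := halve s0 k01; have [-> ->] := halve s2 k23.
have [A00 A11 A22 A33] : [/\ forall y, A y (o4 0) (o4 0) = 0, forall y, A y (o4 1) (o4 1) = 0,
    forall y, A y (o4 2) (o4 2) = 0 & forall y, A y (o4 3) (o4 3) = 0].
  by split=> y; have [] := Z y.
move=> x; have [[_ _ k10 k32] _] := along_gfE hA x.
move: k10 k32; rewrite (dx0 A00) (dx0 A11) (dx0 A22) (dx0 A33) A01 A23.
rewrite !mulr0 !subr0 !add0r => /double0 A10 /double0 A32.
by move=> i j; move: i j; do 2 apply: forall4.
Qed.

End GradientMatrices.

(** * Matrix variational derivatives over N *)

Section DeltaBar.
Context {R : realType}.
Notation C := R[i].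
Implicit Types (A : R -> 'M[C]_4) (z v w f g : R -> 'rV[C]_3) (F G : @functional R 7).
Local Notation r := (sqrtC (2 : C)).

Lemma row_mx_low (v : 'rV[C]_3) (w : 'rV[C]_4) (k : 'I_7) : (k < 3)%N -> v = 0 ->
  row_mx v w 0 k = 0.
Proof.
move=> k3 ->; rewrite mxE; case: splitP => j /= kj; first by rewrite mxE.
by move: k3; rewrite kj.
Qed.

Lemma row_mx_high (v : 'rV[C]_3) (w : 'rV[C]_4) (k : 'I_7) : (2 < k)%N -> w = 0 ->
  row_mx v w 0 k = 0.
Proof.
move=> k3 ->; rewrite mxE; case: splitP => j /= kj; last by rewrite mxE.
by move: k3 (ltn_ord j); rewrite kj ltnNge -ltnS => /negbTE ->.
Qed.

Lemma delta_bar_along F z A : is_delta_bar F (inclN z) A -> along_gf z A.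
Proof.
move=> [_ hs _ hg] x; split; first exact: hs.
by have := hg x; rewrite /inclN qmxN.
Qed.

Lemma delta_bar_form F (q : R -> 'rV[C]_7) A (v : R -> 'rV[C]_7) :
  is_delta_bar F q A -> is_gradient F q v ->
  forall x i, form (A x) (Xb i) = v x 0 i.
Proof.
move=> [_ _ hF _] hv x i; rewrite -(is_gradient_uniq hF hv).
by rewrite mxE.
Qed.

(** The choice operator returns the zero matrix when no solution exists; zero
    lies in both parts of the splitting, so both cases can be treated
    alike. *)
Lemma delta_bar_cases F (q : R -> 'rV[C]_7) :
  is_delta_bar F q (delta_bar F q) \/ delta_bar F q = fun=> 0.
Proof. by rewrite /delta_bar; case: xgetP => [A _ hA|_]; [left|right]. Qed.

Lemma delta_bar_diag F z v :
  is_gradient F (inclN z) (fun x => row_mx (v x) (0 : 'rV[C]_4)) ->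
  forall x, block_diag (delta_bar F (inclN z) x).
Proof.
move=> hF x; have [hA|->] := delta_bar_cases F (inclN z); last by move=> i j _; rewrite mxE.
apply: (along_gf_diag (delta_bar_along hA)) => k k2 y.
by rewrite (delta_bar_form hA hF) row_mx_high.
Qed.

Lemma delta_bar_off F z (w : R -> 'rV[C]_4) :
  is_gradient F (inclN z) (fun x => row_mx (0 : 'rV[C]_3) (w x)) ->
  forall x, block_off (delta_bar F (inclN z) x).
Proof.
move=> hF x; have [hA|->] := delta_bar_cases F (inclN z); last by move=> i j _; rewrite mxE.
apply: (along_gf_off (delta_bar_along hA)) => k k2 y.
by rewrite (delta_bar_form hA hF) row_mx_low.
Qed.

Lemma mdx_diag A : (forall x, block_diag (A x)) -> forall x, block_diag (mdx A x).
Proof. by move=> h x i j ij; rewrite mxE dx0 // => y; exact: h. Qed.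

Lemma mdx_off A : (forall x, block_off (A x)) -> forall x, block_off (mdx A x).
Proof. by move=> h x i j ij; rewrite mxE dx0 // => y; exact: h. Qed.

(** The bracket pairs a block diagonal with a block off-diagonal matrix. *)
Theorem mixed_brackets : @mixed_brackets_vanish R.
Proof.
move=> z F G v w _ hF hG.
have dF := delta_bar_diag hF; have oG := delta_bar_off hG.
have dq x : block_diag (qmx (inclN z x)) by rewrite /inclN qmxN; exact: qN_block.
split; rewrite /bracketQ -[RHS](cint0 (R := R)); apply: eq_cint => x.
  apply: form_diag_off (dF x) _ => i j ij.
  by rewrite mxE (mdx_off oG) // (brk_off (dq x) (oG x)) // addr0.
rewrite trace_formC; apply: form_diag_off _ (oG x) => i j ij.
by rewrite mxE (mdx_diag dF) // (brk_diag (dq x) (dF x)) // addr0.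
Qed.

Lemma brkB (B X Y : 'M[C]_4) : brk B (X - Y) = brk B X - brk B Y.
Proof. by rewrite /brk mulmxBr mulmxBl !opprD !opprK addrACA. Qed.

Lemma mdxB A A' : mloop A -> mloop A' -> mdx (fun x => A x - A' x) = fun x => mdx A x - mdx A' x.
Proof.
move=> /mloop_smooth lA /mloop_smooth lA'; apply/funext => x; apply/matrixP => i j.
rewrite !mxE (dx_ext (g := fun y => A y i j - A' y i j)) => [|y]; last by rewrite !mxE.
by rewrite (dxB (lA i j) (lA' i j)).
Qed.

Lemma along_gfB z A A' : mloop A -> mloop A' -> along_gf z A -> along_gf z A' ->
  along_gf z (fun x => A x - A' x).
Proof.
move=> lA lA' h h' x; have [s [t g]] := h x; have [s' [t' g']] := h' x; split.
  by rewrite /in_sl4 raddfB /= s s' subr0.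
rewrite (mdxB lA lA') brkB addrACA -opprD; split.
  by rewrite /in_sl4 raddfB [X in X - _]t [X in _ - X]t' subr0.
by rewrite brkB [X in X - _]g [X in _ - X]g' subr0.
Qed.

Lemma trace_formB (X Y B : 'M[C]_4) : form (X - Y) B = form X B - form Y B.
Proof. by rewrite /form mulmxBl raddfB mulrBl. Qed.

(** The difference of two solutions has zero gradient, hence it is block diagonal
    and block off-diagonal. *)
Lemma delta_bar_uniq F z A A' :
  is_delta_bar F (inclN z) A -> is_delta_bar F (inclN z) A' -> A = A'.
Proof.
move=> h h'; have [lA _ gA _] := h; have [lA' _ _ _] := h'.
have hB := along_gfB lA lA' (delta_bar_along h) (delta_bar_along h').
have f0 k x : form (A x - A' x) (Xb k) = 0.
  by rewrite trace_formB (delta_bar_form h gA) (delta_bar_form h' gA) subrr.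
have dB := along_gf_diag hB (fun k _ => f0 k); have oB := along_gf_off hB (fun k _ => f0 k).
apply/funext => x; apply/eqP; rewrite -subr_eq0; apply/eqP/matrixP => i j; rewrite [RHS]mxE.
by have [e|ne] := eqVneq (blk i) (blk j); [exact: oB|exact: dB].
Qed.

Lemma delta_barE F z A : is_delta_bar F (inclN z) A -> delta_bar F (inclN z) = A.
Proof. by move=> h; apply: xget_subset1 h _ => A1 A2; exact: delta_bar_uniq. Qed.

(** [top1] and [top2] are the upper right entries of the two diagonal blocks of
    the matrix variational derivative with gradient [v], and [trace1] is the
    trace of its first block. *)
Definition top1 v x : C := v x 0 0 + v x 0 2.
Definition top2 v x : C := v x 0 0 - v x 0 2.
Definition trace1 v x : C := r * v x 0 1.

(** The matrix variational derivative with gradient [v]: the vanishing of the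
    upper right entries of its image and the traces of the blocks give the
    diagonal, and the equality of the diagonal entries of the image gives the lower left entries. *)
Definition dbar z v : R -> 'M[C]_4 := fun x => mx_of
  [:: [:: 2^-1 * (trace1 v x + dx (top1 v) x); top1 v x; 0; 0];
      [:: pot1 z x * top1 v x - 2^-1 * dx (dx (top1 v)) x; 2^-1 * (trace1 v x - dx (top1 v) x); 0; 0];
      [:: 0; 0; 2^-1 * (- trace1 v x + dx (top2 v) x); top2 v x];
      [:: 0; 0; pot2 z x * top2 v x - 2^-1 * dx (dx (top2 v)) x;
          2^-1 * (- trace1 v x - dx (top2 v) x)]].

Section Solution.
Variables (z v : R -> 'rV[C]_3).
Hypotheses (lz : mloop z) (lv : mloop v).

Lemma top1_smooth (w : R -> 'rV[C]_3) : mloop w -> smooth (top1 w).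
Proof. by move=> /rloopP h; exact: smoothD (h 0) (h 2). Qed.
Lemma top2_smooth (w : R -> 'rV[C]_3) : mloop w -> smooth (top2 w).
Proof. by move=> /rloopP h; exact: smoothB (h 0) (h 2). Qed.
Lemma trace1_smooth (w : R -> 'rV[C]_3) : mloop w -> smooth (trace1 w).
Proof. by move=> /rloopP h; exact: smoothZ (h 1). Qed.

Lemma dbar_block x : block_diag (dbar z v x).
Proof. by move=> i j; move: i j; do 2 apply: forall4; rewrite mxE. Qed.

Lemma dbar_form x k : form (dbar z v x) (Xb k) = row_mx (v x) (0 : 'rV[C]_4) 0 k.
Proof.
have r0 := r_neq0 (R := R); have n2 := two_neq0 C.
have [k2|k3] := ltnP 2 k.
  have d (j : 'I_7) : (j < 3)%N -> (k == j) = false.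
    by move=> j3; apply/negbTE; apply: contraTneq k2 => ->; rewrite -leqNgt.
  by rewrite row_mx_high // form_Xb (d (o7 0)) // (d (o7 1)) // (d (o7 2)) // !mxE /=; ring.
have [e0 e1 e2] := form_Xb_diag (dbar z v x).
have low (j : 'I_3) : k = lshift 4 j :> nat -> row_mx (v x) (0 : 'rV[C]_4) 0 k = v x 0 j.
  by move=> e; rewrite (_ : k = lshift 4 j) ?row_mxEl //; exact: val_inj.
move: k low k3; case=> [[|[|[|k]]] hk] low //= _.
- rewrite (low 0) // (_ : Ordinal hk = o7 0); last exact: val_inj.
  rewrite e0 !mxE /= /top1 /top2.
  by field.
- rewrite (low 1) // (_ : Ordinal hk = o7 1); last exact: val_inj.
  rewrite e1 !mxE /= /trace1.
  by field.
- rewrite (low 2) // (_ : Ordinal hk = o7 2); last exact: val_inj.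
  rewrite e2 !mxE /= /top1 /top2.
  by field.
Qed.

Lemma pot1_smooth : smooth (pot1 z). Proof. exact: top1_smooth. Qed.
Lemma pot2_smooth : smooth (pot2 z). Proof. exact: top2_smooth. Qed.

Lemma dbar_loop : mloop (dbar z v).
Proof.
have sp := top1_smooth lv; have sm := top2_smooth lv; have ss := trace1_smooth lv.
have s1 := pot1_smooth; have s2 := pot2_smooth.
apply/mloop_smooth => i j; move: i j; do 2 apply: forall4.
all: apply: (@eq_smooth _ (fun x => nth 0 (nth [::] _ _) _)) => [x|];
  [by rewrite mxE; reflexivity|rewrite /=; smooth_tac].
Qed.

End Solution.

End DeltaBar.

(** * The reduced bracket *)

Lemma form_mx_of (K : numClosedFieldType) (s b d c b' d' c' h y y' : K) (M : 'M[K]_4) :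
  [/\ M (o4 0) (o4 0) = 2^-1 * h, M (o4 0) (o4 1) = 0,
      M (o4 1) (o4 0) = y & M (o4 1) (o4 1) = 2^-1 * h] ->
  [/\ M (o4 2) (o4 2) = - (2^-1 * h), M (o4 2) (o4 3) = 0,
      M (o4 3) (o4 2) = y' & M (o4 3) (o4 3) = - (2^-1 * h)] ->
  form (mx_of [:: [:: 2^-1 * (s + d); b; 0; 0]; [:: c; 2^-1 * (s - d); 0; 0];
                  [:: 0; 0; 2^-1 * (- s + d'); b']; [:: 0; 0; c'; 2^-1 * (- s - d')]]) M =
  (s * h + b * y + b' * y') / 2.
Proof.
have n2 := two_neq0 K.
move=> [e00 e01 e10 e11] [e22 e23 e32 e33].
by rewrite trace_formE !sum4 e00 e01 e10 e11 e22 e23 e32 e33 !mxE /=; field.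
Qed.

Section SolutionBracket.
Context {R : realType}.
Notation C := R[i].
Implicit Types (z v w f g : R -> 'rV[C]_3).
Local Notation r := (sqrtC (2 : C)).

(** 2 u b' + u' b - b'''/2, the contribution of one block to the bracket. *)
Definition block_op (u b : R -> C) : R -> C := fun x =>
  dx u x * b x + 2 * u x * dx b x - 2^-1 * dx (dx (dx b)) x.

Section Solution.
Variables (z v : R -> 'rV[C]_3).
Hypotheses (lz : mloop z) (lv : mloop v).
Let sp := top1_smooth lv.
Let sm := top2_smooth lv.
Let ss := trace1_smooth lv.
Let s1 := pot1_smooth lz.
Let s2 := pot2_smooth lz.

(** The image of [dbar] under d/dx + [q, .], an element of g^f. *)
Definition cov_dbar x : 'M[C]_4 :=
  mdx (dbar z v) x + brk (qN (diag_entry z x) (pot1 z x) (pot2 z x)) (dbar z v x).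

Lemma dx_dbar x :
  [/\ mdx (dbar z v) x (o4 0) (o4 0) = 2^-1 * (dx (trace1 v) x + dx (dx (top1 v)) x),
      mdx (dbar z v) x (o4 0) (o4 1) = dx (top1 v) x,
      mdx (dbar z v) x (o4 1) (o4 0) =
        dx (pot1 z) x * top1 v x + pot1 z x * dx (top1 v) x - 2^-1 * dx (dx (dx (top1 v))) x &
      mdx (dbar z v) x (o4 1) (o4 1) = 2^-1 * (dx (trace1 v) x - dx (dx (top1 v)) x)] /\
  [/\ mdx (dbar z v) x (o4 2) (o4 2) = 2^-1 * (- dx (trace1 v) x + dx (dx (top2 v)) x),
      mdx (dbar z v) x (o4 2) (o4 3) = dx (top2 v) x,
      mdx (dbar z v) x (o4 3) (o4 2) =
        dx (pot2 z) x * top2 v x + pot2 z x * dx (top2 v) x - 2^-1 * dx (dx (dx (top2 v))) x &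
      mdx (dbar z v) x (o4 3) (o4 3) = 2^-1 * (- dx (trace1 v) x - dx (dx (top2 v)) x)].
Proof.
have key i j (e : R -> C) (l : C) : (forall y, dbar z v y i j = e y) -> dx e x = l ->
    mdx (dbar z v) x i j = l.
  by move=> h <-; rewrite mdxE (dx_ext h).
have hD (c : C) (f g : R -> C) : smooth f -> smooth g ->
    dx (fun y => c * (f y + g y)) x = c * (dx f x + dx g x).
  by move=> hf hg; rewrite (dxZ c (smoothD hf hg)) (dxD hf hg).
have hB (c : C) (f g : R -> C) : smooth f -> smooth g ->
    dx (fun y => c * (f y - g y)) x = c * (dx f x - dx g x).
  by move=> hf hg; rewrite (dxZ c (smoothB hf hg)) (dxB hf hg).
have hP (c : C) (u f g : R -> C) : smooth u -> smooth f -> smooth g ->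
    dx (fun y => u y * f y - c * g y) x = dx u x * f x + u x * dx f x - c * dx g x.
  by move=> hu hf hg; rewrite (dxB (smoothM hu hf) (smoothZ c hg)) (dxM hu hf) (dxZ c hg).
have sp' := smooth_dx sp; have sm' := smooth_dx sm; have sn := smoothN ss.
have nE : dx (fun y => - trace1 v y) x = - dx (trace1 v) x by rewrite (dxN ss).
split; split.
- by apply: key (hD 2^-1 _ _ ss sp') => y; rewrite mxE.
- by apply: (key _ _ (top1 v) _ _ erefl) => y; rewrite mxE.
- by apply: key (hP 2^-1 _ _ _ s1 sp (smooth_dx sp')) => y; rewrite mxE.
- by apply: key (hB 2^-1 _ _ ss sp') => y; rewrite mxE.
- by rewrite -nE; apply: key (hD 2^-1 _ _ sn sm') => y; rewrite mxE.
- by apply: (key _ _ (top2 v) _ _ erefl) => y; rewrite mxE.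
- by apply: key (hP 2^-1 _ _ _ s2 sm (smooth_dx sm')) => y; rewrite mxE.
- by rewrite -nE; apply: key (hB 2^-1 _ _ sn sm') => y; rewrite mxE.
Qed.

Lemma cov_dbar_block x : block_diag (cov_dbar x).
Proof.
move=> i j ij; rewrite mxE (mdx_diag (@dbar_block R z v)) //.
by rewrite (brk_diag (@qN_block _ _ _ _) (@dbar_block R z v x)) // addr0.
Qed.

Lemma cov_dbarE x :
  [/\ cov_dbar x (o4 0) (o4 0) = 2^-1 * dx (trace1 v) x, cov_dbar x (o4 0) (o4 1) = 0,
      cov_dbar x (o4 1) (o4 0) = block_op (pot1 z) (top1 v) x &
      cov_dbar x (o4 1) (o4 1) = 2^-1 * dx (trace1 v) x] /\
  [/\ cov_dbar x (o4 2) (o4 2) = - (2^-1 * dx (trace1 v) x), cov_dbar x (o4 2) (o4 3) = 0,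
      cov_dbar x (o4 3) (o4 2) = block_op (pot2 z) (top2 v) x &
      cov_dbar x (o4 3) (o4 3) = - (2^-1 * dx (trace1 v) x)].
Proof.
have n2 := two_neq0 C.
have [[d00 d01 d10 d11] [d22 d23 d32 d33]] := dx_dbar x.
have [[b00 b01 b10 b11] [b22 b23 b32 b33]] :=
  brk_qN (diag_entry z x) (pot1 z x) (pot2 z x) (dbar z v x).
have E i j d e l : mdx (dbar z v) x i j = d ->
    brk (qN (diag_entry z x) (pot1 z x) (pot2 z x)) (dbar z v x) i j = e -> d + e = l ->
    cov_dbar x i j = l.
  by move=> <- <- <-; rewrite mxE.
split; split.
- by apply: (E _ _ _ _ _ d00 b00); rewrite !mxE /=; ring.
- by apply: (E _ _ _ _ _ d01 b01); rewrite !mxE /=; field.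
- by apply: (E _ _ _ _ _ d10 b10); rewrite !mxE /= /block_op; field.
- by apply: (E _ _ _ _ _ d11 b11); rewrite !mxE /=; ring.
- by apply: (E _ _ _ _ _ d22 b22); rewrite !mxE /=; ring.
- by apply: (E _ _ _ _ _ d23 b23); rewrite !mxE /=; field.
- by apply: (E _ _ _ _ _ d32 b32); rewrite !mxE /= /block_op; field.
- by apply: (E _ _ _ _ _ d33 b33); rewrite !mxE /=; ring.
Qed.

Lemma cov_dbar_gf x : in_gf (cov_dbar x).
Proof.
have [[e00 e01 _ e11] [e22 e23 _ e33]] := cov_dbarE x; have dM := @cov_dbar_block x.
apply/in_gfP; split; split.
- exact: e01.
- exact: dM.
- exact: dM.
- exact: e23.
- by rewrite e00 e11.
- by rewrite !dM.
- by rewrite !dM.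
- by rewrite e22 e33.
- by rewrite e22 e00.
Qed.

Lemma dbarP (F : @functional R 7) :
  is_gradient F (inclN z) (fun x => row_mx (v x) (0 : 'rV[C]_4)) ->
  is_delta_bar F (inclN z) (dbar z v).
Proof.
move=> hF; split.
- exact: dbar_loop.
- move=> x; rewrite /in_sl4 /mxtrace sum4 !mxE /=.
  by have n2 := two_neq0 C; field.
- rewrite (_ : (fun x => _) = fun x => row_mx (v x) (0 : 'rV[C]_4)) //.
  by apply/funext => x; apply/rowP => k; rewrite mxE dbar_form.
- by move=> x; rewrite /inclN qmxN; exact: cov_dbar_gf.
Qed.

End Solution.

Lemma form_dbar z v w x : mloop z -> mloop w ->
  form (dbar z v x) (cov_dbar z w x) =
  (trace1 v x * dx (trace1 w) x + top1 v x * block_op (pot1 z) (top1 w) x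
   + top2 v x * block_op (pot2 z) (top2 w) x) / 2.
Proof.
move=> lz lw; have [hM hM'] := cov_dbarE lz lw x.
exact: form_mx_of hM hM'.
Qed.

(** A functional on N, extended independently of z_4, ..., z_7, has the
    gradient of the original one, extended by zero. *)
Lemma gradient_projN (F : @functional R 3) z v :
  is_gradient F z v -> is_gradient (F \o projN) (inclN z) (fun x => row_mx (v x) (0 : 'rV[C]_4)).
Proof.
move=> [lv gv]; split.
  apply/rloopP => k; have [k3|k3] := ltnP k 3.
    have [j ->] : exists j : 'I_3, k = lshift 4 j.
      by exists (Ordinal k3); exact: val_inj.
    apply: (@eq_smooth _ (fun x => v x 0 j)) => [x|].
      by rewrite (@row_mxEl _ 1 3 4).
    by move/rloopP: lv; apply.
  by apply: eq_smooth (smooth_cst (0 : C)) => x; rewrite row_mx_high.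
move=> w lw; pose w' x : 'rV[C]_3 := @lsubmx C 1 3 4 (w x).
have lw' : mloop w'.
  apply/rloopP => a; apply: (@eq_smooth _ (fun x => w x 0 (lshift 4 a))) => [x|].
    by rewrite mxE.
  by move/rloopP: lw; apply.
have := gv w' lw'; congr is_cderive.
  apply/funext => s /=; congr F; apply/funext => x.
  by apply/rowP => a; rewrite !mxE; case: splitP => j /= e; [congr (z x 0 _ + _); exact: val_inj|
    move: (ltn_ord a); rewrite e].
apply: eq_cint => x; rewrite [RHS](@big_split_ord _ _ _ 3 4) /=.
rewrite [X in _ = _ + X]big1 ?addr0 => [|j _]; last by rewrite (@row_mxEr _ 1 3 4) mxE mul0r.
by apply: eq_bigr => j _; rewrite (@row_mxEl _ 1 3 4) mxE.
Qed.

Lemma bracketNE (F G : @functional R 3) z v w : mloop z ->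
  is_gradient F z v -> is_gradient G z w ->
  bracketN F G z = cint (fun x => (trace1 v x * dx (trace1 w) x +
    top1 v x * block_op (pot1 z) (top1 w) x + top2 v x * block_op (pot2 z) (top2 w) x) / 2).
Proof.
move=> lz hF hG; have lv := hF.1; have lw := hG.1.
rewrite /bracketN /bracketQ (delta_barE (dbarP lz lv (gradient_projN hF))).
rewrite (delta_barE (dbarP lz lw (gradient_projN hG))).
apply: eq_cint => x; refine (etrans _ (form_dbar v x lz lw)).
by rewrite /cov_dbar /inclN qmxN.
Qed.

End SolutionBracket.

(** * The decoupling coordinates of the example *)

Section Example.
Context {K : numClosedFieldType}.

(** The rows are the functions t_2, t_1 - t_2 + t_3, t_1 - t_2 - t_3. *)
Definition btN : 'M[K]_3 := mx_of [:: [:: 0; 1; 0]; [:: 1; -1; 1]; [:: 1; -1; -1]].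
(** The vectors dual to the functions in [btN]. *)
Definition bN : 'M[K]_3 :=
  mx_of [:: [:: 1; 1; 0]; [:: 2^-1; 0; 2^-1]; [:: 2^-1; 0; - 2^-1]].
Definition cN (q : 'I_3) : K := nth 0 [:: 2; 4; 4] q.
Definition kapN (q : 'I_3) : K := nth 0 [:: 0; -1; -1] q.
(** The rates at which e = d/dt_2 moves the functions in [btN]. *)
Definition mN (q : 'I_3) : K := nth 0 [:: 1; -1; -1] q.

Lemma forall3 (Q : 'I_3 -> Prop) : Q 0 -> Q 1 -> Q 2 -> forall i, Q i.
Proof.
move=> h0 h1 h2 [[|[|[|//]]] hi].
- by rewrite (_ : Ordinal hi = 0) //; exact: val_inj.
- by rewrite (_ : Ordinal hi = 1) //; exact: val_inj.
- by rewrite (_ : Ordinal hi = 2) //; exact: val_inj.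
Qed.

Lemma dualN : btN *m bN^T = 1%:M.
Proof.
have h2 := two_neq0 K; apply/matrixP => i j; move: i j.
by do 2 apply: forall3; rewrite !mxE sum3 !mxE /=; field.
Qed.

Lemma cN_neq0 q : cN q != 0.
Proof. by move: q; apply: forall3; rewrite /cN /= pnatr_eq0. Qed.

Lemma mN_neq0 q : mN q != 0.
Proof. by move: q; apply: forall3; rewrite /mN /= ?oppr_eq0 oner_eq0. Qed.

Lemma mNE q : mN q = btN q 1.
Proof. by move: q; apply: forall3; rewrite mxE. Qed.

Lemma lin_btN t : [/\ lin btN 0 t = t 0 1, lin btN 1 t = t 0 0 - t 0 1 + t 0 2 &
  lin btN 2 t = t 0 0 - t 0 1 - t 0 2].
Proof. by rewrite /lin !sum3 !mxE /=; split; ring. Qed.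

Lemma lin_bN t : [/\ lin bN 0 t = t 0 0 + t 0 1, lin bN 1 t = 2^-1 * (t 0 0 + t 0 2) &
  lin bN 2 t = 2^-1 * (t 0 0 - t 0 2)].
Proof. by rewrite /lin !sum3 !mxE /=; split; ring. Qed.

Lemma dmetricN t : dmetric btN bN cN 1 (fun=> 0) t = Omega2 t.
Proof.
have h2 := two_neq0 K; have [l0 l1 l2] := lin_btN t.
apply/matrixP => i j; rewrite !mxE /diag_form sum3 /aff l0 l1 l2 /cN /=.
by move: i j; do 2 apply: forall3; rewrite !mxE /=; field.
Qed.

Lemma etaN : diag_mat bN (fun q => cN q * mN q) = Omega1.
Proof.
have h2 := two_neq0 K; apply/matrixP => i j; rewrite !mxE /diag_form sum3 /cN /mN /=.
by move: i j; do 2 apply: forall3; rewrite !mxE /=; field.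
Qed.

Lemma kapNE : diag_mat bN kapN = S22.
Proof.
have h2 := two_neq0 K; apply/matrixP => i j; rewrite !mxE /diag_form sum3 /kapN /=.
by move: i j; do 2 apply: forall3; rewrite !mxE /=; field.
Qed.

Lemma FFE : FF = cubic_potential btN cN mN.
Proof.
have h2 := two_neq0 K; have h6 : 6 != 0 :> K by rewrite pnatr_eq0.
apply/funext => t; have [l0 l1 l2] := lin_btN t.
rewrite /cubic_potential /powsum sum3 l0 l1 l2 /cN /mN /= /FF.
by field.
Qed.

Lemma cinvN q : kapN q / (3 * cN q ^+ 2) = [:: 0; - 48^-1; - 48^-1]`_q.
Proof.
have n3 : 3 != 0 :> K by rewrite pnatr_eq0.
by have h2 := two_neq0 K; move: q; apply: forall3; rewrite /kapN /cN /=; field.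
Qed.

Lemma open_tdom : open (@tdom K).
Proof.
rewrite openE => t h.
have cc : (fun s : 'rV[K]_3 => s 0 1) @ t --> t 0 1 by exact: coord_continuous.
by have := cvg_neq0 _ cc h; apply.
Qed.

Lemma tdom_neq0 : @tdom K !=set0.
Proof. by exists (delta_mx 0 1); rewrite /tdom /= mxE !eqxx oner_eq0. Qed.

Definition tjacN (z : 'rV[K]_3) : 'M[K]_3 :=
  mx_of [:: [:: 1; z 0 1; 0]; [:: 0; z 0 1; 0]; [:: 0; 0; 1]].

Lemma tjacE z : tjac z = tjacN z.
Proof.
have h2 := two_neq0 K; have dc i j := @deriv_coord K 3 i j z.
have ds i : is_derive z (delta_mx 0 i) (fun s : 'rV[K]_3 => 2^-1 * s 0 1 ^+ 2)
    ((i == 1)%:R * z 0 1).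
  by apply: is_derive_eq (deriv_scale _ (deriv_pow 2 (dc i 1))) _ => /=; field.
apply/matrixP => a i; rewrite mxE; move: a; apply: forall3.
- rewrite (_ : (fun y : 'rV[K]_3 => _) = fun y : 'rV[K]_3 => y 0 0 + 2^-1 * y 0 1 ^+ 2); last first.
    by apply/funext => y; rewrite mxE.
  rewrite (pdE (deriv_add (dc i 0) (ds i))).
  by move: i {dc ds}; apply: forall3; rewrite mxE /=; ring.
- rewrite (_ : (fun y : 'rV[K]_3 => _) = fun y : 'rV[K]_3 => 2^-1 * y 0 1 ^+ 2); last first.
    by apply/funext => y; rewrite mxE.
  rewrite (pdE (ds i)).
  by move: i {dc ds}; apply: forall3; rewrite mxE /=; ring.
- rewrite (_ : (fun y : 'rV[K]_3 => _) = fun y : 'rV[K]_3 => y 0 2); last first.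
    by apply/funext => y; rewrite mxE.
  rewrite (pdE (dc i 2)).
  by move: i {dc ds}; apply: forall3; rewrite mxE /=.
Qed.

Lemma tjac_unit (z : 'rV[K]_3) : z 0 1 != 0 -> tjac z \in unitmx.
Proof.
move=> z0; pose B : 'M[K]_3 :=
  mx_of [:: [:: 1; -1; 0]; [:: 0; (z 0 1)^-1; 0]; [:: 0; 0; 1]].
have [] // := @mulmx1_unit _ _ (tjac z) B.
rewrite tjacE; apply/matrixP => i j; move: i j.
by do 2 apply: forall3; rewrite !mxE sum3 !mxE /=; field.
Qed.

Lemma evecE (z : 'rV[K]_3) : z 0 1 != 0 -> evec z *m (tjac z)^T = delta_mx 0 1.
Proof.
move=> z0; rewrite tjacE; apply/rowP; apply: forall3; rewrite !mxE sum3 !mxE /=; by field.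
Qed.

Lemma dmetric_unitN t : dmetric btN bN cN 0 mN t = Omega1.
Proof.
by rewrite -etaN; apply/matrixP => i j; rewrite !mxE; apply: eq_bigr => q _; rewrite /aff; ring.
Qed.

Lemma frobeniusN (U : set 'rV[K]_3) : frobenius_manifold U FF 1 (Omega1 : 'M[K]_3) id 0.
Proof.
rewrite FFE -etaN.
exact (frobenius_decoupled dualN cN_neq0 mN_neq0 U (k := 1) mNE).
Qed.

Lemma intersectionN t : intersection_form FF Omega1 id t = dmetric btN bN cN 1 (fun=> 0) t.
Proof. by rewrite FFE -etaN (intersection_cubic dualN cN_neq0 mN_neq0). Qed.

Lemma eulerN (t : 'rV[K]_3) : euler_action id FF t = 3 * FF t.
Proof. by rewrite FFE; exact: euler_cubic. Qed.

Lemma trivialN (U : set 'rV[K]_3) : trivial_frobenius U FF 1 (Omega1 : 'M[K]_3).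
Proof. by rewrite FFE -etaN; exact (trivial_decoupled dualN cN_neq0 mN_neq0 (U := U) 1). Qed.

Lemma central_invariantsN U : open U ->
  central_invariants U (vir btN bN cN kapN 1 (fun=> 0)) (vir btN bN cN (fun=> 0) 0 mN)
    (root_vir btN mN) (fun i _ => [:: 0; - 48^-1; - 48^-1]`_i).
Proof.
have -> : (fun (i : 'I_3) (_ : 'rV[K]_3) => [:: 0; - 48^-1; - 48^-1]`_i) =
    fun i _ => kapN i / (3 * cN i ^+ 2).
  by apply/funext => i; apply/funext => t; rewrite cinvN.
by move=> oU; exact: (central_invariants_vir dualN cN_neq0 kapN mN_neq0 oU).
Qed.

Lemma not_topologicalN : ~ topological_type tdom (vir btN bN cN kapN 1 (fun=> 0))
  (vir btN bN cN (fun=> 0) 0 mN).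
Proof.
apply: (not_topological_vir dualN cN_neq0 mN_neq0 (p := 0) (q := 1) open_tdom tdom_neq0).
by rewrite !cinvN /= eq_sym oppr_eq0 invr_eq0 pnatr_eq0.
Qed.

End Example.

Section Representation.
Context {R : realType}.
Notation C := R[i].
Implicit Types (z f g : R -> 'rV[C]_3).

(** Equality of the two integrands, with the values of all functions and
    derivatives at a point as free variables: [z] is z_2, [r] is sqrt 2, [u] and [v]
    are the two KdV potentials, and [f0], [f1], [f2], [g0], [a], [b]
    are the components of the gradients. *)
Lemma integrand_alg (K : numClosedFieldType) (s p m w0 w1 w2
  r z z' f0 f1 f2 g0 g0' g03 u u' a a' a3 v v' b b' b3 : K) : r * r = 2 ->
  s = r * (z * f0) * (r * (z' * g0 + z * g0')) ->
  p = 2 * f1 * (u' * (2 * a) + 2 * u * (2 * a') - 2^-1 * (2 * a3)) ->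
  m = 2 * f2 * (v' * (2 * b) + 2 * v * (2 * b') - 2^-1 * (2 * b3)) ->
  w0 = 2 * ((1 * (2^-1 * (z * z)) + 0) * g0' + 2^-1 * (1 * (2^-1 * (z' * z + z * z'))) * g0)
        + 0 * g03 ->
  w1 = 4 * ((1 * u + 0) * a' + 2^-1 * (1 * u') * a) + -1 * a3 ->
  w2 = 4 * ((1 * v + 0) * b' + 2^-1 * (1 * v') * b) + -1 * b3 ->
  (s + p + m) / 2 = f0 * w0 + f1 * w1 + f2 * w2.
Proof.
have h2 := two_neq0 K => rr -> -> -> -> -> ->.
have -> : r * (z * f0) * (r * (z' * g0 + z * g0')) = (r * r) * (z * f0 * (z' * g0 + z * g0')).
  by ring.
by rewrite rr; field.
Qed.

Lemma block_op2 (u h : R -> C) x : smooth h -> block_op u (fun y => 2 * h y) x =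
  dx u x * (2 * h x) + 2 * u x * (2 * dx h x) - 2^-1 * (2 * dx (dx (dx h)) x).
Proof.
move=> sh; have s1 := smooth_dx sh; have s2 := smooth_dx s1.
by rewrite /block_op (dxZ 2 sh) (dxZ 2 s1) (dxZ 2 s2).
Qed.

Lemma vop_at n (bt b : 'M[C]_n) c kap mu nu q (t g : R -> 'rV[C]_n) (p p' : R -> C) :
  mloop t -> cpt bt q t = p -> dx p = p' -> forall x,
  vop bt b c kap mu nu q t g x =
  c q * ((nu * p x + mu q) * dx (cpt b q g) x + 2^-1 * (nu * p' x) * cpt b q g x)
  + kap q * dx (dx (dx (cpt b q g))) x.
Proof. by move=> lt <- <- x; rewrite /vop /virop dx_phi. Qed.

Local Notation P2 := (vir (btN : 'M[C]_3) bN cN kapN 1 (fun=> 0)).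

(** The chain rule: dt_2 and dt_1 both contain z_2 dz_2, which accounts for the
    factor z_2 in the last component. *)
Lemma gradient_comps z f : let v x := f x *m tjac (z x) in
  [/\ top1 v = fun x => 2 * cpt bN 1 f x, top2 v = fun x => 2 * cpt bN 2 f x &
      trace1 v = fun x => sqrtC 2 * (z x 0 1 * cpt bN 0 f x)].
Proof.
move=> v; have h2 := two_neq0 C.
have vE x : [/\ v x 0 0 = f x 0 0, v x 0 1 = z x 0 1 * (f x 0 0 + f x 0 1) &
    v x 0 2 = f x 0 2].
  by rewrite /v tjacE !mxE !sum3 !mxE /=; split; ring.
split; apply/funext => x; have [v0 v1 v2] := vE x; have [l0 l1 l2] := lin_bN (f x).
- by rewrite /top1 v0 v2 /cpt l1; field.
- by rewrite /top2 v0 v2 /cpt l2; field.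
- by rewrite /trace1 v1 /cpt l0.
Qed.

(** The decoupling coordinates along a loop in N are z_2^2/2 and the two KdV potentials. *)
Lemma cpt_tmap z : let t x := tmap (z x) in
  [/\ cpt btN 0 t = fun x => 2^-1 * (z x 0 1 * z x 0 1), cpt btN 1 t = pot1 z &
      cpt btN 2 t = pot2 z].
Proof.
move=> t; split; apply/funext => x; have [l0 l1 l2] := lin_btN (t x).
- by rewrite /cpt l0 mxE.
- by rewrite /cpt l1 !mxE /= /pot1; ring.
- by rewrite /cpt l2 !mxE /= /pot2; ring.
Qed.

Lemma tmap_loop z : mloop z -> mloop (fun x => tmap (z x)).
Proof.
move=> /rloopP lz; have sq := smoothZ 2^-1 (smoothM (lz 1) (lz 1)).
apply/rloopP; apply: forall3.
- by apply: eq_smooth (smoothD (lz 0) sq) => x; rewrite mxE.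
- by apply: eq_smooth sq => x; rewrite mxE.
- by apply: eq_smooth (lz 2) => x; rewrite mxE.
Qed.

Lemma represents_vir : represents_bracketN P2.
Proof.
move=> z f g F G lz _ lf lg hF hG.
have lt := tmap_loop lz; set t := fun x => tmap (z x) in lt *.
have [p0 p1 p2] := cpt_tmap z; rewrite -/t in p0 p1 p2.
have [fp fm fs] := gradient_comps z f; have [gp gm gs] := gradient_comps z g.
have s0 := cpt_smooth bN 0 lg; have s1 := cpt_smooth bN 1 lg; have s2 := cpt_smooth bN 2 lg.
have sz : smooth (fun x => z x 0 1) by move/rloopP: lz.
have sv q : smooth (fun x => cpt bN q f x * vop btN bN cN kapN (fun=> 0) 1 q t g x).
  by apply: smoothM; [exact: cpt_smooth|exact: vop_smooth].
rewrite (bracketNE lz hF hG).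
rewrite (lb_pair_vir _ _ _ _ _ _ _ lt lg) (pairing_ham _ _ _ _ _ _ lf lt lg) sum3.
refine (etrans _ (etrans (cintD (smoothD (sv 0) (sv 1)) (sv 2))
  (congr1 (fun y => y + _) (cintD (sv 0) (sv 1))))).
apply: eq_cint => x.
refine (integrand_alg (r := sqrtC 2) _ _ _ _ (g03 := dx (dx (dx (cpt bN 0 g))) x) _ _ _).
- by rewrite -expr2 sqrtCK.
- by rewrite fs gs (dxZ _ (smoothM sz s0)) (dxM sz s0).
- by rewrite fp gp (block_op2 _ x s1).
- by rewrite fm gm (block_op2 _ x s2).
- exact: vop_at lt p0 (etrans (dxZ _ (smoothM sz sz))
    (congr1 (fun h (x : R) => 2^-1 * h x) (dxM sz sz))) x.
- exact: vop_at lt p1 erefl x.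
- exact: vop_at lt p2 erefl x.
Qed.

End Representation.

(** * The theorem *)

Theorem mainTheorem3 (R : realType) :
  let U : set 'rV[R[i]]_3 := tdom in
  let e : 'rV[R[i]]_3 := delta_mx 0 1 in
  @mixed_brackets_vanish R /\
  exists P2 : bracket_expr R[i] 3,
  let P1 := lb_lie 1 P2 in
  let O1 := lie_bivector (fun=> e) (lead P2 1) in
  [/\ is_local P2 /\ represents_bracketN P2,
      (* (1) *)
      (forall z : 'rV[R[i]]_3, z 0 1 != 0 ->
        tjac z \in unitmx /\ evec z *m (tjac z)^T = e) /\
      [/\ dispersionless U P2,
          forall t, U t -> lead P2 2 t = 0,
          forall t, U t -> lead P2 1 t = Omega2 t &
          forall t, U t -> lead P2 3 t = S22],
      (* (2) *)
      [/\ lb_eq0 U (lb_lie 1 (lb_lie 1 P2)),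
          exact_poisson_pencil U 1 P2 P1,
          dispersionless U P2 & dispersionless U P1],
      (* (3) *)
      (forall t, U t -> O1 t = Omega1 /\ lead P1 1 t = O1 t) /\
      [/\ regular_qh_flat_pencil U (lead P2 1) O1 0,
          frobenius_manifold U FF 1 Omega1 (fun t => t) 0,
          forall t, U t -> intersection_form FF Omega1 (fun t => t) t = lead P2 1 t,
          forall t, U t -> euler_action (fun t => t) FF t = 3 * FF t &
          trivial_frobenius U FF 1 Omega1] &
      (* (4) *)
      (exists r, central_invariants U P2 P1 r
         (fun i _ => [:: 0; - 48^-1; - 48^-1]`_i)) /\
      ~ topological_type U P2 P1].
Proof.
move=> U e; split; first exact: mixed_brackets.
have oU := open_tdom (K := R[i]).
have d := dualN (K := R[i]); have c0 := cN_neq0 (K := R[i]); have m0 := mN_neq0 (K := R[i]).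
exists (vir btN bN cN kapN 1 (fun=> 0)) => P1 O1.
have P1E : P1 = vir btN bN cN (fun=> 0) 0 mN.
  by rewrite /P1 lie_vir; congr vir; apply/funext => q; rewrite mul1r mNE.
have O1E : O1 = dmetric btN bN cN 0 mN.
  apply/funext => t; rewrite /O1 lead_vir1 lie_const_dmetric; congr (dmetric _ _ _ 0 _ t).
  by apply/funext => q; rewrite mul1r lin_delta mNE.
split.
- by split; [exact: vir_local|exact: represents_vir].
- split; first by move=> z z0; split; [exact: tjac_unit|exact: evecE].
  split=> t _.
  + exact: lead_vir0.
  + exact: lead_vir2.
  + by rewrite lead_vir1 dmetricN.
  + by rewrite lead_vir3 kapNE.
- split.
  + rewrite -/P1 P1E lie_vir (_ : (fun q => 0 * btN q 1) = fun=> 0); first exact: lb_eq0_vir.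
    by apply/funext => q; rewrite mul0r.
  + exact: exact_pencil_vir.
  + by move=> t _; exact: lead_vir0.
  + by rewrite P1E => t _; exact: lead_vir0.
- split; first by move=> t _; rewrite O1E P1E lead_vir1 dmetric_unitN.
  split.
  + rewrite O1E lead_vir1; exact: (regular_qh_decoupled d c0 m0 oU).
  + exact: frobeniusN.
  + by move=> t _; rewrite lead_vir1; exact: intersectionN.
  + by move=> t _; exact: eulerN.
  + exact: trivialN.
- rewrite P1E; split; last exact: not_topologicalN.
  by exists (root_vir btN mN); exact: (central_invariantsN oU).
Qed.
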